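(* The weak (resp. full) opacity with respect to the first $N$ observations decision problem, restricted to discrete-time timed automata, is co-NEXPTIME-complete.
   Context: A timed automaton (TA) is a tuple $\mathcal{A}=(\Sigma,L,\ell_0,L_{priv},L_f,X,I,E)$ where $\Sigma$ is a finite set of actions, $L$ a finite set of locations, $\ell_0\in L$ the initial location, $L_{priv}\subseteq L$ the set of private locations, $L_f\subseteq L$ the set of final locations, $X$ a finite set of clocks, $I$ assigns to each location an invariant, and $E$ is a finite set of edges $(\ell,g,a,R,\ell')$ with $\ell,\ell'\in L$, $a\in\Sigma\cup\{\varepsilon\}$ (where $\varepsilon$ is an unobservable action), $R\subseteq X$ the set of clocks to reset, and $g$ a guard. Invariants and guards are conjunctions of constraints $x\bowtie d$ with $x\in X$, $d\in\mathbb{Z}$, ${\bowtie}\in\{<,\le,=,\ge,>\}$. In the discrete-time semantics, clock valuations are maps $\mu:X\to\mathbb{N}$ and delays are in $\mathbb{N}$: a configuration is a pair $(\ell,\mu)$ with $\mu\models I(\ell)$; the initial configuration is $(\ell_0,\mathbf{0})$; a delay $d\in\mathbb{N}$ leads from $(\ell,\mu)$ to $(\ell,\mu+d)$ provided $\mu+d'\models I(\ell)$ for all $d'\in\{0,\dots,d\}$; an edge $(\ell,g,a,R,\ell')$ leads from $(\ell,\mu)$ to $(\ell',\mu')$ if $\mu\models g$, $\mu'$ is $\mu$ with the clocks of $R$ set to $0$, and $\mu'\models I(\ell')$. A run is a finite sequence $(\ell_0,\mu_0),(d_0,e_0),(\ell_1,\mu_1),\dots,(\ell_n,\mu_n)$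 starting in the initial configuration, where each step is a delay $d_i$ followed by taking edge $e_i$, with $\ell_n\in L_f$ and $\ell_i\notin L_f$ for $i<n$. The trace of a run is the timed word consisting, in order, of the pairs $(a_i,\sum_{j\le i}d_j)$ for the edges $e_i$ whose action $a_i$ is not $\varepsilon$. A run is private if it visits some location of $L_{priv}$ and public otherwise; $\mathrm{PrivTr}(\mathcal{A})$ and $\mathrm{PubTr}(\mathcal{A})$ denote the sets of traces of private, resp. public, runs. For $N\in\mathbb{N}$ and a timed word $w$, let $\pi_N(w)$ be the prefix of $w$ consisting of its first $\min(N,|w|)$ letters. The weak (resp. full) opacity with respect to the first $N$ observations decision problem asks, given a TA $\mathcal{A}$ and $N$ (in binary), whether $\pi_N(\mathrm{PrivTr}(\mathcal{A}))\subseteq\pi_N(\mathrm{PubTr}(\mathcal{A}))$ (resp. whether $\pi_N(\mathrm{PrivTr}(\mathcal{A}))=\pi_N(\mathrm{PubTr}(\mathcal{A}))$). *)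

(* Defs.v *)
From HB Require Import structures.
From mathcomp Require Import all_boot all_order all_algebra.

Set Implicit Arguments.
Unset Strict Implicit.
Unset Printing Implicit Defensive.

Local Open Scope nat_scope.

Inductive cmp := CmpLt | CmpLe | CmpEq | CmpGe | CmpGt.

Definition nat_of_cmp (c : cmp) : nat :=
  match c with
  | CmpLt => 0 | CmpLe => 1 | CmpEq => 2 | CmpGe => 3 | CmpGt => 4
  end.

Definition cmp_of_nat (n : nat) : option cmp :=
  ohead (drop n [:: CmpLt; CmpLe; CmpEq; CmpGe; CmpGt]).

Lemma nat_of_cmpK : pcancel nat_of_cmp cmp_of_nat.
Proof. by case. Qed.

HB.instance Definition _ := Equality.copy cmp (pcan_type nat_of_cmpK).

Definition cmp_sem (c : cmp) (x y : int) : bool :=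
  match c with
  | CmpLt => (x < y)%R
  | CmpLe => (x <= y)%R
  | CmpEq => x == y
  | CmpGe => (x >= y)%R
  | CmpGt => (x > y)%R
  end.

(* The constraint [x c d] is the triple [(x, c, d)]; a guard or an invariant is
   the conjunction of a list of constraints. *)
Definition constraint (Clk : eqType) : Type := (Clk * cmp * int)%type.
Definition guard (Clk : eqType) : Type := seq (constraint Clk).

Section TimedAutomata.

Variables Act Loc Clk : finType.

(* The action [None] is the unobservable action epsilon. *)
Record edge := Edge {
  src : Loc;
  eguard : guard Clk;
  eact : option Act;
  resets : {set Clk};
  tgt : Loc
}.

Definition tuple_of_edge (e : edge) :=
  (src e, eguard e, eact e, resets e, tgt e).

Definition edge_of_tuple
    (t : Loc * guard Clk * option Act * {set Clk} * Loc) : edge :=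
  let: (l, g, a, R, l') := t in Edge l g a R l'.

Lemma tuple_of_edgeK : cancel tuple_of_edge edge_of_tuple.
Proof. by case. Qed.

HB.instance Definition _ := Equality.copy edge (can_type tuple_of_edgeK).

(* Only membership in the list [edges] is ever used: it stands for the finite
   set of its elements. *)
Record TA := MkTA {
  init_loc : Loc;
  private_locs : {set Loc};
  final_locs : {set Loc};
  loc_inv : {ffun Loc -> guard Clk};
  edges : seq edge
}.

Definition valuation : Type := {ffun Clk -> nat}.

Definition sat (mu : valuation) (g : guard Clk) : bool :=
  all (fun xcd : constraint Clk =>
         let: (x, c, d) := xcd in cmp_sem c (mu x)%:Z d) g.

Definition elapse (mu : valuation) (d : nat) : valuation :=
  [ffun x => mu x + d].

Definition reset (R : {set Clk}) (mu : valuation) : valuation :=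
  [ffun x => if x \in R then 0 else mu x].

Variable A : TA.

Definition config : Type := (Loc * valuation)%type.

Definition init_config : config := (init_loc A, [ffun=> 0]).

Definition in_inv (c : config) : bool := sat c.2 (loc_inv A c.1).

Definition timed_step : Type := (nat * edge)%type.

Definition succ_config (c : config) (m : timed_step) : config :=
  (tgt m.2, reset (resets m.2) (elapse c.2 m.1)).

Definition enabled (c : config) (m : timed_step) : bool :=
  [&& m.2 \in edges A,
      src m.2 == c.1,
      [forall d' : 'I_m.1.+1, in_inv (c.1, elapse c.2 d')],
      sat (elapse c.2 m.1) (eguard m.2)
    & in_inv (succ_config c m)].

Fixpoint feasible (c : config) (r : seq timed_step) : bool :=
  if r is m :: r' then enabled c m && feasible (succ_config c m) r' else true.

(* The intermediate configurations are determined by the delays and edges, so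
   that a run is represented by its sequence of timed steps. *)
Definition tail_locs (r : seq timed_step) : seq Loc := [seq tgt m.2 | m <- r].

Definition is_run (r : seq timed_step) : bool :=
  [&& in_inv init_config,
      feasible init_config r,
      last (init_loc A) (tail_locs r) \in final_locs A
    & all (fun l => l \notin final_locs A)
          (belast (init_loc A) (tail_locs r))].

Definition is_private (r : seq timed_step) : bool :=
  has (fun l => l \in private_locs A) (init_loc A :: tail_locs r).

Definition timed_word : Type := seq (Act * nat).

Fixpoint trace_from (t : nat) (r : seq timed_step) : timed_word :=
  if r is (d, e) :: r' then
    if eact e is Some a then (a, t + d) :: trace_from (t + d) r'
    else trace_from (t + d) r'
  else [::].

Definition trace (r : seq timed_step) : timed_word := trace_from 0 r.

Definition PrivTr (w : timed_word) : Prop :=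
  exists r, [/\ is_run r, is_private r & w = trace r].

Definition PubTr (w : timed_word) : Prop :=
  exists r, [/\ is_run r, ~~ is_private r & w = trace r].

Definition first_obs (N : nat) (T : timed_word -> Prop) (w : timed_word) : Prop :=
  exists2 v, T v & w = take N v.

Definition weakly_opaque (N : nat) : Prop :=
  forall w, first_obs N PrivTr w -> first_obs N PubTr w.

Definition fully_opaque (N : nat) : Prop :=
  forall w, first_obs N PrivTr w <-> first_obs N PubTr w.

End TimedAutomata.

Inductive direction := ToLeft | Stay | ToRight.

(* [None] is the blank, [Some (inl b)] an input/output bit and [Some (inr g)] an
   auxiliary symbol. *)
Definition symbol (G : finType) : Type := option (bool + G).

(* A two-way infinite tape; [tleft] is listed from the head outwards, and the
   cells not represented are blank. *)
Record tape (G : finType) := Tape {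
  tleft : seq (symbol G);
  thead : symbol G;
  tright : seq (symbol G)
}.

Definition tape_of (G : finType) (s : seq (symbol G)) : tape G :=
  Tape [::] (head None s) (behead s).

Definition tape_act (G : finType) (t : tape G) (a : symbol G * direction) :
    tape G :=
  let: (s, d) := a in
  match d with
  | ToLeft => Tape (behead (tleft t)) (head None (tleft t)) (s :: tright t)
  | Stay => Tape (tleft t) s (tright t)
  | ToRight => Tape (s :: tleft t) (head None (tright t)) (behead (tright t))
  end.

(* There are [ntapes.+1] tapes: the input is on the first one, the output on the
   last one. *)
Record NTM := MkNTM {
  ntapes : nat;
  aux : finType;
  state : finType;
  start : state;
  accept : {set state};
  delta : state -> {ffun 'I_ntapes.+1 -> symbol aux} ->
          state * {ffun 'I_ntapes.+1 -> symbol aux * direction} -> bool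
}.

Section Machine.

Variable M : NTM.

Definition tm_config : Type :=
  (state M * {ffun 'I_(ntapes M).+1 -> tape (aux M)})%type.

Definition tm_init (w : seq bool) : tm_config :=
  (start M,
   [ffun i => tape_of (if i == ord0 then [seq Some (inl b) | b <- w] else [::])]).

Definition tm_step (c c' : tm_config) : Prop :=
  exists2 qa, delta c.1 [ffun i => thead (c.2 i)] qa &
    c' = (qa.1, [ffun i => tape_act (c.2 i) (qa.2 i)]).

Fixpoint tm_reach (n : nat) (c c' : tm_config) : Prop :=
  if n is n'.+1 then exists2 c1, tm_step c c1 & tm_reach n' c1 c' else c = c'.

Definition tm_halted (c : tm_config) : Prop := forall c', ~ tm_step c c'.

Definition deterministic : Prop :=
  forall q s a a', delta q s a -> delta q s a' -> a = a' :> state M * _.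

Fixpoint leading_bits (s : seq (symbol (aux M))) : seq bool :=
  if s is Some (inl b) :: s' then b :: leading_bits s' else [::].

Definition tm_output (c : tm_config) : seq bool :=
  let t := c.2 ord_max in leading_bits (thead t :: tright t).

End Machine.

Definition language : Type := seq bool -> Prop.

(* Every computation on [w], accepting or not, has at most [T (size w)] steps. *)
Definition decides_in_time (M : NTM) (T : nat -> nat) (P : language) : Prop :=
  (forall w n c, tm_reach n (tm_init M w) c -> n <= T (size w)) /\
  (forall w, P w <->
     exists n c, [/\ tm_reach n (tm_init M w) c, tm_halted c & c.1 \in accept M]).

Definition NEXPTIME (P : language) : Prop :=
  exists (M : NTM) (p : {poly nat}),
    decides_in_time M (fun n => 2 ^ (p.[n])%R) P.

Definition coNEXPTIME (P : language) : Prop := NEXPTIME (fun w => ~ P w).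

Definition polytime_computable (f : seq bool -> seq bool) : Prop :=
  exists (M : NTM) (p : {poly nat}), deterministic M /\
    forall w, exists n c,
      [/\ tm_reach n (tm_init M w) c, tm_halted c, n <= (p.[size w])%R
        & tm_output c = f w].

Definition polytime_reducible (P Q : language) : Prop :=
  exists2 f, polytime_computable f & forall w, P w <-> Q (f w).

Definition complete_for (C : language -> Prop) (P : language) : Prop :=
  C P /\ forall Q, C Q -> polytime_reducible Q P.

(* Up to renaming, actions, locations and clocks are numbered. *)
Record instance := MkInstance {
  nact : nat;
  nloc : nat;
  nclk : nat;
  automaton : TA 'I_nact 'I_nloc 'I_nclk;
  nobs : nat
}.

(* All the encodings below are prefix-free, so that they can be concatenated.
   The finite sets of actions, locations and clocks have to be listed, hence
   their cardinals count in unary; all other numbers (the constants of the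
   constraints and the number of observations, notably) are in binary. *)

Definition enc_unary (n : nat) : seq bool := nseq n true ++ [:: false].

Definition enc_seq (T : Type) (enc : T -> seq bool) (s : seq T) : seq bool :=
  foldr (fun x r => true :: enc x ++ r) [:: false] s.

Definition enc_bool (b : bool) : seq bool := [:: b].

(* Least significant digit first. *)
Definition binary_digits (n : nat) : seq bool :=
  [seq odd (n %/ 2 ^ i) | i <- iota 0 (trunc_log 2 n).+1].

Definition enc_nat (n : nat) : seq bool := enc_seq enc_bool (binary_digits n).

Definition enc_int (z : int) : seq bool := (z < 0)%R :: enc_nat `|z|%N.

Definition enc_set (n : nat) (S : {set 'I_n}) : seq bool :=
  enc_seq enc_bool [seq i \in S | i <- enum 'I_n].

Definition enc_option (T : Type) (enc : T -> seq bool) (o : option T) : seq bool :=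
  if o is Some x then true :: enc x else [:: false].

Definition enc_constraint (n : nat) (xcd : constraint 'I_n) : seq bool :=
  let: (x, c, d) := xcd in enc_nat x ++ enc_nat (nat_of_cmp c) ++ enc_int d.

Definition enc_guard (n : nat) (g : guard 'I_n) : seq bool :=
  enc_seq (@enc_constraint n) g.

Definition enc_edge (na nl nc : nat) (e : edge 'I_na 'I_nl 'I_nc) : seq bool :=
  enc_nat (src e) ++ enc_guard (eguard e) ++
  enc_option (fun a : 'I_na => enc_nat a) (eact e) ++
  enc_set (resets e) ++ enc_nat (tgt e).

Definition enc_TA (na nl nc : nat) (A : TA 'I_na 'I_nl 'I_nc) : seq bool :=
  enc_unary na ++ enc_unary nl ++ enc_unary nc ++
  enc_nat (init_loc A) ++ enc_set (private_locs A) ++ enc_set (final_locs A) ++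
  enc_seq (@enc_guard nc) [seq loc_inv A l | l <- enum 'I_nl] ++
  enc_seq (@enc_edge na nl nc) (edges A).

Definition enc_instance (i : instance) : seq bool :=
  enc_TA (automaton i) ++ enc_nat (nobs i).

Definition problem (positive : instance -> Prop) : language :=
  fun w => exists2 i, enc_instance i = w & positive i.

Definition WeakFirstObsOpacity : language :=
  problem (fun i => weakly_opaque (automaton i) (nobs i)).

Definition FullFirstObsOpacity : language :=
  problem (fun i => fully_opaque (automaton i) (nobs i)).

(* Main.v *)
(* Membership: after truncation of the clock values to a number C above all the
   constants, an automaton with an instance of size n has 2 ^ poly(n) configurations,
   split further by whether a private location was visited. An opacity violation is
   a sequence of at most N pairs (delay, action) which labels the first N
   observations of a run of one kind and of no run of the other kind. Its delays
   can be taken below 2 ^ |V| for V the list of truncated configurations, because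
   the set of configurations reached after k time units takes at most 2 ^ |V|
   values; in binary they have |V| bits. So the violation has size 2 ^ poly(n), and
   it is checked in time polynomial in this size, iterating the one-time-unit
   relation by repeated squaring: non-opacity is in NEXPTIME.

   Hardness: given a machine running in time less than 2 ^ m on w, a timed word
   describes an accepting computation by one letter (state, symbols read, action)
   every P = 2 ^ (m + 1) + 1 time units. All the words are traces of private runs;
   a public run guesses an error of the word, and the instance, with N = 2 ^ m, is
   opaque iff every word contains an error, since an accepting computation has less
   than N steps. One clock checks the times of the letters. Another one
   follows a single cell of one tape, whose content is in the location: its value at
   the letters is H = 2 ^ m + 1 minus the position of the cell relative to the head,
   a move of the head being applied by resetting it when it reaches P - 1, P or
   P + 1. The automaton has a fixed set of locations, and only its constants and
   the |w| edges which initialize the followed cell depend on w. *)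
From HB Require Import structures.
Require Import Defs.
From mathcomp Require Import all_boot all_order all_algebra.
From mathcomp Require Import zify.
From Stdlib Require Import Classical.
Set Implicit Arguments.
Unset Strict Implicit.
Unset Printing Implicit Defensive.
Import GRing.Theory.
Local Open Scope nat_scope.

(** * Stack programs and their execution by Turing machines *)

(** Both halves must end in genuine multi-tape machines, and [decides_in_time] bounds every branch.
    So a language on four stacks is compiled to machines once and for all, with nondeterminism
    turned into an oracle string read by an otherwise deterministic program. Membership then needs
    only a certificate of length exactly [2 ^ q n], guessed in full before a deterministic check;
    closure properties of [FP] stand in for programming. [FP] codes numbers in unary. The verifier
    can afford it: its certificate is exponentially long and itself supplies the truncation bound
    and the list of configurations, which are merely checked. The reduction cannot, so it writes
    powers of two digit by digit. Words that encode no instance belong to the complement, so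
    decoding has to be exact. In the reduction, [2 ^ m] exceeds every distance between the head and
    a relevant cell. For [|k| <= 2 ^ m] the date [2 ^ m + k] after a letter falls before the next
    letter, and a clock reset at that date shows [period - (2 ^ m + k) = mark - k] at that letter.
    Since every word with nondecreasing dates is a private trace, weak and full opacity coincide
    there. *)

Definition nat_of_dir (d : direction) : 'I_3 :=
  match d with ToLeft => inord 0 | Stay => inord 1 | ToRight => inord 2 end.

Definition dir_of_nat (i : 'I_3) : direction :=
  match val i with 0 => ToLeft | 1 => Stay | _ => ToRight end.

Lemma nat_of_dirK : cancel nat_of_dir dir_of_nat.
Proof. by case; rewrite /dir_of_nat /= inordK. Qed.

HB.instance Definition _ := Finite.copy direction (can_type nat_of_dirK).

(** [T0] receives the input and holds the values, [T1] and [T2] are scratch, and [T3] carries most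
    loop flags. Being the last tape of the machine, [T3] also delivers the output. *)
Inductive reg := T0 | T1 | T2 | T3.

(* [orc] supplies the outcomes of the nondeterministic choices. *)
Record st := St { r0 : seq bool; r1 : seq bool; r2 : seq bool; r3 : seq bool;
                  orc : seq bool }.

Definition get (t : reg) (s : st) : seq bool :=
  match t with T0 => r0 s | T1 => r1 s | T2 => r2 s | T3 => r3 s end.

Definition set (t : reg) (x : seq bool) (s : st) : st :=
  let: St a b c d o := s in
  match t with
  | T0 => St x b c d o | T1 => St a x c d o
  | T2 => St a b x d o | T3 => St a b c x o
  end.

Definition seto (o : seq bool) (s : st) : st :=
  let: St a b c d _ := s in St a b c d o.

Lemma set_get t s : set t (get t s) s = s.
Proof. by case: s; case: t. Qed.

Lemma set_seto t x o s : set t x (seto o s) = seto o (set t x s).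
Proof. by case: s; case: t. Qed.

Lemma seto_seto o o' s : seto o (seto o' s) = seto o s.
Proof. by case: s. Qed.

Lemma orc_seto o s : orc (seto o s) = o.
Proof. by case: s. Qed.

Inductive instr :=
| IPush of reg & option bool
| IPop of reg & nat & nat & nat
| IJmp of nat.

(* [None] pushes the next oracle bit. *)
Definition do_push (t : reg) (ob : option bool) (s : st) : st :=
  match ob with
  | Some b => set t (b :: get t s) s
  | None => set t (head false (orc s) :: get t s) (seto (behead (orc s)) s)
  end.

Definition fstep (code : seq instr) (x : nat * st) : option (nat * st) :=
  let: (pc, s) := x in
  match onth code pc with
  | None => None
  | Some (IPush t ob) => Some (pc.+1, do_push t ob s)
  | Some (IPop t j0 j1 je) =>
      match get t s with
      | [::] => Some (je, s)
      | b :: r => Some (if b then j1 else j0, set t r s)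
      end
  | Some (IJmp j) => Some (j, s)
  end.

Fixpoint fsteps (code : seq instr) (n : nat) (x y : nat * st) : Prop :=
  if n is n'.+1 then exists2 z, fstep code x = Some z & fsteps code n' z y
  else x = y.

Lemma fsteps_trans code n m x y z :
  fsteps code n x y -> fsteps code m y z -> fsteps code (n + m) x z.
Proof.
elim: n x => [|n IH] x /=; first by move=> ->.
by case=> w xw wy yz; exists w => //; apply: IH.
Qed.

Lemma fsteps_halt code n m x y z :
  fsteps code n x y -> fsteps code m x z -> fstep code z = None ->
  n <= m /\ fsteps code (m - n) y z.
Proof.
elim: n m x => [|n IH] m x /=; first by move=> <- H _; rewrite subn0.
case=> w xw wy; case: m => [|m] /=; first by move=> <-; rewrite xw.
by case=> w'; rewrite xw => -[<-] wz hz; rewrite subSS ltnS; apply: (IH m w).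
Qed.

Section FlatMachine.

Variables (code : seq instr) (acc : nat).

Definition itarget (i : instr) : nat :=
  match i with
  | IPush _ _ => 0 | IPop _ j0 j1 je => maxn j0 (maxn j1 je) | IJmp j => j
  end.

(** Bounds [acc], every jump target and the first address past the code, so that [inord] loses
    nothing on the program counters that occur. *)
Definition pcmax : nat := maxn acc (maxn (size code) (\max_(i <- code) itarget i)).

Definition ord_of (t : reg) : 'I_4 :=
  match t with T0 => inord 0 | T1 => inord 1 | T2 => inord 2 | T3 => inord 3 end.

(** The head stays on the top of the stack, so a push needs two steps: move left onto a blank, then
    write. The Boolean of the state marks the second half. A guessing push leaves the written bit
    [b] free, and this is the only nondeterminism. *)
Definition machine_delta (q : 'I_pcmax.+1 * bool) (a : {ffun 'I_4 -> symbol void})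
    (qa : 'I_pcmax.+1 * bool * {ffun 'I_4 -> symbol void * direction}) : bool :=
  let: (q', act) := qa in
  match onth code (val q.1) with
  | None => false
  | Some (IPush t ob) =>
    if q.2 then
      (q' == (inord (val q.1).+1, false)) &&
      [exists b : bool, (if ob is Some b' then b == b' else true) &&
         (act == [ffun i => (if i == ord_of t then Some (inl b) else a i, Stay)])]
    else (q' == (q.1, true)) &&
         (act == [ffun i => (a i, if i == ord_of t then ToLeft else Stay)])
  | Some (IPop t j0 j1 je) =>
    (q' == (inord (match a (ord_of t) with
                   | Some (inl b) => if b then j1 else j0
                   | _ => je end), false)) &&
    (act == [ffun i => if i == ord_of t then (None, ToRight) else (a i, Stay)])
  | Some (IJmp j) =>
    (q' == (inord j, false)) && (act == [ffun i => (a i, Stay)])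
  end.

Definition machine : NTM :=
  @MkNTM 3 void ('I_pcmax.+1 * bool)%type (ord0, false)
    [set q | val q.1 == acc] machine_delta.

(** The amount of blank padding is left open on both sides: each pop leaves a blank behind on the
    left, and popping an empty stack walks right over blanks. *)
Definition rep (t : tape void) (s : seq bool) : Prop :=
  (exists k, tleft t = nseq k None) /\
  (exists k, Defs.thead t :: tright t = [seq Some (inl b) | b <- s] ++ nseq k None).

Definition repc (c : tm_config machine) (x : nat * st) : Prop :=
  [/\ c.1 = (inord x.1, false), x.1 <= pcmax
    & forall t, rep (c.2 (ord_of t)) (get t x.2)].

Lemma ord_of_inj : injective ord_of.
Proof. by case; case => //= /(congr1 val); rewrite /= !inordK. Qed.

Lemma get_set t t' x s :
  get t (set t' x s) = if ord_of t == ord_of t' then x else get t s.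
Proof.
case: eqP => [/ord_of_inj -> | ]; first by case: s; case: t'.
by case: s => a b c d o; case: t; case: t'.
Qed.

Lemma get_seto t o s : get t (seto o s) = get t s.
Proof. by case: s; case: t. Qed.

Lemma head_rep t s : rep t s ->
  Defs.thead t = if s is b :: _ then Some (inl b) else None.
Proof. by case=> _ [k]; case: s => [|b s] /=; [case: k => [|k] //; case|case]. Qed.

Lemma rep_stay t s : rep t s -> rep (tape_act t (Defs.thead t, Stay)) s.
Proof. by case: t. Qed.

Lemma rep_pop t s : rep t s -> rep (tape_act t (None, ToRight)) (behead s).
Proof.
case: t => l h r [[k /= ->]] [k' /=] E; split; first by exists k.+1.
case: s E => [|b s] /= E.
  case: k' E => [|k'] // [_ ->]; case: k' => [|k'] /=; first by exists 1.
  by exists k'.+1.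
case: E => _ ->; case: s => [|b' s] /=; last by exists k'.
by case: k' => [|k']; [exists 1|exists k'.+1].
Qed.

Lemma rep_push t s b : rep t s ->
  rep (tape_act (tape_act t (Defs.thead t, ToLeft)) (Some (inl b), Stay)) (b :: s).
Proof.
case: t => l h r [[k /= ->]] [k' /=] E; split => /=; first by case: k => [|k]; [exists 0|exists k].
by exists k'; rewrite E.
Qed.

Lemma pc_bound x y : x.1 <= pcmax -> fstep code x = Some y -> y.1 <= pcmax.
Proof.
case: x => pc s /= Hpc; case E: (onth code pc) => [i|//].
have /onthP-Hin : exists k, onth (map itarget code) k = Some (itarget i).
  by exists pc; rewrite onth_map E.
have Hi : itarget i <= pcmax.
  rewrite /pcmax; apply: leq_trans (leq_maxr _ _); apply: leq_trans (leq_maxr _ _).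
  by rewrite -(big_map itarget predT id); apply: leq_bigmax_seq.
have Hlt : pc < size code by rewrite -onthTE E.
have Hs : pc.+1 <= pcmax.
  apply: leq_trans Hlt _; rewrite /pcmax.
  by apply: leq_trans (leq_maxr _ _); apply: leq_maxl.
case: i E Hi {Hin} => [t ob|t j0 j1 je|j] E /=.
- by move=> _ [<-].
- rewrite !geq_max => /and3P[H0 H1 He].
  by case: (get t s) => [|b r] [<-] //=; case: b.
- by move=> Hj [<-].
Qed.

Lemma step_det c x y : repc c x -> fstep code x = Some y ->
  exists k c', [/\ 0 < k <= 2, @tm_reach machine k c c' & repc c' y].
Proof.
move=> [E1 Hpc Hrep] Hy; have Hpy := pc_bound Hpc Hy.
case: x E1 Hpc Hrep Hy => pc s /= E1 Hpc Hrep.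
case E: (onth code pc) => [[t ob|t j0 j1 je|j]|//].
- case=> Ey; pose b := if ob is Some b then b else head false (orc s).
  pose c1 : tm_config machine :=
    ((inord pc, true), [ffun i => tape_act (c.2 i) (Defs.thead (c.2 i), if i == ord_of t then ToLeft else Stay)]).
  pose c2 : tm_config machine :=
    ((inord pc.+1, false), [ffun i => tape_act (c1.2 i) (if i == ord_of t then Some (inl b) else Defs.thead (c1.2 i), Stay)]).
  exists 2, c2; split => //; [|split; rewrite -Ey //=].
  + exists c1; last exists c2 => //.
    * exists ((inord pc, true), [ffun i => (Defs.thead (c.2 i), if i == ord_of t then ToLeft else Stay)]).
        rewrite /= /machine_delta E1 /= inordK // E eqxx /=.
        by apply/eqP/ffunP => i; rewrite !ffunE.
      by congr (_, _); apply/ffunP => i; rewrite !ffunE.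
    * exists ((inord pc.+1, false), [ffun i => (if i == ord_of t then Some (inl b) else Defs.thead (c1.2 i), Stay)]).
        rewrite /= /machine_delta /= inordK // E eqxx /=.
        apply/existsP; exists b; apply/andP; split.
          by rewrite /b; case: (ob).
        by apply/eqP/ffunP => i; rewrite !ffunE.
      by congr (_, _); apply/ffunP => i; rewrite !ffunE.
  + by rewrite -Ey in Hpy.
  + move=> t'; rewrite !ffunE.
    have -> : get t' (do_push t ob s) = if ord_of t' == ord_of t then b :: get t s else get t' s.
      by rewrite /do_push /b; case: (ob) => [b'|]; rewrite get_set ?get_seto.
    case: eqP => [->|_]; first exact: rep_push.
    by do 2 apply: rep_stay.
- move=> Hy.
  pose j := match get t s with [::] => je | b :: _ => if b then j1 else j0 end.
  have {Hy} Hy : y = (j, set t (behead (get t s)) s).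
    move: Hy; rewrite /j; case Eg: (get t s) => [|b r] [<-] //.
    by rewrite -{1}(set_get t s) Eg.
  pose c1 : tm_config machine :=
    ((inord j, false), [ffun i => tape_act (c.2 i) (if i == ord_of t then (None, ToRight) else (Defs.thead (c.2 i), Stay))]).
  exists 1, c1; split => //; [|split; rewrite Hy //=].
  + exists c1 => //.
    exists ((inord j, false), [ffun i => (if i == ord_of t then (None, ToRight) else (Defs.thead (c.2 i), Stay))]).
      rewrite /= /machine_delta E1 /= inordK // E !ffunE (head_rep (Hrep t)).
      apply/andP; split; last by apply/eqP/ffunP => i; rewrite !ffunE.
      by rewrite /j; case: (get t s).
    by congr (_, _); apply/ffunP => i; rewrite !ffunE.
  + by rewrite Hy in Hpy.
  + move=> t'; rewrite !ffunE get_set; case: eqP => [->|_]; first exact: rep_pop.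
    exact: rep_stay.
- case=> Ey.
  pose c1 : tm_config machine :=
    ((inord j, false), [ffun i => tape_act (c.2 i) (Defs.thead (c.2 i), Stay)]).
  exists 1, c1; split => //; [|split; rewrite -Ey //=].
  + exists c1 => //; exists ((inord j, false), [ffun i => (Defs.thead (c.2 i), Stay)]).
      rewrite /= /machine_delta E1 /= inordK // E eqxx /=.
      by apply/eqP/ffunP => i; rewrite !ffunE.
    by congr (_, _); apply/ffunP => i; rewrite !ffunE.
  + by rewrite -Ey in Hpy.
  + by move=> t'; rewrite !ffunE; apply: rep_stay.
Qed.

Lemma reach_det n c x y : repc c x -> fsteps code n x y ->
  exists k c', [/\ k <= 2 * n, @tm_reach machine k c c' & repc c' y].
Proof.
elim: n c x => [|n IH] c x Hc /=; first by move=> <-; exists 0, c.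
case=> z xz zy; have [k [c1 [/andP[_ k2] r1 rep1]]] := step_det Hc xz.
have [k' [c' [k2' r2 rep2]]] := IH _ _ rep1 zy.
exists (k + k'), c'; split => //; first by lia.
elim: k {k2} c {Hc} r1 => [|k IHk] c /=; first by move=> ->.
by case=> d cd dc; exists d => //; apply: IHk.
Qed.

Lemma repc_seto c pc s o : repc c (pc, s) -> repc c (pc, seto o s).
Proof. by case=> H1 H2 H3; split => // t; rewrite get_seto; apply: H3. Qed.

Lemma repc_halted c x : repc c x -> fstep code x = None -> @tm_halted machine c.
Proof.
case: x => pc s [E1 Hpc Hrep] H c' [[q act]].
rewrite /= /machine_delta E1 /= inordK //; move: H => /=.
by case: (onth code pc) => [[t ob|t j0 j1 je|j]|] //=; case: (get t s).
Qed.

(* A push takes two steps of the machine: [mid] is the configuration in between. *)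
Definition mid (c' : tm_config machine) (y : nat * st) : Prop :=
  exists2 z, fstep code y = Some z &
  exists c1 c2, [/\ repc c1 y, @tm_step machine c1 c' & @tm_step machine c' c2].

(** Rebuilds an oracle from the choices of the machine. A guessing push determines one oracle bit,
    put in front by [b]; the rest [o'] stays universally quantified because later steps fix it. *)
Lemma step_back c pc s c' : repc c (pc, s) -> @tm_step machine c c' ->
  (exists o y, [/\ fstep code (pc, seto o s) = Some y, repc c' y
      & forall o', fstep code (pc, seto o' s) = Some (y.1, seto o' y.2)]) \/
  (forall c2, @tm_step machine c' c2 -> exists b y,
     repc c2 y /\
     forall o', fstep code (pc, seto (b o') s) = Some (y.1, seto o' y.2)) /\
  mid c' (pc, s).
Proof.
move=> Hc; have [E1 Hpc Hrep] := Hc; case=> -[q act] Hd.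
rewrite /= /machine_delta E1 /= inordK // in Hd; move: Hd.
case E: (onth code pc) => [[t ob|t j0 j1 je|j]|//] /andP[/eqP-> /eqP->] ->; rewrite ?ffunE /=.
- have Hs : pc.+1 <= pcmax by have := @pc_bound (pc, s) (pc.+1, do_push t ob s) Hpc; rewrite /= E; apply.
  right; split; last first.
    exists (pc.+1, do_push t ob s); first by rewrite /= E.
    set c1 : tm_config machine := (_, _).
    pose b := if ob is Some b then b else false.
    exists c, ((inord pc.+1, false), [ffun i => tape_act (c1.2 i) (if i == ord_of t then Some (inl b) else Defs.thead (c1.2 i), Stay)]); split => //.
      exists ((inord pc, true), [ffun i => (Defs.thead (c.2 i), if i == ord_of t then ToLeft else Stay)]).
        rewrite /= /machine_delta E1 /= inordK // E eqxx /=.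
        by apply/eqP/ffunP => i; rewrite !ffunE.
      by congr (_, _); apply/ffunP => i; rewrite !ffunE.
    exists ((inord pc.+1, false), [ffun i => (if i == ord_of t then Some (inl b) else Defs.thead (c1.2 i), Stay)]).
      rewrite /= /machine_delta /= inordK // E eqxx /=.
      apply/existsP; exists b; apply/andP; split; first by rewrite /b; case: (ob).
      by apply/eqP/ffunP => i; rewrite !ffunE.
    by congr (_, _); apply/ffunP => i; rewrite !ffunE.
  move=> c2 [[q2 act2]]; rewrite /= /machine_delta /= inordK // E.
  case/andP=> /eqP-> /existsP[b /andP[Hb /eqP->]] ->.
  exists (fun o' => if ob is Some _ then o' else b :: o'), (pc.+1, set t (b :: get t s) s); split.
    split => // t'; rewrite !ffunE get_set.
    by case: eqP => [->|_]; [apply: rep_push|do 2 apply: rep_stay].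
  move=> o'; rewrite /do_push; case: (ob) Hb => [b' /eqP->|_].
    by rewrite get_seto set_seto.
  by rewrite get_seto orc_seto seto_seto set_seto.
- left; pose j := match get t s with [::] => je | b :: _ => if b then j1 else j0 end.
  have H o : fstep code (pc, seto o s) = Some (j, seto o (set t (behead (get t s)) s)).
    rewrite /= E /j get_seto; case Eg: (get t s) => [|b r] /=; last by rewrite set_seto.
    by rewrite -{1}(set_get t s) Eg.
  exists (orc s), (j, seto (orc s) (set t (behead (get t s)) s)); split; [exact: H|split => //|].
  + rewrite /= (head_rep (Hrep t)) /j; by case: (get t s).
  + exact: (@pc_bound (pc, seto (orc s) s) _ Hpc (H (orc s))).
  + move=> t' /=; rewrite !ffunE get_seto get_set; case: eqP => [->|_]; first exact: rep_pop.
    exact: rep_stay.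
  + by move=> o'; move: (H o') => /= ->; rewrite seto_seto.
- left; have H o : fstep code (pc, seto o s) = Some (j, seto o s) by rewrite /= E.
  exists (orc s), (j, seto (orc s) s); split; [exact: H|split => //|].
  + exact: (@pc_bound (pc, seto (orc s) s) _ Hpc (H (orc s))).
  + by move=> t' /=; rewrite !ffunE get_seto; apply: rep_stay.
  + by move=> o'; move: (H o') => /= ->; rewrite seto_seto.
Qed.

Lemma reach_back k c pc s c' : repc c (pc, s) -> @tm_reach machine k c c' ->
  exists o n y, fsteps code n (pc, seto o s) y /\
   ((repc c' y /\ k <= 2 * n) \/ (mid c' y /\ k <= 2 * n + 1)).
Proof.
have [m] := ubnP k; elim: m k c pc s => // m IH [|k] c pc s /ltnSE km Hc /=.
  move=> <-; exists [::], 0, (pc, seto [::] s); split => //; left; split => //.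
  exact: repc_seto.
case=> d cd dc; have [] := step_back Hc cd.
- move=> [o [[pc1 s1] [H1 H2 H3]]].
  have [//|o1 [n [y [H4 H5]]]] := IH _ _ _ _ _ H2 dc.
  exists o1, n.+1, y; split; first by exists (pc1, seto o1 s1).
  by case: H5 => -[H5 H6]; [left|right]; split => //; lia.
- move=> [H1 H2]; case: k km dc => [|k] km /=.
    move=> <-; exists (orc s), 0, (pc, s); split; first by case: (s).
    by right.
  case=> e de ec; have [b [[pc1 s1] [H3 H4]]] := H1 _ de.
  have [|o1 [n [y [H5 H6]]]] := IH _ _ _ _ _ H3 ec; first by lia.
  exists (b o1), n.+1, y; split; first by exists (pc1, seto o1 s1); first exact: H4.
  by case: H6 => -[H6 H7]; [left|right]; split => //; lia.
Qed.

Lemma machine_bounded c pc s N : repc c (pc, s) ->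
  (forall o, exists n y, [/\ n <= N, fsteps code n (pc, seto o s) y
                          & fstep code y = None]) ->
  forall k c', @tm_reach machine k c c' -> k <= 2 * N.
Proof.
move=> Hc Hterm k c' /(reach_back Hc) [o [n [y [H1 H2]]]].
have [n' [z [H3 H4 H5]]] := Hterm o.
have [H6 H7] := fsteps_halt H1 H4 H5.
case: H2 => -[H2 H8]; first by lia.
(* A computation stopped halfway through a push has a next instruction, so [n < n'], which pays for
   the extra machine step. *)
case: H2 => w Hw _; case: (n' - n) H7 (subnKC H6) => [|p] //=; last by lia.
by move=> E; rewrite -E Hw in H5.
Qed.

Lemma machine_accepts c pc s : repc c (pc, s) ->
  (exists n c', [/\ @tm_reach machine n c c', @tm_halted machine c'
                & c'.1 \in accept machine]) <->
  exists o n y, [/\ fsteps code n (pc, seto o s) y, fstep code y = None & y.1 = acc].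
Proof.
move=> Hc; split.
- move=> [k [c' [/(reach_back Hc) [o [n [y [H1 H2]]]] H3 H4]]].
  case: H2 => -[H2 _]; last by case: H2 => z _ [c1 [c2 [_ _ /H3]]].
  exists o, n, y; split => //.
    case E: (fstep code y) => [z|//]; have [k' [c2 [k2 r2 _]]] := step_det H2 E.
    by case: k' k2 r2 => [|k'] //= _ [c3 /H3].
  by move: H4; rewrite inE; case: H2 => -> /= H2 _; rewrite inordK // => /eqP.
- move=> [o [n [y [H1 H2 H3]]]].
  have [k [c' [_ H4 H5]]] := reach_det (repc_seto o Hc) H1.
  exists k, c'; split => //; first exact: repc_halted H5 H2.
  by rewrite inE; case: H5 => -> Hle _ /=; rewrite inordK // H3.
Qed.

Lemma repc_init w : repc (tm_init machine w) (0, St w [::] [::] [::] [::]).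
Proof.
split => //=; first by congr (_, _); apply/val_inj; rewrite /= inordK.
move=> t; rewrite ffunE.
have -> : (ord_of t == ord0) = (if t is T0 then true else false).
  by rewrite -val_eqE; case: t => /=; rewrite inordK.
case: t => /=; try by split; [exists 0|exists 1].
split; first by exists 0.
by case: w => [|b w] /=; [exists 1|exists 0; rewrite cats0].
Qed.

Definition no_guess (i : instr) : bool := if i is IPush _ None then false else true.

Lemma machine_deterministic : all no_guess code -> deterministic machine.
Proof.
move=> Hall q a [q1 a1] [q2 a2]; rewrite /= /machine_delta.
case E: (onth code (val q.1)) => [i|//].
have Hi : no_guess i.
  elim: (code) (val q.1) Hall E => [|j l IH] [|p] //=; first by case/andP=> H _ [<-].
  by case/andP=> _ /IH; apply.
case: i E Hi => [t [b|]|t j0 j1 je|j] //= E _.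
- case: q.2.
    case/andP=> /eqP-> /existsP[b1 /andP[/eqP-> /eqP->]].
    by case/andP=> /eqP-> /existsP[b2 /andP[/eqP-> /eqP->]].
  by case/andP=> /eqP-> /eqP-> /andP[/eqP-> /eqP->].
- by case/andP=> /eqP-> /eqP-> /andP[/eqP-> /eqP->].
- by case/andP=> /eqP-> /eqP-> /andP[/eqP-> /eqP->].
Qed.

Lemma leading_bits_cat s k :
  @leading_bits machine ([seq Some (inl b) | b <- s] ++ nseq k None) = s.
Proof. by elim: s => [|b s /= ->] //; case: k. Qed.

Lemma repc_output c x : repc c x -> tm_output c = r3 x.2.
Proof.
case=> _ _ /(_ T3) [_ [k /= E]].
rewrite /tm_output; have -> : ord_max = ord_of T3.
  by apply/val_inj; rewrite /= inordK.
by rewrite E leading_bits_cat.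
Qed.

End FlatMachine.

(** * Structured commands and their compilation *)

Inductive cmd :=
| Skip
| Push of reg & option bool
| Seq of cmd & cmd
| Case of reg & cmd & cmd & cmd
| Loop of reg & cmd.

Fixpoint clen (c : cmd) : nat :=
  match c with
  | Skip => 0
  | Push _ _ => 1
  | Seq c1 c2 => clen c1 + clen c2
  | Case _ c0 c1 ce => (clen c0 + clen c1 + clen ce).+3
  | Loop _ c => (clen c).+2
  end.

Fixpoint compile (p : nat) (c : cmd) : seq instr :=
  match c with
  | Skip => [::]
  | Push t ob => [:: IPush t ob]
  | Seq c1 c2 => compile p c1 ++ compile (p + clen c1) c2
  | Case t c0 c1 ce =>
    let p0 := p.+1 in let p1 := (p0 + clen c0).+1 in let pe := (p1 + clen c1).+1 in
    let: e := pe + clen ce in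
    IPop t p0 p1 pe :: compile p0 c0 ++ IJmp e :: compile p1 c1 ++ IJmp e :: compile pe ce
  | Loop t c =>
    let: e := p + (clen c).+2 in
    IPop t e p.+1 e :: compile p.+1 c ++ [:: IJmp p]
  end.

(** The last index counts the compiled instructions exactly, jumps included. The test of [Loop] is
    destructive and stops on [false] as well as on an empty stack, so a loop can run directly over a
    coded list, whose constructor bits are its tests. *)
Inductive exec : cmd -> st -> st -> nat -> Prop :=
| ESkip s : exec Skip s s 0
| EPush t ob s : exec (Push t ob) s (do_push t ob s) 1
| ESeq c1 c2 s s' s'' n m : exec c1 s s' n -> exec c2 s' s'' m ->
    exec (Seq c1 c2) s s'' (n + m)
| ECase0 t c0 c1 ce s r s' n : get t s = false :: r -> exec c0 (set t r s) s' n ->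
    exec (Case t c0 c1 ce) s s' n.+2
| ECase1 t c0 c1 ce s r s' n : get t s = true :: r -> exec c1 (set t r s) s' n ->
    exec (Case t c0 c1 ce) s s' n.+2
| ECaseE t c0 c1 ce s s' n : get t s = [::] -> exec ce s s' n ->
    exec (Case t c0 c1 ce) s s' n.+1
| ELoop0 t c s r : get t s = false :: r -> exec (Loop t c) s (set t r s) 1
| ELoopE t c s : get t s = [::] -> exec (Loop t c) s s 1
| ELoop1 t c s r s' s'' n m : get t s = true :: r -> exec c (set t r s) s' n ->
    exec (Loop t c) s' s'' m -> exec (Loop t c) s s'' (n + m).+2.

Lemma size_compile p c : size (compile p c) = clen c.
Proof.
elim: c p => //= [c1 IH1 c2 IH2|t c0 IH0 c1 IH1 ce IHe|t c IH] p.
- by rewrite size_cat IH1 IH2.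
- by rewrite !size_cat /= size_cat /= IH0 IH1 IHe; lia.
- by rewrite size_cat IH /= addn1.
Qed.

Lemma fstepsS code n x y z :
  fstep code x = Some z -> fsteps code n z y -> fsteps code n.+1 x y.
Proof. by exists z. Qed.

Lemma fstepsSr code n x y z :
  fsteps code n x y -> fstep code y = Some z -> fsteps code n.+1 x z.
Proof.
by move=> H1 H2; rewrite -addn1; apply: fsteps_trans H1 _; exists z.
Qed.

Local Arguments fsteps : simpl never.

(** Jump addresses are absolute, hence the arbitrary context [pre], [post]: each subcommand is run
    at its real position in the whole code. *)
Lemma exec_fsteps c s s' n : exec c s s' n ->
  forall pre post, fsteps (pre ++ compile (size pre) c ++ post) n (size pre, s) (size pre + clen c, s').
Proof.
have at0 pre i l : onth (pre ++ i :: l) (size pre) = Some i.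
  by rewrite onth_cat ltnn subnn.
have jmp pre e l p s1 : p = size pre -> fstep (pre ++ IJmp e :: l) (p, s1) = Some (e, s1).
  by move=> ->; rewrite /= at0.
elim=> {c s s' n} /=.
- by move=> s pre post; rewrite addn0.
- move=> t ob s pre post; apply: (@fstepsS _ _ _ _ ((size pre).+1, do_push t ob s)); last by rewrite addn1.
  by rewrite /= at0.
- move=> c1 c2 s s' s'' n m _ IH1 _ IH2 pre post; rewrite -catA.
  apply: fsteps_trans (IH1 pre _) _.
  have := IH2 (pre ++ compile (size pre) c1) post.
  by rewrite size_cat size_compile -!catA addnA.
- move=> t c0 c1 ce s r s' n Hg _ IH pre post.
  set q1 := (_ + clen c1).+1; set e := _ + clen ce; set i := IPop _ _ _ _.
  apply: (@fstepsS _ _ _ _ ((size pre).+1, set t r s)); first by rewrite /= at0 /= Hg.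
  apply: (@fstepsSr _ _ _ ((size pre).+1 + clen c0, s')).
    have := IH (pre ++ [:: i]) ((IJmp e :: compile ((size pre).+1 + clen c0).+1 c1 ++ IJmp e :: compile q1 ce) ++ post).
    by rewrite size_cat addn1 !(=^~ catA, cat_cons, cat0s).
  rewrite (_ : pre ++ _ = (pre ++ i :: compile (size pre).+1 c0) ++ IJmp e ::
    ((compile ((size pre).+1 + clen c0).+1 c1 ++ IJmp e :: compile q1 ce) ++ post)); last by rewrite !(=^~ catA, cat_cons, cat0s).
  rewrite jmp; last by rewrite size_cat /= size_compile; lia.
  by congr (Some (_, _)); rewrite /e /q1; lia.
- move=> t c0 c1 ce s r s' n Hg _ IH pre post.
  set p1 := (_ + clen c0).+1; set q1 := (p1 + clen c1).+1.
  set e := _ + clen ce; set i := IPop _ _ _ _.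
  apply: (@fstepsS _ _ _ _ (p1, set t r s)); first by rewrite /= at0 /= Hg.
  have Ep : size (pre ++ i :: compile (size pre).+1 c0 ++ [:: IJmp e]) = p1.
    by rewrite size_cat /= size_cat size_compile /= /p1; lia.
  apply: (@fstepsSr _ _ _ (p1 + clen c1, s')).
    have := IH (pre ++ i :: compile (size pre).+1 c0 ++ [:: IJmp e]) (IJmp e :: compile q1 ce ++ post).
    by rewrite Ep !(=^~ catA, cat_cons, cat0s).
  rewrite (_ : pre ++ _ = (pre ++ i :: compile (size pre).+1 c0 ++ IJmp e :: compile p1 c1) ++
    IJmp e :: (compile q1 ce ++ post)); last by rewrite !(=^~ catA, cat_cons, cat0s).
  rewrite jmp; last by rewrite size_cat /= size_cat /= !size_compile /p1; lia.
  by congr (Some (_, _)); rewrite /e /q1 /p1; lia.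
- move=> t c0 c1 ce s s' n Hg _ IH pre post.
  set p1 := (_ + clen c0).+1; set q1 := (p1 + clen c1).+1.
  set e := _ + clen ce; set i := IPop _ _ _ _.
  apply: (@fstepsS _ _ _ _ (q1, s)); first by rewrite /= at0 /= Hg.
  have := IH (pre ++ i :: compile (size pre).+1 c0 ++ IJmp e :: compile p1 c1 ++ [:: IJmp e]) post.
  have -> : size (pre ++ i :: compile (size pre).+1 c0 ++ IJmp e :: compile p1 c1 ++ [:: IJmp e]) = q1.
    by rewrite size_cat /= size_cat /= size_cat !size_compile /q1 /p1 /=; lia.
  have -> : size pre + (clen c0 + clen c1 + clen ce).+3 = q1 + clen ce.
    by rewrite /q1 /p1; lia.
  by rewrite !(=^~ catA, cat_cons, cat0s).
- move=> t c s r Hg pre post.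
  by apply: fstepsS; first by rewrite /= at0 /= Hg.
- move=> t c s Hg pre post.
  by apply: fstepsS; first by rewrite /= at0 /= Hg.
- move=> t c s r s' s'' n m Hg _ IH1 _ IH2 pre post.
  set e := _ + (clen c).+2; set i := IPop _ _ _ _.
  apply: (@fstepsS _ _ _ _ ((size pre).+1, set t r s)); first by rewrite /= at0 /= Hg.
  rewrite -addnS; apply: (@fsteps_trans _ _ _ _ ((size pre).+1 + clen c, s')).
    have := IH1 (pre ++ [:: i]) (IJmp (size pre) :: post).
    by rewrite size_cat addn1 !(=^~ catA, cat_cons, cat0s).
  apply: (@fstepsS _ _ _ _ (size pre, s')); last exact: (IH2 pre post).
  rewrite (_ : pre ++ _ = (pre ++ i :: compile (size pre).+1 c) ++ IJmp (size pre) :: post);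
    last by rewrite !(=^~ catA, cat_cons, cat0s).
  by rewrite jmp // size_cat /= size_compile; lia.
Qed.

Fixpoint deterministic_cmd (c : cmd) : bool :=
  match c with
  | Skip => true
  | Push _ ob => ob != None
  | Seq c1 c2 => deterministic_cmd c1 && deterministic_cmd c2
  | Case _ c0 c1 ce => [&& deterministic_cmd c0, deterministic_cmd c1 & deterministic_cmd ce]
  | Loop _ c => deterministic_cmd c
  end.

Lemma deterministic_compile p c : deterministic_cmd c -> all no_guess (compile p c).
Proof.
elim: c p => //= [t [b|] //|c1 IH1 c2 IH2|t c0 IH0 c1 IH1 ce IHe|t c IH] p.
- by case/andP=> H1 H2; rewrite all_cat IH1 ?IH2.
- by case/and3P=> H1 H2 H3; rewrite all_cat /= all_cat /= IH0 ?IH1 ?IHe.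
- by move=> H; rewrite all_cat IH.
Qed.

(** * Polynomial time computable functions on trees *)

(** Monotonicity lets size bounds be substituted into one another; the base [n + 2], at least 2 even
    for [n = 0], lets constants be absorbed into the exponent. *)
Definition mpoly_bounded (F : nat -> nat) : Prop :=
  {homo F : m n / m <= n} /\ exists k, forall n, F n <= (n + 2) ^ k.

Lemma mpb_const c : mpoly_bounded (fun=> c).
Proof.
split=> //; exists c => n; apply: leq_trans (ltnW (ltn_expl c (isT : 1 < 2))) _.
by case: c => // c; rewrite leq_exp2r // leq_addl.
Qed.

Lemma mpb_id : mpoly_bounded id.
Proof. by split=> //; exists 1 => n; rewrite expn1 leq_addr. Qed.

Lemma mpbD F G : mpoly_bounded F -> mpoly_bounded G -> mpoly_bounded (fun n => F n + G n).
Proof.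
move=> [HF [a Ha]] [HG [b Hb]]; split=> [m n H|]; first by rewrite leq_add ?HF ?HG.
exists (a + b).+1 => n; apply: leq_trans (leq_add (Ha n) (Hb n)) _.
have H1 : (n + 2) ^ a <= (n + 2) ^ (a + b) by rewrite leq_exp2l ?leq_addr //; lia.
have H2 : (n + 2) ^ b <= (n + 2) ^ (a + b) by rewrite leq_exp2l ?leq_addl //; lia.
rewrite expnS; nia.
Qed.

Lemma mpbS F : mpoly_bounded F -> mpoly_bounded (fun n => (F n).+1).
Proof.
move=> HF; have [h [k H]] := mpbD HF (mpb_const 1).
by split=> [m n /h|]; [rewrite !addn1|exists k => n; rewrite -addn1].
Qed.

Lemma mpbM F G : mpoly_bounded F -> mpoly_bounded G -> mpoly_bounded (fun n => F n * G n).
Proof.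
move=> [HF [a Ha]] [HG [b Hb]]; split=> [m n H|]; first by rewrite leq_mul ?HF ?HG.
by exists (a + b) => n; rewrite expnD leq_mul.
Qed.

Lemma mpb_comp F G : mpoly_bounded F -> mpoly_bounded G -> mpoly_bounded (fun n => F (G n)).
Proof.
move=> [HF [a Ha]] [HG [b Hb]]; split=> [m n H|]; first by rewrite HF ?HG.
exists (b.+2 * a) => n; apply: leq_trans (Ha _) _; rewrite expnM.
case: a {Ha} => [|a] //; rewrite leq_exp2r //.
have := Hb n; have : 0 < (n + 2) ^ b by rewrite expn_gt0; lia.
rewrite !expnS; set X := _ ^ b; nia.
Qed.

Ltac mpb := repeat first
  [ assumption | apply: mpb_const | apply: mpb_id
  | match goal with
    | |- mpoly_bounded (fun n => n) => apply: mpb_id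
    | |- mpoly_bounded (fun n => (@?F n).+1) => apply: (@mpbS F)
    | |- mpoly_bounded (fun n => @?F n + @?G n) => apply: (@mpbD F G)
    | |- mpoly_bounded (fun n => @?F n * @?G n) => apply: (@mpbM F G)
    | |- mpoly_bounded (fun n => ?F (@?G n)) => apply: (@mpb_comp F G)
    end ].

Inductive tree := Leaf | Node of tree & tree.

(* Preorder, hence prefix-free: values can be stacked on the same tape. *)
Fixpoint code (x : tree) : seq bool :=
  if x is Node a b then true :: code a ++ code b else [:: false].

(** [T3] holds one mark per subtree still to be copied: the loop consumes a mark, a leaf adds none
    and a node adds two. This finds the end of a prefix-free code without any arithmetic. *)
Definition walk_body (d : reg) : cmd :=
  Case T0 (Push d (Some false))
    (Seq (Push d (Some true)) (Seq (Push T3 (Some true)) (Push T3 (Some true)))) Skip.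

Definition walk (d : reg) : cmd := Seq (Push T3 (Some true)) (Loop T3 (walk_body d)).

Definition walk_to (d : bool) (x : tree) (r a b : seq bool) (c o : seq bool) : st :=
  if d then St r (rev (code x) ++ a) b c o else St r a (rev (code x) ++ b) c o.

(** Stated backwards, from the execution that follows the copy of [x]: the two subtrees of a node
    are then chained by applying the induction hypotheses in reverse order, inside one single
    loop. *)
Lemma walk_loop d x r a b c o s' m :
  exec (Loop T3 (walk_body (if d then T1 else T2))) (walk_to d x r a b c o) s' m ->
  exists2 n, exec (Loop T3 (walk_body (if d then T1 else T2)))
     (St (code x ++ r) a b (true :: c) o) s' n & n <= m + 7 * size (code x).
Proof.
elim: x r a b c s' m => [|x IHx y IHy] r a b c s' m H.
  exists (3 + m).+2; last by rewrite /=; lia.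
  apply: ELoop1 => //; last exact: H.
  by case: (d); apply: ECase0 => //; apply: EPush.
have [m1 H1 L1] : exists2 m1, exec (Loop T3 (walk_body (if d then T1 else T2)))
     (if d then St (code y ++ r) (rev (code x) ++ true :: a) b (true :: c) o
      else St (code y ++ r) a (rev (code x) ++ true :: b) (true :: c) o) s' m1 & m1 <= m + 7 * size (code y).
  move: H; rewrite /walk_to /= rev_cons rev_cat -cats1 -!catA /=.
  by move: (IHy); rewrite /walk_to; case: (d) => IH; apply: IH.
have [m2 H2 L2] : exists2 m2, exec (Loop T3 (walk_body (if d then T1 else T2)))
     (if d then St (code x ++ code y ++ r) (true :: a) b (true :: true :: c) o
      else St (code x ++ code y ++ r) a (true :: b) (true :: true :: c) o) s' m2 & m2 <= m1 + 7 * size (code x).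
  by move: (IHx) H1; rewrite /walk_to; case: (d) => IH; apply: IH.
exists (5 + m2).+2; last by rewrite /= size_cat; lia.
move: H2; rewrite /= -catA; case: (d) => H2; apply: ELoop1 H2 => //.
  apply: ECase1 => //; apply: (ESeq (n := 1) (m := 2)); first exact: EPush.
  by apply: (ESeq (n := 1) (m := 1)); apply: EPush.
apply: ECase1 => //; apply: (ESeq (n := 1) (m := 2)); first exact: EPush.
by apply: (ESeq (n := 1) (m := 1)); apply: EPush.
Qed.

Lemma exec_walk (d : bool) x r a b o : exists2 n,
  exec (walk (if d then T1 else T2)) (St (code x ++ r) a b [::] o) (walk_to d x r a b [::] o) n
  & n <= 7 * size (code x) + 2.
Proof.
have [|n H L] := @walk_loop d x r a b [::] o (walk_to d x r a b [::] o) 1.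
  by case: (d); apply: ELoopE.
by exists (1 + n); [apply: ESeq H; apply: EPush | lia].
Qed.

(* [drain true] empties T1 and [drain false] empties T2, copying what is popped
   onto T0 and/or the other one of these two stacks. *)
Definition push_to (f : bool) (d : reg) (b : bool) : cmd :=
  if f then Push d (Some b) else Skip.

Definition drain_body (src f0 f1 : bool) : cmd :=
  let put b := Seq (push_to f0 T0 b)
    (Seq (push_to f1 (if src then T2 else T1) b) (Push T3 (Some true))) in
  Case (if src then T1 else T2) (put false) (put true) Skip.

Definition drain (src f0 f1 : bool) : cmd :=
  Seq (Push T3 (Some true)) (Loop T3 (drain_body src f0 f1)).

Lemma exec_drain (src f0 f1 : bool) l a b o : exists2 n,
  exec (drain src f0 f1) (if src then St a l b [::] o else St a b l [::] o)
    (let a' := if f0 then rev l ++ a else a in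
     let b' := if f1 then rev l ++ b else b in
     if src then St a' [::] b' [::] o else St a' b' [::] [::] o) n
  & n <= 7 * size l + 5.
Proof.
set fin := (X in exec _ _ X).
suff [n H L] : exists2 n, exec (Loop T3 (drain_body src f0 f1))
  (if src then St a l b [:: true] o else St a b l [:: true] o) fin n & n <= 7 * size l + 4.
  exists (1 + n); last by lia.
  by apply: ESeq H; case: (src); apply: EPush.
rewrite {}/fin; elim: l a b => [|x l IH] a b.
  exists (1 + 1).+2 => //; case: (src).
    apply: (ELoop1 (n := 1) (m := 1) (s' := St a [::] b [::] o)) => //.
      by apply: ECaseE => //; apply: ESkip.
    by case: (f0); case: (f1); apply: ELoopE.
  apply: (ELoop1 (n := 1) (m := 1) (s' := St a b [::] [::] o)) => //.
    by apply: ECaseE => //; apply: ESkip.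
  by case: (f0); case: (f1); apply: ELoopE.
have [n H L] := IH (if f0 then x :: a else a) (if f1 then x :: b else b).
have E f (u : seq bool) : (if f then rev (x :: l) ++ u else u) = if f then rev l ++ (if f then x :: u else u) else (if f then x :: u else u).
  by case: f; rewrite // rev_cons cat_rcons.
rewrite !E; exists (((f0 : nat) + ((f1 : nat) + 1)).+2 + n).+2; last by rewrite /= -/size; case: (f0); case: (f1); lia.
apply: (ELoop1 (s' := if src then
   St (if f0 then x :: a else a) l (if f1 then x :: b else b) [:: true] o
   else St (if f0 then x :: a else a) (if f1 then x :: b else b) l [:: true] o)); last exact: H.
  by case: (src).
have P f d s : exec (push_to f d x) s (if f then set d (x :: get d s) s else s) f.
  by case: f; [apply: EPush | apply: ESkip].
have Q d s : exec (Push d (Some true)) s (set d (true :: get d s) s) 1 by apply: EPush.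
have R : exec (Seq (push_to f0 T0 x) (Seq (push_to f1 (if src then T2 else T1) x) (Push T3 (Some true))))
  (if src then St a l b [::] o else St a b l [::] o) (if src
    then St (if f0 then x :: a else a) l (if f1 then x :: b else b) [:: true] o
    else St (if f0 then x :: a else a) (if f1 then x :: b else b) l [:: true] o) ((f0 : nat) + ((f1 : nat) + 1)).
  apply: ESeq (P _ _ _) _; apply: ESeq (P _ _ _) _.
  by case: (src); case: (f0); case: (f1); apply: Q.
by move: R; case: (src); case: (x) => R; [apply: (@ECase1 _ _ _ _ _ l)|apply: (@ECase0 _ _ _ _ _ l)|apply: (@ECase1 _ _ _ _ _ l)|apply: (@ECase0 _ _ _ _ _ l)].
Qed.

Definition pure_st (a o : seq bool) : st := St a [::] [::] [::] o.

(** Each transfer reverses its data. After the first drain [T2] holds the second copy in the right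
    order, so it passes through [T1] to reach [T0] unreversed. *)
Definition c_dup : cmd :=
  Seq (walk T1) (Seq (drain true true true) (Seq (drain false false true) (drain true true false))).

Definition c_swap : cmd :=
  Seq (walk T1) (Seq (walk T2) (Seq (drain true true false) (drain false true false))).

Definition c_drop : cmd := Seq (walk T1) (drain true false false).

Lemma exec_dup x r o : exists2 n,
  exec c_dup (pure_st (code x ++ r) o) (pure_st (code x ++ code x ++ r) o) n
  & n <= 28 * size (code x) + 20.
Proof.
have [n1 H1 L1] := exec_walk true x r [::] [::] o.
have [n2 H2 L2] := exec_drain true true true (rev (code x)) r [::] o.
have [n3 H3 L3] := exec_drain false false true (code x) (code x ++ r) [::] o.
have [n4 H4 L4] := exec_drain true true false (rev (code x)) (code x ++ r) [::] o.
rewrite /= ?revK ?cats0 ?size_rev in H1 H2 H3 H4 L2 L3 L4.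
exists (n1 + (n2 + (n3 + n4))); last by lia.
by apply: ESeq H1 _; apply: ESeq H2 _; apply: ESeq H3 H4.
Qed.

Lemma exec_swap x y r o : exists2 n,
  exec c_swap (pure_st (code x ++ code y ++ r) o) (pure_st (code y ++ code x ++ r) o) n
  & n <= 14 * (size (code x) + size (code y)) + 20.
Proof.
have [n1 H1 L1] := exec_walk true x (code y ++ r) [::] [::] o.
have [n2 H2 L2] := exec_walk false y r (rev (code x)) [::] o.
have [n3 H3 L3] := exec_drain true true false (rev (code x)) r (rev (code y)) o.
have [n4 H4 L4] := exec_drain false true false (rev (code y)) (code x ++ r) [::] o.
rewrite /= ?revK ?cats0 ?size_rev in H1 H2 H3 H4 L2 L3 L4.
exists (n1 + (n2 + (n3 + n4))); last by lia.
by apply: ESeq H1 _; apply: ESeq H2 _; apply: ESeq H3 H4.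
Qed.

Lemma exec_drop x r o : exists2 n,
  exec c_drop (pure_st (code x ++ r) o) (pure_st r o) n & n <= 14 * size (code x) + 10.
Proof.
have [n1 H1 L1] := exec_walk true x r [::] [::] o.
have [n2 H2 L2] := exec_drain true false false (rev (code x)) r [::] o.
rewrite /= ?revK ?cats0 ?size_rev in H1 H2 L2.
exists (n1 + n2); last by lia.
exact: ESeq H1 H2.
Qed.

Structure encType := EncType { carrier :> Type; enc : carrier -> tree }.

Definition sz (A : encType) (x : A) : nat := size (code (enc x)).

Canonical unit_encType := @EncType unit (fun=> Leaf).
Canonical bool_encType := @EncType bool (fun b => if b then Node Leaf Leaf else Leaf).
(** Unary, with the same tree as a list of units: arithmetic becomes list manipulation, and [FP] is
    polynomial in the values of numbers. *)
Canonical nat_encType := @EncType nat (fix f n := if n is n'.+1 then Node Leaf (f n') else Leaf).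
Canonical prod_encType (A B : encType) := @EncType (A * B) (fun p => Node (enc p.1) (enc p.2)).
Canonical seq_encType (A : encType) :=
  @EncType (seq A) (fix f s := if s is x :: s' then Node (enc x) (f s') else Leaf).
Canonical option_encType (A : encType) :=
  @EncType (option A) (fun o => if o is Some x then Node (enc x) Leaf else Leaf).

(** The arbitrary remainder [r] below the argument and the untouched oracle make the programs usable
    as subroutines. The output size is bounded along with the time because composition needs it. *)
Definition FP (A B : encType) (f : A -> B) : Prop :=
  exists (c : cmd) (F : nat -> nat), [/\ mpoly_bounded F, deterministic_cmd c &
    forall a r o, exists n,
      [/\ exec c (pure_st (code (enc a) ++ r) o) (pure_st (code (enc (f a)) ++ r) o) n,
          n <= F (sz a) & sz (f a) <= F (sz a)]].

Lemma FP_ext (A B : encType) (f g : A -> B) : f =1 g -> FP f -> FP g.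
Proof.
move=> E [c [F [HF Hd H]]]; exists c, F; split => // a r o.
by have := H a r o; rewrite -E.
Qed.

Lemma FP_cast (A B : encType) (f : A -> B) : (forall a, enc (f a) = enc a) -> FP f.
Proof.
move=> E; exists Skip, id; split => [|//|a r o]; first exact: mpb_id.
by exists 0; rewrite /sz E; split => //; apply: ESkip.
Qed.

Lemma FP_id (A : encType) : FP (fun x : A => x).
Proof. exact: FP_cast. Qed.

Lemma FP_comp (A B C : encType) (g : B -> C) (f : A -> B) :
  FP g -> FP f -> FP (fun x => g (f x)).
Proof.
move=> [cg [G [HG dG Hg]]] [cf [F [HF dF Hf]]].
exists (Seq cf cg), (fun n => F n + G (F n)); split; [mpb|by rewrite /= dF dG|].
move=> a r o; have [n [H1 L1 S1]] := Hf a r o; have [m [H2 L2 S2]] := Hg (f a) r o.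
have M := HG.1 _ _ S1; exists (n + m); split; [exact: ESeq H1 H2|lia|lia].
Qed.

Lemma sz_pair (A B : encType) (x : A) (y : B) : sz (x, y) = (sz x + sz y).+1.
Proof. by rewrite /sz /= size_cat. Qed.

Lemma sz_gt0 (A : encType) (x : A) : 0 < sz x.
Proof. by rewrite /sz; case: (enc x). Qed.

Lemma FP_pair (A B C : encType) (f : A -> B) (g : A -> C) :
  FP f -> FP g -> FP (fun x => (f x, g x)).
Proof.
move=> [cf [F [HF dF Hf]]] [cg [G [HG dG Hg]]].
exists (Seq c_dup (Seq cf (Seq c_swap (Seq cg (Seq c_swap (Push T0 (Some true))))))),
  (fun n => 28 * n + 20 + F n + (14 * (F n + n) + 20) + G n + (14 * (F n + G n) + 20) + 1).
split; [mpb|by rewrite /= dF dG|].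
move=> a r o; have [n1 H1 L1] := exec_dup (enc a) r o.
have [n2 [H2 L2 S2]] := Hf a (code (enc a) ++ r) o.
have [n3 H3 L3] := exec_swap (enc (f a)) (enc a) r o.
have [n4 [H4 L4 S4]] := Hg a (code (enc (f a)) ++ r) o.
have [n5 H5 L5] := exec_swap (enc (g a)) (enc (f a)) r o.
exists (n1 + (n2 + (n3 + (n4 + (n5 + 1))))); split.
- apply: ESeq H1 _; apply: ESeq H2 _; apply: ESeq H3 _; apply: ESeq H4 _; apply: ESeq H5 _.
  by rewrite /= -catA; apply: EPush.
- rewrite /sz in L1 L2 L3 L4 L5 S2 S4 *; lia.
- rewrite sz_pair; lia.
Qed.

Lemma FP_fst0 (A B : encType) : FP (fun p : A * B => p.1).
Proof.
exists (Case T0 Skip (Seq c_swap c_drop) Skip), (fun n => 50 * n + 50); split; [mpb|by []|].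
case=> a b r o; have [n1 H1 L1] := exec_swap (enc a) (enc b) r o.
have [n2 H2 L2] := exec_drop (enc b) (code (enc a) ++ r) o.
exists (n1 + n2).+2; rewrite sz_pair; split => /=; rewrite /sz; try lia.
by apply: ECase1 => //=; rewrite -catA; apply: ESeq H1 H2.
Qed.

Lemma FP_snd0 (A B : encType) : FP (fun p : A * B => p.2).
Proof.
exists (Case T0 Skip c_drop Skip), (fun n => 50 * n + 50); split; [mpb|by []|].
case=> a b r o; have [n1 H1 L1] := exec_drop (enc a) (code (enc b) ++ r) o.
exists n1.+2; rewrite sz_pair; split => /=; rewrite /sz; try lia.
by apply: ECase1 => //=; rewrite -catA.
Qed.

Lemma FP_fst (A B C : encType) (f : A -> B * C) : FP f -> FP (fun x => (f x).1).
Proof. exact: FP_comp (FP_fst0 _ _). Qed.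

Lemma FP_snd (A B C : encType) (f : A -> B * C) : FP f -> FP (fun x => (f x).2).
Proof. exact: FP_comp (FP_snd0 _ _). Qed.

Definition push_all (s : seq bool) : cmd := foldr (fun b c => Seq c (Push T0 (Some b))) Skip s.

Lemma exec_push_all s r o : exec (push_all s) (pure_st r o) (pure_st (s ++ r) o) (size s).
Proof.
elim: s => [|b s IH] /=; first exact: ESkip.
by rewrite -addn1; apply: ESeq IH _; apply: EPush.
Qed.

Lemma FP_const (A B : encType) (b : B) : FP (fun _ : A => b).
Proof.
exists (Seq c_drop (push_all (code (enc b)))), (fun n => 14 * n + 10 + sz b); split; [mpb| |].
  by rewrite /=; elim: (code _) => //= x s ->.
move=> a r o; have [n H L] := exec_drop (enc a) r o.
exists (n + sz b); split; [by apply: ESeq H _; apply: exec_push_all|rewrite /sz in L *; lia|lia].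
Qed.

(** The source of all conditionals: [v] puts a tag, [Leaf] or [Node Leaf Leaf], in front of a
    payload, and the branch taken works on the payload alone. The two payload types may differ, as
    matching on options and lists requires. *)
Lemma FP_branch (A L R B X : encType) (v : A -> X) (f : A -> B) (g0 : L -> B) (g1 : R -> B) :
  FP v ->
  (forall a, (exists2 l, enc (v a) = Node Leaf (enc l) & f a = g0 l) \/
             (exists2 y, enc (v a) = Node (Node Leaf Leaf) (enc y) & f a = g1 y)) ->
  FP g0 -> FP g1 -> FP f.
Proof.
move=> [cv [V [HV dV Hv]]] Hb [c0 [F0 [HF0 dF0 H0]]] [c1 [F1 [HF1 dF1 H1]]].
exists (Seq cv (Case T0 Skip (Case T0 c0 (Case T0 (Case T0 c1 Skip Skip) Skip Skip) Skip) Skip)),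
  (fun n => V n + F0 (V n) + F1 (V n) + 20); split; [mpb|by rewrite /= dV dF0 dF1|].
move=> a r o; have [n [Hn L1 S1]] := Hv a r o.
case: (Hb a) => -[l E ->].
- have [m [Hm L2 S2]] := H0 l r o.
  have Sl : sz l <= V (sz a) by move: S1; rewrite /sz E /=; lia.
  have M := HF0.1 _ _ Sl; exists (n + m.+4); split; [|lia|lia].
  apply: ESeq Hn _; rewrite E /=; apply: ECase1 => //; apply: ECase0 => //.
- have [m [Hm L2 S2]] := H1 l r o.
  have Sl : sz l <= V (sz a) by move: S1; rewrite /sz E /=; lia.
  have M := HF1.1 _ _ Sl; exists (n + (m.+4).+4); split; [|lia|lia].
  apply: ESeq Hn _; rewrite E /=; apply: ECase1 => //; apply: ECase1 => //.
  by apply: ECase0 => //; apply: ECase0.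
Qed.

Lemma FP_if (A B : encType) (b : A -> bool) (f g : A -> B) :
  FP b -> FP f -> FP g -> FP (fun x => if b x then f x else g x).
Proof.
move=> Hb Hf Hg; apply: (@FP_branch A A A B _ (fun a => (b a, a)) _ g f) => //.
  by apply: FP_pair => //; apply: FP_id.
by move=> a; case: (b a); [right|left]; exists a.
Qed.

Lemma sz_nil (A : encType) : sz ([::] : seq A) = 1. Proof. by []. Qed.

Lemma sz_cons (A : encType) (x : A) (s : seq A) : sz (x :: s) = (sz x + sz s).+1.
Proof. by rewrite /sz /= size_cat. Qed.

Lemma sz_nat (n : nat) : sz n = n.*2.+1.
Proof. by elim: n => // n; rewrite /sz /= => ->; rewrite doubleS. Qed.

Lemma sz_bool (b : bool) : sz b <= 3. Proof. by case: b. Qed.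

Lemma FP_nilp0 (A : encType) : FP (fun s : seq A => nilp s).
Proof.
exists (Case T0 (push_all [:: true; false; false]) (Seq c_drop (Seq c_drop (Push T0 (Some false)))) Skip),
  (fun n => 14 * n + 50); split; [mpb|by []|].
case=> [|x s] r o; first by exists 5; split => //; apply: ECase0 => //; apply: exec_push_all.
have [n1 H1 L1] := exec_drop (enc x) (code (enc s) ++ r) o.
have [n2 H2 L2] := exec_drop (enc s) r o.
exists (n1 + (n2 + 1)).+2; rewrite sz_cons; split; [|rewrite /sz; lia|rewrite /sz /=; lia].
apply: ECase1 => //=; rewrite -catA; apply: ESeq H1 _; apply: ESeq H2 _.
exact: EPush.
Qed.

Lemma FP_behead0 (A : encType) : FP (@behead A).
Proof.
exists (Case T0 (Push T0 (Some false)) c_drop Skip), (fun n => 14 * n + 50); split; [mpb|by []|].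
case=> [|x s] r o; first by exists 3; split => //; apply: ECase0 => //; apply: EPush.
have [n1 H1 L1] := exec_drop (enc x) (code (enc s) ++ r) o.
exists n1.+2; rewrite sz_cons; split; [|rewrite /sz; lia|rewrite /sz /=; lia].
by apply: ECase1 => //=; rewrite -catA.
Qed.

Lemma FP_head0 (A : encType) (x0 : A) : FP (head x0).
Proof.
exists (Case T0 (push_all (code (enc x0))) (Seq c_swap c_drop) Skip), (fun n => 28 * n + sz x0 + 50).
split; [mpb|by rewrite /=; elim: (code _) => //= x s -> |].
case=> [|x s] r o.
  exists (size (code (enc x0))).+2; split; rewrite /sz /=; try lia.
  by apply: ECase0 => //; apply: exec_push_all.
have [n1 H1 L1] := exec_swap (enc x) (enc s) r o.
have [n2 H2 L2] := exec_drop (enc s) (code (enc x) ++ r) o.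
exists (n1 + n2).+2; rewrite sz_cons; split; [|rewrite /sz; lia|rewrite /sz /=; lia].
by apply: ECase1 => //=; rewrite -catA; apply: ESeq H1 H2.
Qed.

Lemma FP_nilp (A B : encType) (l : A -> seq B) : FP l -> FP (fun x => nilp (l x)).
Proof. exact: FP_comp (FP_nilp0 _). Qed.

Lemma FP_behead (A B : encType) (l : A -> seq B) : FP l -> FP (fun x => behead (l x)).
Proof. exact: FP_comp (FP_behead0 _). Qed.

Lemma FP_head (A B : encType) (x0 : B) (l : A -> seq B) : FP l -> FP (fun x => head x0 (l x)).
Proof. exact: FP_comp (FP_head0 _). Qed.

Lemma FP_cons (A B : encType) (h : A -> B) (l : A -> seq B) :
  FP h -> FP l -> FP (fun x => h x :: l x).
Proof.
move=> Hh Hl; apply: (@FP_comp A _ _ (fun p : B * seq B => p.1 :: p.2) (fun x => (h x, l x))).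
  exact: FP_cast.
exact: FP_pair.
Qed.

Lemma mpb_homo F : mpoly_bounded F -> {homo F : m n / m <= n}. Proof. by case. Qed.

(** The loop test pops the constructor bit of the list, and the two pushes rebuild the tree of
    [((x, l), (c, s))] around what lies on the stack. The body [cb] leaves a pair [(l, _)] whose
    node bit the final [Case] removes, so the next test reads the constructor of [l]. [N] bounds all
    intermediate stack contents. *)
Lemma foldl_steps (C X S : encType) (step : C -> S -> X -> S) cb (F : nat -> nat) N :
  {homo F : m n / m <= n} ->
  (forall (a : X * seq X * (C * S)) r o, exists n,
      [/\ exec cb (pure_st (code (enc a) ++ r) o)
            (pure_st (code (enc (a.1.2, (a.2.1, step a.2.1 a.2.2 a.1.1))) ++ r) o) n
        & n <= F (sz a)]) ->
  forall (l : seq X) (c : C) (s : S),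
  (forall l1 l2, l = l1 ++ l2 -> sz (l2, (c, foldl (step c) s l1)) <= N) ->
  forall r o, exists2 n,
    exec (Loop T0 (Seq (Push T0 (Some true)) (Seq (Push T0 (Some true)) (Seq cb (Case T0 Skip Skip Skip)))))
      (pure_st (code (enc l) ++ code (enc (c, s)) ++ r) o)
      (pure_st (code (enc (c, foldl (step c) s l)) ++ r) o) n &
    n <= size l * (F N.+1 + 10) + 1.
Proof.
move=> HF Hb; elim=> [|x l IH] c s HN r o.
  by exists 1 => //; apply: ELoop0.
have [|m Hm Lm] := IH c (step c s x) _ r o.
  by move=> l1 l2 E; apply: (HN (x :: l1) l2); rewrite E.
have [n [Hn Ln]] := Hb (x, l, (c, s)) r o.
exists (1 + (1 + (n + 2)) + m).+2; last first.
  have L : sz (x, l, (c, s)) <= N.+1.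
    have := HN [::] (x :: l) erefl; rewrite !sz_pair sz_cons /=; lia.
  have := HF _ _ L; rewrite /=; nia.
apply: (@ELoop1 _ _ _ (code (enc x) ++ code (enc l) ++ code (enc (c, s)) ++ r)
          (pure_st (code (enc l) ++ code (enc (c, step c s x)) ++ r) o)); [by rewrite /= -catA| |exact: Hm].
apply: ESeq (EPush _ _ _) _; apply: ESeq (EPush _ _ _) _.
move: Hn; rewrite /= -!catA /= -!catA => Hn; apply: ESeq Hn _.
by apply: ECase1 => //; exact: ESkip.
Qed.

Lemma size_le_sz (A : encType) (l : seq A) : size l <= sz l.
Proof. by elim: l => // x l IH; rewrite sz_cons /=; lia. Qed.

Lemma sz_cat (A : encType) (l1 l2 : seq A) : (sz (l1 ++ l2)).+1 = sz l1 + sz l2.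
Proof. by elim: l1 => [|x l1 IH] /=; rewrite ?sz_nil ?sz_cons //; lia. Qed.

Lemma sz_catr (A : encType) (l1 l2 : seq A) : sz l2 <= sz (l1 ++ l2).
Proof. by have := sz_cat l1 l2; have := sz_gt0 l1; lia. Qed.

(** Iterating a polynomial time step can square the size at each turn, so a polynomial bound on
    every intermediate accumulator has to be supplied. *)
Lemma FP_foldl (C X S : encType) (step : C -> S -> X -> S) (l : C -> seq X) (s0 : C -> S) :
  FP (fun p : C * (S * X) => step p.1 p.2.1 p.2.2) -> FP l -> FP s0 ->
  (exists2 G, mpoly_bounded G &
     forall c l1 l2, l c = l1 ++ l2 -> sz (foldl (step c) (s0 c) l1) <= G (sz c)) ->
  FP (fun c => foldl (step c) (s0 c) (l c)).
Proof.
move=> Hstep Hl Hs [G HG Hb].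
have [cb [F [HF dF Hcb]]] : FP (fun a : X * seq X * (C * S) => (a.1.2, (a.2.1, step a.2.1 a.2.2 a.1.1))).
  have I := FP_id (X * seq X * (C * S))%type.
  apply: FP_pair; first exact: FP_snd (FP_fst I).
  apply: FP_pair; first exact: FP_fst (FP_snd I).
  apply: (FP_comp (f := fun a : X * seq X * (C * S) => (a.2.1, (a.2.2, a.1.1))) Hstep); apply: FP_pair; first exact: FP_fst (FP_snd I).
  by apply: FP_pair; [exact: FP_snd (FP_snd I)|exact: FP_fst (FP_fst I)].
have HE : FP (fun c => (l c, (c, s0 c))).
  by apply: FP_pair => //; apply: FP_pair => //; apply: FP_id.
have [ci [I [HI dI Hci]]] := HE.
have [cs [Sn [HSn dSn Hcs]]] := FP_snd0 C S.
pose N n := I n + n + G n + 3.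
pose M n := I n + 2 + (I n * (F (N n).+1 + 10) + 1) + Sn ((n + G n).+1) + G n.
have HN : mpoly_bounded N by rewrite /N; mpb.
have HM : mpoly_bounded M by rewrite /M; mpb.
exists (Seq ci (Case T0 Skip (Seq (Loop T0 (Seq (Push T0 (Some true)) (Seq (Push T0 (Some true)) (Seq cb (Case T0 Skip Skip Skip))))) cs) Skip)), M.
split => //; first by rewrite /= dI dF dSn.
move=> c r o; have [n1 [H1 L1 S1]] := Hci c r o.
rewrite !sz_pair in S1.
have Hinv l1 l2 : l c = l1 ++ l2 -> sz (l2, (c, foldl (step c) (s0 c) l1)) <= N (sz c).
  move=> E; have L := Hb c l1 l2 E; rewrite !sz_pair /N.
  have := sz_cat l1 l2; have := sz_gt0 l1; rewrite -E; lia.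
have [n2 H2 L2] := foldl_steps (mpb_homo HF) (fun a r o =>
   let: ex_intro n (And3 h1 h2 _) := Hcb a r o in ex_intro _ n (conj h1 h2)) Hinv r o.
have [n3 [H3 L3 S3]] := Hcs (c, foldl (step c) (s0 c) (l c)) r o.
have Lf := Hb c (l c) [::] (esym (cats0 _)).
exists (n1 + (n2 + n3).+2); split.
- apply: ESeq H1 _; rewrite /=; apply: ECase1 => //=; rewrite -catA.
  exact: ESeq H2 H3.
- have Ls : size (l c) <= I (sz c) by have := size_le_sz (l c); lia.
  have Lp : sz (c, foldl (step c) (s0 c) (l c)) <= (sz c + G (sz c)).+1 by rewrite sz_pair; lia.
  have := HSn.1 _ _ Lp; rewrite /M; nia.
- by rewrite /M; lia.
Qed.

Lemma FP_size_bound (A B : encType) (f : A -> B) :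
  FP f -> exists2 F, mpoly_bounded F & forall a, sz (f a) <= F (sz a).
Proof.
move=> [c [F [HF _ H]]]; exists F => // a.
by have [n [_ _]] := H a [::] [::].
Qed.

Lemma FP_comp2 (A B C D : encType) (h : B -> C -> D) (f : A -> B) (g : A -> C) :
  FP (fun p => h p.1 p.2) -> FP f -> FP g -> FP (fun x => h (f x) (g x)).
Proof.
by move=> Hh Hf Hg; apply: (FP_comp (f := fun x => (f x, g x)) Hh); apply: FP_pair.
Qed.

Lemma FP_arg1 (A B : encType) : FP (fun p : A * B => p.1).
Proof. exact: FP_fst0. Qed.

Lemma FP_arg2 (A B : encType) : FP (fun p : A * B => p.2).
Proof. exact: FP_snd0. Qed.

Lemma FP_negb (A : encType) (b : A -> bool) : FP b -> FP (fun x => ~~ b x).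
Proof.
move=> Hb; apply: (@FP_ext _ _ (fun x => if b x then false else true)); first by move=> x; case: (b x).
by apply: FP_if => //; apply: FP_const.
Qed.

Lemma FP_andb (A : encType) (b c : A -> bool) : FP b -> FP c -> FP (fun x => b x && c x).
Proof. by move=> Hb Hc; apply: FP_if => //; apply: FP_const. Qed.

Lemma FP_orb (A : encType) (b c : A -> bool) : FP b -> FP c -> FP (fun x => b x || c x).
Proof. by move=> Hb Hc; apply: FP_if => //; apply: FP_const. Qed.

Lemma FP_catrev0 (A : encType) : FP (fun p : seq A * seq A => catrev p.1 p.2).
Proof.
apply: (@FP_ext _ _ (fun p => foldl (fun s x => x :: s) p.2 p.1)).
  by case=> s t /=; elim: s t => //= x s IH t; rewrite IH.
apply: (@FP_foldl _ _ _ (fun p s x => x :: s)); [|exact: FP_arg1|exact: FP_arg2|].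
  apply: FP_cons; first exact: FP_snd (FP_arg2 _ _).
  exact: FP_fst (FP_arg2 _ _).
exists id; first exact: mpb_id.
case=> s t l1 l2 /= ->; rewrite sz_pair /=.
suff : sz (foldl (fun s x => x :: s) t l1) + 1 = sz l1 + sz t by have := sz_cat l1 l2; have := sz_gt0 l2; lia.
by elim: l1 t => [|x l1 IH] t /=; rewrite ?sz_nil ?sz_cons ?IH ?sz_cons; lia.
Qed.

Lemma FP_rev (A B : encType) (l : A -> seq B) : FP l -> FP (fun x => rev (l x)).
Proof.
move=> Hl; apply: (FP_comp2 (h := @catrev B) (g := fun=> [::])) => //; first exact: FP_catrev0.
exact: FP_const.
Qed.

Lemma FP_cat (A B : encType) (s t : A -> seq B) : FP s -> FP t -> FP (fun x => s x ++ t x).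
Proof.
move=> Hs Ht; apply: (@FP_ext _ _ (fun x => catrev (rev (s x)) (t x))).
  by move=> x; rewrite catrevE revK.
apply: (FP_comp2 (h := @catrev B) (f := fun x => rev (s x))) => //; first exact: FP_catrev0.
exact: FP_rev.
Qed.

Lemma FP_rcons (A B : encType) (s : A -> seq B) (t : A -> B) :
  FP s -> FP t -> FP (fun x => rcons (s x) (t x)).
Proof.
move=> Hs Ht; apply: (@FP_ext _ _ (fun x => s x ++ [:: t x])); first by move=> x; rewrite cats1.
apply: FP_cat => //; apply: FP_cons => //; exact: FP_const.
Qed.

Lemma sz_mem_cat (A : encType) (l1 l2 : seq A) x : sz x < sz (l1 ++ x :: l2).
Proof. have := sz_cat l1 (x :: l2); rewrite sz_cons; have := sz_gt0 l1; lia. Qed.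

Lemma FP_flatmap (C X Y : encType) (g : C -> X -> seq Y) (l : C -> seq X) :
  FP (fun p => g p.1 p.2) -> FP l -> FP (fun c => flatten [seq g c x | x <- l c]).
Proof.
move=> Hg Hl; have [Fg [HFg Fgk] Bg] := FP_size_bound Hg; have [Fl HFl Bl] := FP_size_bound Hl.
pose G n := Fl n * (Fg (n + Fl n + 1)) + 1.
have E c s : foldl (fun acc x => acc ++ g c x) [::] s = flatten [seq g c x | x <- s].
  elim/last_ind: s => // s x IH.
  by rewrite -cats1 foldl_cat /= IH map_cat flatten_cat /= cats0.
apply: (@FP_ext _ _ (fun c => foldl (fun acc x => acc ++ g c x) [::] (l c))) => //.
apply: (@FP_foldl _ _ _ (fun c acc x => acc ++ g c x)) => //; [|exact: FP_const|].
  apply: FP_cat; first exact: FP_fst (FP_arg2 _ _).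
  apply: (FP_comp2 (h := g)) => //; first exact: FP_arg1.
  exact: FP_snd (FP_arg2 _ _).
exists G; first by rewrite /G; have ? : mpoly_bounded Fg by []; mpb.
move=> c l1 l2 El; rewrite E /G.
have H : forall x l3 l4, l1 = l3 ++ x :: l4 -> sz (g c x) <= Fg (sz c + Fl (sz c) + 1).
  move=> x l3 l4 E1; apply: leq_trans (Bg (c, x)) _; apply: HFg; rewrite sz_pair.
  have := Bl c; rewrite El E1 -catA cat_cons; have := sz_mem_cat l3 (l4 ++ l2) x; lia.
have L : sz (flatten [seq g c x | x <- l1]) <= size l1 * Fg (sz c + Fl (sz c) + 1) + 1.
  elim/last_ind: l1 {El} H => // s x IH H.
  rewrite -cats1 map_cat flatten_cat /= cats0 size_cat /=.
  have Hx := H x s [::] (esym (cats1 _ _)).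
  have := sz_cat (flatten [seq g c x | x <- s]) (g c x).
  have {}IH : sz (flatten [seq g c i | i <- s]) <= size s * Fg (sz c + Fl (sz c) + 1) + 1.
    by apply: IH => y l3 l4 Es; apply: (H y l3 (rcons l4 x)); rewrite Es rcons_cat.
  nia.
apply: leq_trans L _; rewrite leq_add2r leq_mul2r; apply/orP; right.
apply: leq_trans (Bl c); apply: leq_trans (size_le_sz _); rewrite El size_cat; lia.
Qed.

Lemma FP_map (C X Y : encType) (g : C -> X -> Y) (l : C -> seq X) :
  FP (fun p => g p.1 p.2) -> FP l -> FP (fun c => [seq g c x | x <- l c]).
Proof.
move=> Hg Hl; apply: (@FP_ext _ _ (fun c => flatten [seq [:: g c x] | x <- l c])).
  by move=> c; rewrite flatten_map1.
apply: (@FP_flatmap _ _ _ (fun c x => [:: g c x])) => //.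
by apply: FP_cons => //; apply: FP_const.
Qed.

Lemma FP_flatten (C Y : encType) (l : C -> seq (seq Y)) : FP l -> FP (fun c => flatten (l c)).
Proof.
move=> Hl; apply: (@FP_ext _ _ (fun c => flatten [seq x | x <- l c])).
  by move=> c; rewrite map_id.
by apply: (@FP_flatmap _ _ _ (fun c x => x)) => //; apply: FP_arg2.
Qed.

Lemma FP_filter (C X : encType) (g : C -> X -> bool) (l : C -> seq X) :
  FP (fun p => g p.1 p.2) -> FP l -> FP (fun c => [seq x <- l c | g c x]).
Proof.
move=> Hg Hl; apply: (@FP_ext _ _ (fun c => flatten [seq (if g c x then [:: x] else [::]) | x <- l c])).
  by move=> c; elim: (l c) => //= x s ->; case: (g c x).
apply: (@FP_flatmap _ _ _ (fun c x => if g c x then [:: x] else [::])) => //.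
apply: FP_if => //; last exact: FP_const.
by apply: FP_cons; [apply: FP_arg2|apply: FP_const].
Qed.

Lemma FP_has (C X : encType) (g : C -> X -> bool) (l : C -> seq X) :
  FP (fun p => g p.1 p.2) -> FP l -> FP (fun c => has (g c) (l c)).
Proof.
move=> Hg Hl; apply: (@FP_ext _ _ (fun c => ~~ nilp [seq x <- l c | g c x])).
  by move=> c; rewrite has_count -size_filter /nilp lt0n.
by apply: FP_negb; apply: FP_nilp; apply: FP_filter.
Qed.

Lemma FP_all (C X : encType) (g : C -> X -> bool) (l : C -> seq X) :
  FP (fun p => g p.1 p.2) -> FP l -> FP (fun c => all (g c) (l c)).
Proof.
move=> Hg Hl; apply: (@FP_ext _ _ (fun c => ~~ has (fun x => ~~ g c x) (l c))).
  by move=> c; rewrite (has_predC (g c)) negbK.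
by apply: FP_negb; apply: (@FP_has _ _ (fun c x => ~~ g c x)) => //; apply: FP_negb.
Qed.

(** A list of units and its length have the same tree, so this conversion is free; sizes,
    successors, sums and products all go through it. *)
Lemma FP_size0 : FP (fun s : seq unit => size s).
Proof. by apply: FP_cast; elim=> [//|[] s /= ->]. Qed.

Lemma FP_size (A X : encType) (l : A -> seq X) : FP l -> FP (fun a => size (l a)).
Proof.
move=> Hl; apply: (@FP_ext _ _ (fun a => size [seq tt | _ <- l a])).
  by move=> a; rewrite size_map.
apply: (FP_comp FP_size0); apply: (@FP_map _ _ _ (fun _ _ => tt)) => //; exact: FP_const.
Qed.

Lemma FP_nseq (A B : encType) (n : A -> nat) (b : A -> B) :
  FP n -> FP b -> FP (fun a => nseq (n a) (b a)).
Proof.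
move=> Hn Hb; apply: (@FP_ext _ _ (fun a => [seq b a | _ <- nseq (n a) tt])).
  by move=> a; rewrite map_nseq.
apply: (@FP_map _ _ _ (fun a _ => b a)); first by apply: FP_comp Hb (FP_arg1 _ _).
apply: (@FP_comp _ _ _ (fun n => nseq n tt)) Hn.
by apply: FP_cast; elim=> //= k ->.
Qed.

Lemma FP_iter (C S : encType) (f : C -> S -> S) (n : C -> nat) (s0 : C -> S) :
  FP (fun p => f p.1 p.2) -> FP n -> FP s0 ->
  (exists2 G, mpoly_bounded G & forall c k, k <= n c -> sz (iter k (f c) (s0 c)) <= G (sz c)) ->
  FP (fun c => iter (n c) (f c) (s0 c)).
Proof.
move=> Hf Hn Hs [G HG Hb].
have E c k : foldl (fun s (_ : unit) => f c s) (s0 c) (nseq k tt) = iter k (f c) (s0 c).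
  by elim: k (s0 c) => // k IH s /=; rewrite IH -iterSr.
apply: (@FP_ext _ _ (fun c => foldl (fun s (_ : unit) => f c s) (s0 c) (nseq (n c) tt))) => //.
apply: (@FP_foldl _ _ _ (fun c s (_ : unit) => f c s)) => //.
- apply: (FP_comp2 (h := f)) => //; first exact: FP_arg1.
  exact: FP_fst (FP_arg2 _ _).
- by apply: FP_nseq => //; apply: FP_const.
- exists G => // c l1 l2 H.
  have El : l1 = nseq (size l1) tt by elim: (l1) => //= -[] s <-.
  rewrite El E; apply: Hb; have := congr1 size H; rewrite size_nseq size_cat; lia.
Qed.

Lemma FP_S (A : encType) (n : A -> nat) : FP n -> FP (fun a => (n a).+1).
Proof.
move=> Hn; apply: (@FP_ext _ _ (fun a => size (tt :: nseq (n a) tt))).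
  by move=> a; rewrite /= size_nseq.
by apply: FP_size; apply: FP_cons; [|apply: FP_nseq => //]; apply: FP_const.
Qed.

Lemma FP_predn (A : encType) (n : A -> nat) : FP n -> FP (fun a => (n a).-1).
Proof.
move=> Hn; apply: (@FP_ext _ _ (fun a => size (behead (nseq (n a) tt)))).
  by move=> a; rewrite size_behead size_nseq.
by apply: FP_size; apply: FP_behead; apply: FP_nseq => //; apply: FP_const.
Qed.

Lemma FP_addn (A : encType) (m n : A -> nat) : FP m -> FP n -> FP (fun a => m a + n a).
Proof.
move=> Hm Hn; apply: (@FP_ext _ _ (fun a => size (nseq (m a) tt ++ nseq (n a) tt))).
  by move=> a; rewrite size_cat !size_nseq.
by apply: FP_size; apply: FP_cat; apply: FP_nseq => //; apply: FP_const.
Qed.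

Lemma FP_muln (A : encType) (m n : A -> nat) : FP m -> FP n -> FP (fun a => m a * n a).
Proof.
move=> Hm Hn; apply: (@FP_ext _ _ (fun a => size (flatten [seq nseq (n a) tt | _ <- nseq (m a) tt]))).
  by move=> a; elim: (m a) => //= k IH; rewrite size_cat IH size_nseq mulSn.
apply: FP_size; apply: (@FP_flatmap _ _ _ (fun a _ => nseq (n a) tt)).
  by apply: FP_nseq; [apply: FP_comp Hn (FP_arg1 _ _)|apply: FP_const].
by apply: FP_nseq => //; apply: FP_const.
Qed.

Lemma FP_subn (A : encType) (m n : A -> nat) : FP m -> FP n -> FP (fun a => m a - n a).
Proof.
have E k p : iter k predn p = p - k by elim: k p => [|k IH] p /=; rewrite ?subn0 // IH subnS.
move=> Hm Hn; apply: (@FP_ext _ _ (fun a => iter (n a) predn (m a))) => //.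
apply: (@FP_iter _ _ (fun _ => predn)) => //; first by apply: FP_predn; exact: FP_arg2.
have [F HF B] := FP_size_bound Hm; exists F => // a k _; apply: leq_trans (B a).
by rewrite E !sz_nat; lia.
Qed.

Lemma FP_leq (A : encType) (m n : A -> nat) : FP m -> FP n -> FP (fun a => m a <= n a).
Proof.
move=> Hm Hn; apply: (@FP_ext _ _ (fun a => nilp (nseq (m a - n a) tt))).
  by move=> a; rewrite /nilp size_nseq subn_eq0.
by apply: FP_nilp; apply: FP_nseq; [apply: FP_subn|apply: FP_const].
Qed.

Lemma FP_eqn (A : encType) (m n : A -> nat) : FP m -> FP n -> FP (fun a => m a == n a).
Proof.
move=> Hm Hn; apply: (@FP_ext _ _ (fun a => (m a <= n a) && (n a <= m a))).
  by move=> a; rewrite eqn_leq.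
by apply: FP_andb; apply: FP_leq.
Qed.

Lemma FP_minn (A : encType) (m n : A -> nat) : FP m -> FP n -> FP (fun a => minn (m a) (n a)).
Proof. by move=> Hm Hn; apply: FP_if => //; apply: FP_leq => //; apply: FP_S. Qed.

Lemma sz_drop (A : encType) k (l : seq A) : sz (drop k l) <= sz l.
Proof.
have := sz_cat (take k l) (drop k l); rewrite cat_take_drop.
by have := sz_gt0 (take k l); lia.
Qed.

Lemma FP_drop (A X : encType) (n : A -> nat) (l : A -> seq X) :
  FP n -> FP l -> FP (fun a => drop (n a) (l a)).
Proof.
have E k (s : seq X) : iter k behead s = drop k s by elim: k s => [|k IH] s; rewrite ?drop0 // iterS IH -drop1 drop_drop.
move=> Hn Hl; apply: (@FP_ext _ _ (fun a => iter (n a) behead (l a))) => //.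
apply: (@FP_iter _ _ (fun _ => behead)) => //; first by apply: FP_behead; exact: FP_arg2.
have [F HF B] := FP_size_bound Hl; exists F => // a k _; apply: leq_trans (B a).
by rewrite E sz_drop.
Qed.

Lemma FP_nth (A X : encType) (x0 : X) (n : A -> nat) (l : A -> seq X) :
  FP n -> FP l -> FP (fun a => nth x0 (l a) (n a)).
Proof.
move=> Hn Hl; apply: (@FP_ext _ _ (fun a => head x0 (drop (n a) (l a)))).
  by move=> a; rewrite -nth0 nth_drop addn0.
by apply: FP_head; apply: FP_drop.
Qed.

Lemma FP_iota0 (A : encType) (n : A -> nat) : FP n -> FP (fun a => iota 0 (n a)).
Proof.
have E k : iter k (fun s => rcons s (size s)) [::] = iota 0 k.
  by elim: k => // k IH; rewrite iterS IH size_iota -addn1 iotaD cats1.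
move=> Hn; apply: (@FP_ext _ _ (fun a => iter (n a) (fun s => rcons s (size s)) [::])) => //.
apply: (@FP_iter _ _ (fun _ s => rcons s (size s))) => //; last first.
- have [F HF B] := FP_size_bound Hn; exists (fun k => F k * (2 * F k + 2) + 1); first by mpb.
  move=> a k Hk; rewrite E; have := B a; rewrite sz_nat => Hna.
  have L : sz (iota 0 k) <= k * (2 * n a + 2) + 1.
    elim: k Hk => // k IH Hk; rewrite -[in iota _ _]addn1 iotaD /= add0n mulSn.
    have : (sz (iota 0 k ++ [:: k])).+1 = sz (iota 0 k) + (k.*2.+1 + 1).+1.
      by rewrite sz_cat sz_cons sz_nil sz_nat.
    by have := IH (ltnW Hk); lia.
  nia.
- exact: FP_const.
- by apply: FP_rcons; [|apply: FP_size]; exact: FP_arg2.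
Qed.

Lemma FP_odd_half (A : encType) (n : A -> nat) : FP n -> FP (fun a => (odd (n a), (n a)./2)).
Proof.
pose f (p : bool * nat) := (~~ p.1, if p.1 then p.2.+1 else p.2).
have E k : iter k f (false, 0) = (odd k, k./2).
  by elim: k => // k IH; rewrite iterS IH /f /= uphalf_half; case: (odd k).
move=> Hn; apply: (@FP_ext _ _ (fun a => iter (n a) f (false, 0))) => //.
apply: (@FP_iter _ _ (fun _ => f)) => //; last first.
- have [F HF B] := FP_size_bound Hn; exists (fun k => F k + 5); first by mpb.
  move=> a k Hk; rewrite E; have := B a; rewrite sz_pair !sz_nat; have := sz_bool (odd k); lia.
- exact: FP_const.
- have I := FP_arg2 A (bool * nat)%type.
  apply: FP_pair; first by apply: FP_negb; apply: FP_fst.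
  by apply: FP_if; [apply: FP_fst|apply: FP_S; apply: FP_snd|apply: FP_snd].
Qed.

Lemma FP_eqb (A : encType) (b c : A -> bool) : FP b -> FP c -> FP (fun a => b a == c a).
Proof.
move=> Hb Hc; apply: (@FP_ext _ _ (fun x => if b x then c x else ~~ c x)).
  by move=> x; case: (b x); case: (c x).
by apply: FP_if => //; apply: FP_negb.
Qed.

Definition eq_fold (T : eqType) (x0 : T) (s t : seq T) : bool * seq T :=
  foldl (fun p x => ([&& p.1, ~~ nilp p.2 & x == head x0 p.2], behead p.2)) (true, t) s.

Lemma eq_foldE (T : eqType) (x0 : T) s t : (eq_fold x0 s t).1 && nilp (eq_fold x0 s t).2 = (s == t).
Proof.
rewrite /eq_fold; have -> : (s == t) = true && (s == t) by [].
elim: s t true => [|x s IH] t b /=; first by case: t.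
by rewrite IH; case: t => [|y t] /=; rewrite ?andbF // eqseq_cons !andbA.
Qed.

Lemma eq_fold_rest (T : eqType) (x0 : T) s t : (eq_fold x0 s t).2 = drop (size s) t.
Proof.
rewrite /eq_fold; elim: s t true => [|x s IH] t b /=; first by rewrite drop0.
by rewrite IH; case: t.
Qed.

Lemma FP_eq_seqnat (A : encType) (s t : A -> seq nat) :
  FP s -> FP t -> FP (fun a => s a == t a).
Proof.
move=> Hs Ht; have [Ft HFt Bt] := FP_size_bound Ht.
apply: (@FP_ext _ _ (fun a => (eq_fold 0 (s a) (t a)).1 && nilp (eq_fold 0 (s a) (t a)).2)).
  by move=> a; rewrite eq_foldE.
have H : FP (fun a => eq_fold 0 (s a) (t a)).
  rewrite /eq_fold.
  apply: (@FP_foldl A nat_encType (prod_encType bool_encType (seq_encType nat_encType))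
    (fun _ (p : bool * seq nat) (x : nat) => ([&& p.1, ~~ nilp p.2 & x == head 0 p.2], behead p.2))
    s (fun a => (true, t a))) => //.
  - have I := FP_arg2 A (prod_encType (prod_encType bool_encType (seq_encType nat_encType)) nat_encType).
    have J := FP_snd (FP_fst I).
    apply: FP_pair; last exact: FP_behead.
    apply: FP_andb; first exact: FP_fst (FP_fst I).
    apply: FP_andb; first by apply: FP_negb; apply: FP_nilp.
    by apply: FP_eqn; [exact: FP_snd I|apply: FP_head].
  - by apply: FP_pair => //; apply: FP_const.
  - exists (fun n => Ft n + 5); first by mpb.
    move=> a l1 l2 _; rewrite -/(eq_fold 0 l1 (t a)) [eq_fold _ _ _]surjective_pairing sz_pair eq_fold_rest.
    set X := sz (drop _ _); have LX : X <= sz (t a) by apply: sz_drop.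
    by have := sz_bool (eq_fold 0 l1 (t a)).1; have := Bt a; lia.
by apply: FP_andb; [exact: FP_fst H|apply: FP_nilp; exact: FP_snd H].
Qed.

Canonical tree_encType := @EncType tree id.

(** [X] may have no default element, so the content travels as a raw tree with default [Leaf], and
    [FP_branch] reads it back as an element of [X]. *)
Lemma FP_ocase (A X B : encType) (o : A -> option X) (f : A -> X -> B) (g : A -> B) :
  FP o -> FP (fun p => f p.1 p.2) -> FP g ->
  FP (fun a => if o a is Some x then f a x else g a).
Proof.
move=> Ho Hf Hg; pose os a : seq tree := if o a is Some x then [:: enc x] else [::].
have Hos : FP os.
  apply: (FP_comp (f := o) (g := fun u => if u is Some x then [:: enc x] else [::])) => //.
  by apply: FP_cast; case.
apply: (@FP_branch A (prod_encType A unit_encType) (prod_encType A X) B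
  (prod_encType bool_encType (prod_encType A tree_encType)) (fun a => (~~ nilp (os a), (a, head Leaf (os a)))) _
  (fun p => g p.1) (fun p => f p.1 p.2)) => //.
- apply: FP_pair; first by apply: FP_negb; apply: FP_nilp.
  by apply: FP_pair; [apply: FP_id|apply: FP_head].
- move=> a; rewrite /os; case: (o a) => [x|]; last by left; exists (a, tt).
  by right; exists (a, x).
- by apply: FP_comp Hg (FP_arg1 _ _).
Qed.

Lemma FP_scase (A X B : encType) (l : A -> seq X) (f : A -> X -> seq X -> B) (g : A -> B) :
  FP l -> FP (fun p => f p.1 p.2.1 p.2.2) -> FP g ->
  FP (fun a => if l a is x :: s then f a x s else g a).
Proof.
move=> Hl Hf Hg.
apply: (@FP_branch A (prod_encType A unit_encType) (prod_encType A (prod_encType X (seq_encType X))) B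
  (prod_encType bool_encType (prod_encType A (seq_encType X))) (fun a => (~~ nilp (l a), (a, l a))) _
  (fun p => g p.1) (fun p => f p.1 p.2.1 p.2.2)) => //.
- apply: FP_pair; first by apply: FP_negb; apply: FP_nilp.
  by apply: FP_pair => //; apply: FP_id.
- move=> a; case: (l a) => [|x s]; first by left; exists (a, tt).
  by right; exists (a, (x, s)).
- by apply: FP_comp Hg (FP_arg1 _ _).
Qed.

Lemma FP_some (A B : encType) (f : A -> B) : FP f -> FP (fun a => Some (f a)).
Proof.
move=> Hf; apply: (FP_comp (f := fun a => (f a, tt)) (g := fun p => Some p.1)); first exact: FP_cast.
by apply: FP_pair => //; apply: FP_const.
Qed.

Ltac fp1 :=
  match goal with
  | H : FP _ |- FP _ => exact H
  | H : FP ?h |- FP (fun x => ?h (@?g x)) => apply: (FP_comp (f := g) H)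
  | |- FP (fun x => x) => exact: FP_id
  | |- FP (fun _ => ?c) => exact: FP_const
  | |- FP (fun x => fst (@?f x)) => apply: (@FP_fst _ _ _ f)
  | |- FP (fun x => snd (@?f x)) => apply: (@FP_snd _ _ _ f)
  | |- FP (fun x => pair (@?f x) (@?g x)) => apply: (@FP_pair _ _ _ f g)
  | |- FP (fun x => Some (@?f x)) => apply: (@FP_some _ _ f)
  | |- FP (fun x => cons (@?f x) (@?g x)) => apply: (@FP_cons _ _ f g)
  | |- FP (fun x => cat (@?f x) (@?g x)) => apply: (@FP_cat _ _ f g)
  | |- FP (fun x => rev (@?f x)) => apply: (@FP_rev _ _ f)
  | |- FP (fun x => flatten (@?f x)) => apply: (@FP_flatten _ _ f)
  | |- FP (fun x => nilp (@?f x)) => apply: (@FP_nilp _ _ f)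
  | |- FP (fun x => head ?a (@?f x)) => apply: (@FP_head _ _ a f)
  | |- FP (fun x => nth ?a (@?f x) (@?g x)) => apply: (@FP_nth _ _ a g f)
  | |- FP (fun x => size (@?f x)) => apply: (@FP_size _ _ f)
  | |- FP (fun x => S (@?f x)) => apply: (@FP_S _ f)
  | |- FP (fun x => addn (@?f x) (@?g x)) => apply: (@FP_addn _ f g)
  | |- FP (fun x => muln (@?f x) (@?g x)) => apply: (@FP_muln _ f g)
  | |- FP (fun x => leq (@?f x) (@?g x)) => apply: (@FP_leq _ f g)
  | |- FP (fun x => minn (@?f x) (@?g x)) => apply: (@FP_minn _ f g)
  | |- FP (fun x => nseq (@?f x) (@?g x)) => apply: (@FP_nseq _ _ f g)
  | |- FP (fun x => iota 0 (@?f x)) => apply: (@FP_iota0 _ f)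
  | |- FP (fun x => negb (@?f x)) => apply: (@FP_negb _ f)
  | |- FP (fun x => andb (@?f x) (@?g x)) => apply: (@FP_andb _ f g)
  | |- FP (fun x => orb (@?f x) (@?g x)) => apply: (@FP_orb _ f g)
  | |- FP (fun x => eq_op (@?f x) (@?g x)) =>
      first [apply: (@FP_eqn _ f g) | apply: (@FP_eqb _ f g) | apply: (@FP_eq_seqnat _ f g)]
  | |- FP (fun c => map (fun x => @?g c x) (@?l c)) => apply: (@FP_map _ _ _ g l)
  | |- FP (fun c => filter (fun x => @?g c x) (@?l c)) => apply: (@FP_filter _ _ g l)
  | |- FP (fun c => has (fun x => @?g c x) (@?l c)) => apply: (@FP_has _ _ g l)
  | |- FP (fun c => all (fun x => @?g c x) (@?l c)) => apply: (@FP_all _ _ g l)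
  | |- FP _ => first [apply: FP_if | apply: FP_ocase | apply: FP_scase]
  end; cbn beta.

Ltac fp := repeat fp1.

(** * Decodable prefix-free encodings *)

(** [cdecK] makes the decoder exact and not merely a left inverse: success proves that the word is
    an encoding. Hence non-encodings are recognized, as the complement of the problem requires. *)
Record codec (A : encType) := Codec {
  cenc : A -> seq bool;
  cdec : seq bool -> option (A * seq bool);
  cencK : forall x r, cdec (cenc x ++ r) = Some (x, r);
  cdecK : forall s x r, cdec s = Some (x, r) -> s = cenc x ++ r;
  cdecFP : FP cdec
}.

Lemma FP_cdec (A B : encType) (c : codec B) (f : A -> seq bool) : FP f -> FP (fun x => cdec c (f x)).
Proof. exact: FP_comp (cdecFP c). Qed.

Ltac fpc := repeat first [exact: cdecFP | fp1 | match goal with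
  | |- FP (fun x => cdec ?c (@?f x)) => apply: (@FP_cdec _ _ c f) end; cbn beta].

Definition unit_codec : codec unit_encType.
Proof.
apply: (@Codec _ (fun=> [::]) (fun s => Some (tt, s))); first by case.
  by move=> s [] r [->].
by fp.
Defined.

Definition bool_codec : codec bool_encType.
Proof.
apply: (@Codec _ enc_bool (fun s => if s is b :: r then Some (b, r) else None)) => //.
  by case=> // b s x r [-> ->].
by fp.
Defined.

Definition pair_codec (A B : encType) (c : codec A) (d : codec B) : codec (prod_encType A B).
Proof.
apply: (@Codec _ (fun p => cenc c p.1 ++ cenc d p.2)
    (fun s => if cdec c s is Some p then
                if cdec d p.2 is Some q then Some ((p.1, q.1), q.2) else None
              else None)).
- by case=> x y r; rewrite -catA !cencK.
- move=> s [x y] r; case E: (cdec c s) => [[x' r1]|//] /=.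
  case E1: (cdec d r1) => [[y' r2]|//] /= -[<- <- <-].
  by rewrite (cdecK E) (cdecK E1) catA.
- by fpc.
Defined.

Definition option_codec (A : encType) (c : codec A) : codec (option_encType A).
Proof.
apply: (@Codec _ (enc_option (cenc c))
    (fun s => if s is b :: r then
                if b then (if cdec c r is Some p then Some (Some p.1, p.2) else None)
                else Some (None, r)
              else None)).
- by case=> [x|] r //=; rewrite cencK.
- case=> [//|[] s] x r; last by case=> <- <-.
  by case E: (cdec c s) => [[y r1]|//] [<- <-]; rewrite (cdecK E).
- by fpc.
Defined.

Section SeqCodec.

Variables (A : encType) (c : codec A).

(* The flag tells whether the end of the list has been read. *)
Definition seq_dec_state : encType :=
  option_encType (prod_encType (prod_encType (seq_encType A) (seq_encType bool_encType)) bool_encType).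

Definition seq_dec_step (u : seq_dec_state) : seq_dec_state :=
  if u is Some p then
    if p.2 then Some p else
    if p.1.2 is b :: r then
      if b then
        if cdec c r is Some q then Some (q.1 :: p.1.1, q.2, false) else None
      else Some (p.1.1, r, true)
    else None
  else None.

(** As many rounds as input bits suffice: each item consumes at least its marker bit, and a finished
    state is a fixed point of the step. *)
Definition seq_dec (s : seq bool) : option (seq A * seq bool) :=
  if iter (size s) seq_dec_step (Some ([::], s, false)) is Some p then
    if p.2 then Some (rev p.1.1, p.1.2) else None
  else None.

Definition seq_pre (l : seq A) : seq bool := flatten [seq true :: cenc c x | x <- l].

Lemma enc_seq_pre l : enc_seq (cenc c) l = seq_pre l ++ [:: false].
Proof. by elim: l => //= x l ->; rewrite -!catA. Qed.

Lemma seq_dec_done n (p : seq A * seq bool * bool) : p.2 -> iter n seq_dec_step (Some p) = Some p.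
Proof. by move=> H; elim: n => //= n ->; rewrite /= H. Qed.

Lemma seq_encK l r : seq_dec (enc_seq (cenc c) l ++ r) = Some (l, r).
Proof.
rewrite /seq_dec; suff H n acc : size l < n ->
    iter n seq_dec_step (Some (acc, enc_seq (cenc c) l ++ r, false)) = Some (catrev l acc, r, true).
  rewrite H //= -?[X in rev X]/(rev l) ?revK //.
  rewrite size_cat enc_seq_pre size_cat addn1.
  apply: leq_trans (leq_addr _ _); rewrite ltnS.
  by rewrite /seq_pre; elim: (l) => //= x l' IH; rewrite size_cat; lia.
elim: l n acc => [|x l IH] [|n] acc // H; rewrite iterSr /=; first by rewrite seq_dec_done.
by rewrite -catA cencK /= IH.
Qed.

Lemma seq_dec_inv s n : 
  if iter n seq_dec_step (Some ([::], s, false)) is Some p then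
    s = seq_pre (rev p.1.1) ++ (if p.2 then [:: false] else [::]) ++ p.1.2
  else True.
Proof.
elim: n => //= n; case: (iter n _ _) => [[[acc r] d]|//] /=; case: d => //=.
case: r => [|[] r] //= E.
case E1: (cdec c r) => [[x r']|//] /=.
by rewrite E (cdecK E1) rev_cons -cats1 /seq_pre map_cat flatten_cat /= cats0 -!catA.
Qed.

Lemma seq_decK s l r : seq_dec s = Some (l, r) -> s = enc_seq (cenc c) l ++ r.
Proof.
rewrite /seq_dec; have := seq_dec_inv s (size s).
case: (iter _ _ _) => [[[acc r'] []]|] //= -> [<- <-].
by rewrite enc_seq_pre -catA.
Qed.

Lemma seq_dec_stepFP : FP seq_dec_step.
Proof. by rewrite /seq_dec_step; fpc. Qed.

Lemma sz_some (B : encType) (x : B) : sz (Some x) = (sz x).+2.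
Proof. by rewrite /sz /= size_cat /=; lia. Qed.

Lemma seq_decFP : FP seq_dec.
Proof.
have H : FP (fun s : seq bool => iter (size s) seq_dec_step (Some ([::], s, false))).
  apply: (@FP_iter _ _ (fun _ => seq_dec_step)).
  - exact: FP_comp seq_dec_stepFP (FP_arg2 _ _).
  - exact: FP_size (FP_id _).
  - apply: FP_some; apply: FP_pair; last exact: FP_const.
    by apply: FP_pair; [apply: FP_const|apply: FP_id].
  - have [F [HF FF] B] := FP_size_bound (cdecFP c).
    exists (fun n => n * (F n + n + 1) + n + 20); first by have ? : mpoly_bounded F by []; mpb.
    move=> s k Hk; have Hk' : k <= sz s := leq_trans Hk (size_le_sz _).
    suff : if iter k seq_dec_step (Some ([::], s, false)) is Some p then
       sz p.1.1 <= k * (F (sz s) + 1) + 1 /\ sz p.1.2 <= sz s else True.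
      case: (iter _ _ _) => [[[acc r] d]|] /=; last by rewrite /sz /=; lia.
      by case=> H1 H2; rewrite sz_some !sz_pair; have := sz_bool d; nia.
    elim: k {Hk Hk'} => [|k IH]; first by rewrite /= sz_nil.
    rewrite iterS; have := seq_dec_inv s k; case: (iter k _ _) IH => [[[acc r] d]|//] /= [H1 H2].
    case: d => //=; first by move=> _; split => //; lia.
    case: r H2 => [|[] r] //= H2 E; last by rewrite sz_cons in H2; split; lia.
    case E1: (cdec c r) => [[x r']|//] /=; have := B r; rewrite E1 sz_some sz_pair => L.
    rewrite sz_cons in H2.
    have M : F (sz r) <= F (sz s) by apply: HF; lia.
    split; first by rewrite sz_cons; lia.
    have L3 : sz r' <= sz r by rewrite (cdecK E1); apply: sz_catr.
    by apply: leq_trans L3 _; lia.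
by rewrite /seq_dec; fp.
Qed.

Definition seq_codec : codec (seq_encType A) := Codec seq_encK seq_decK seq_decFP.

End SeqCodec.

(** * From raw words to coded trees and back; the two complexity theorems *)

(** Looping on [src] itself would stop at its first [false]. The loop runs instead on a flag renewed
    after each popped bit, and ends when [src] is empty and no flag is renewed. *)
Definition spill (fl src : reg) (h : bool -> cmd) : cmd :=
  Seq (Push fl (Some true))
    (Loop fl (Case src (Seq (h false) (Push fl (Some true))) (Seq (h true) (Push fl (Some true))) Skip)).

(* [S l a t] is the state with [l] on [src], [t] on [fl] and [a] elsewhere. *)
Lemma exec_spill (X : Type) (fl src : reg) (h : bool -> cmd) (S : seq bool -> X -> seq bool -> st)
    (g : bool -> X -> X) K :
  (forall l a t, get src (S l a t) = l) ->
  (forall l a t, get fl (S l a t) = t) ->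
  (forall l l' a t, set src l' (S l a t) = S l' a t) ->
  (forall l a t t', set fl t' (S l a t) = S l a t') ->
  (forall b l a, exists2 n, exec (h b) (S l a [::]) (S l (g b a) [::]) n & n <= K) ->
  forall l a, exists2 n, exec (spill fl src h) (S l a [::]) (S [::] (foldl (fun a b => g b a) a l) [::]) n
    & n <= size l * (K + 5) + 10.
Proof.
move=> gs gf ss sf Hh l a.
have P l1 a1 t1 : exec (Push fl (Some true)) (S l1 a1 t1) (S l1 a1 (true :: t1)) 1.
  by have := EPush fl (Some true) (S l1 a1 t1); rewrite /do_push gf sf.
suff [n H L] : exists2 n, exec (Loop fl (Case src (Seq (h false) (Push fl (Some true))) (Seq (h true) (Push fl (Some true))) Skip))
   (S l a [:: true]) (S [::] (foldl (fun a b => g b a) a l) [::]) n & n <= size l * (K + 5) + 9.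
  by exists (1 + n); [exact: ESeq (P _ _ _) H|lia].
elim: l a => [|b l IH] a /=.
  exists (1 + 1).+2 => //.
  apply: (@ELoop1 _ _ _ [::] (S [::] a [::])); first by rewrite gf.
    by rewrite sf; apply: ECaseE; [rewrite gs|apply: ESkip].
  by apply: ELoopE; rewrite gf.
have [n Hn Ln] := IH (g b a); have [m Hm Lm] := Hh b l a.
exists ((m + 1).+2 + n).+2; last by lia.
apply: (@ELoop1 _ _ _ [::] (S l (g b a) [:: true])); [by rewrite gf|rewrite sf|exact: Hn].
have E := ESeq Hm (P l (g b a) [::]).
by case: b E {Hm Hn IH} => E; [apply: (@ECase1 _ _ _ _ _ l)|apply: (@ECase0 _ _ _ _ _ l)]; rewrite ?gs ?ss.
Qed.

Lemma exec_push_all_gen s a t1 t2 t3 o :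
  exec (push_all s) (St a t1 t2 t3 o) (St (s ++ a) t1 t2 t3 o) (size s).
Proof.
elim: s => [|b s IH] /=; first exact: ESkip.
by rewrite -addn1; apply: ESeq IH _; apply: EPush.
Qed.

Definition c_input : cmd :=
  Seq (spill T3 T0 (fun b => Push T1 (Some b)))
    (Seq (Push T0 (Some false)) (spill T3 T1 (fun b => push_all (true :: code (enc b))))).

Lemma exec_input (w o : seq bool) : exists2 n,
  exec c_input (St w [::] [::] [::] o) (pure_st (code (enc w)) o) n & n <= size w * 20 + 30.
Proof.
have [||||b l a|n1 H1 L1] := @exec_spill _ T3 T0 (fun b => Push T1 (Some b)) (fun l a t => St l a [::] t o) cons 1 _ _ _ _ _ w [::] => //.
  by exists 1 => //; apply: EPush.
have [||||b l a|n2 H2 L2] := @exec_spill _ T3 T1 (fun b => push_all (true :: code (enc b))) (fun l a t => St a l [::] t o)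
   (fun b a => true :: code (enc b) ++ a) 5 _ _ _ _ _ (rev w) [:: false] => //.
  exists (size (true :: code (enc b))); last by case: b.
  exact: exec_push_all_gen.
exists (n1 + (1 + n2)); last by rewrite size_rev in L2; lia.
apply: ESeq H1 _; apply: ESeq (EPush _ _ _) _ => /=.
have -> : foldl (fun a b => b :: a) [::] w = rev w.
  by elim/last_ind: w {L1 n2 H2 L2} => // w x IH; rewrite -cats1 foldl_cat IH /= rev_cat.
suff <- : foldl (fun a b => true :: code (enc b) ++ a) [:: false] (rev w) = code (enc w) by [].
rewrite foldl_rev; elim: (w) => //= x s ->.
by case: x.
Qed.

Definition c_output : cmd :=
  Seq (Loop T0 (Case T0 (Push T1 (Some false)) (Case T0 (Case T0 (Push T1 (Some true)) Skip Skip) Skip Skip) Skip))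
    (spill T2 T1 (fun b => Push T3 (Some b))).

Lemma exec_output (w o : seq bool) : exists2 n,
  exec c_output (pure_st (code (enc w)) o) (St [::] [::] [::] w o) n & n <= size w * 20 + 30.
Proof.
have H1 (l : seq bool) a : exists2 n, exec (Loop T0 (Case T0 (Push T1 (Some false)) (Case T0 (Case T0 (Push T1 (Some true)) Skip Skip) Skip Skip) Skip))
   (St (code (enc l)) a [::] [::] o) (St [::] (rev l ++ a) [::] [::] o) n & n <= size l * 10 + 1.
  elim: l a => [|b l IH] a; first by exists 1 => //; apply: ELoop0.
  have [n H L] := IH (b :: a); rewrite rev_cons cat_rcons.
  case: b H => H; [exists (7 + n).+2|exists (3 + n).+2]; rewrite /=; try lia.
    apply: ELoop1 H => //=; apply: ECase1 => //=; apply: ECase0 => //=; apply: ECase0 => //=.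
    exact: EPush.
  apply: ELoop1 H => //=; apply: ECase0 => //=; exact: EPush.
have [n1 E1 L1] := H1 w [::]; rewrite cats0 in E1.
have [||||b l a|n2 H2 L2] := @exec_spill _ T2 T1 (fun b => Push T3 (Some b)) (fun l a t => St [::] l t a o) cons 1 _ _ _ _ _ (rev w) [::] => //.
  by exists 1 => //; apply: EPush.
exists (n1 + n2); last by rewrite size_rev in L2; lia.
apply: ESeq E1 _; rewrite (_ : foldl _ _ _ = w) in H2 => //.
by rewrite foldl_rev; elim: (w) => //= x s ->.
Qed.

Lemma mpb_poly F : mpoly_bounded F -> exists p : {poly nat}, forall n, F n <= (p.[n])%R.
Proof.
move=> [_ [k H]]; exists (('X + 2%:P) ^+ k)%R => n; apply: leq_trans (H n) _.
elim: k {H} => [|k IH]; first by rewrite expr0 hornerC.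
by rewrite exprS expnS hornerM hornerD hornerX hornerC leq_mul.
Qed.

Lemma sz_bits (w : seq bool) : sz w <= 4 * size w + 1.
Proof. by elim: w => // b w IH; rewrite sz_cons /=; have := sz_bool b; lia. Qed.

Theorem FP_polytime (f : seq bool -> seq bool) : FP f -> polytime_computable f.
Proof.
move=> [cf [F [HF dF Hf]]].
pose c := Seq c_input (Seq cf c_output); pose cd := compile 0 c.
pose B n := 2 * (n * 20 + 30 + F (4 * n + 1) + (F (4 * n + 1) * 20 + 30)).
have [p Hp] : exists p : {poly nat}, forall n, B n <= (p.[n])%R.
  by apply: mpb_poly; rewrite /B; mpb.
exists (machine cd 0), p; split.
  by apply: machine_deterministic; apply: deterministic_compile; rewrite /= dF.
move=> w; have [n1 H1 L1] := exec_input w [::].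
have [n2 [H2 L2 S2]] := Hf w [::] [::].
have [n3 H3 L3] := exec_output (f w) [::].
rewrite !cats0 in H2.
have Hx : exec c (St w [::] [::] [::] [::]) (St [::] [::] [::] (f w) [::]) (n1 + (n2 + n3)).
  by apply: ESeq H1 _; apply: ESeq H2 _.
have := exec_fsteps Hx [::] [::]; rewrite /= cats0 -/c -/cd => Hs.
have [k [c' [L4 R4 rep4]]] := reach_det (repc_init cd 0 w) Hs.
exists k, c'; split => //.
- apply: repc_halted rep4 _; have Hcd : size cd = clen c by exact: size_compile.
  by rewrite /fstep onth_default // Hcd.
- apply: leq_trans (Hp _); apply: leq_trans L4 _; rewrite /B.
  have M := HF.1 _ _ (sz_bits w).
  have Lf : size (f w) <= sz (f w) by apply: size_le_sz.
  lia.
- by rewrite (repc_output rep4).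
Qed.

(** Builds [2 ^ m] marks on [T1], doubling them through [T2] once per unit of the unary [m] on [T0].
    The [Case] removes the leaf that accompanies each unit. *)
Definition c_double : cmd :=
  Seq (Push T1 (Some true))
   (Loop T0 (Case T0 (Seq (spill T3 T1 (fun=> Seq (Push T2 (Some true)) (Push T2 (Some true))))
                          (spill T3 T2 (fun=> Push T1 (Some true)))) Skip Skip)).

Lemma exec_double (m : nat) r o : exists2 n,
  exec c_double (pure_st (code (enc m) ++ r) o) (St r (nseq (2 ^ m) true) [::] [::] o) n
  & n <= (m + 1) * (2 ^ m * 40 + 40).
Proof.
have D l j : foldl (fun a (_ : bool) => true :: true :: a) (nseq j true) (nseq l true) = nseq (l.*2 + j) true.
  by elim: l j => // l IH j; rewrite /= (IH j.+2) !addnS.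
have D' l j : foldl (fun a (_ : bool) => true :: a) (nseq j true) (nseq l true) = nseq (l + j) true.
  by elim: l j => // l IH j; rewrite /= (IH j.+1) addnS.
have main k : exists2 n, exec (Loop T0 (Case T0 (Seq (spill T3 T1 (fun=> Seq (Push T2 (Some true)) (Push T2 (Some true))))
                          (spill T3 T2 (fun=> Push T1 (Some true)))) Skip Skip))
   (St (code (enc m) ++ r) (nseq (2 ^ k) true) [::] [::] o)
   (St r (nseq (2 ^ (m + k)) true) [::] [::] o) n & n <= m * (2 ^ (m + k) * 40 + 40) + 1.
  elim: m k => [|m IH] k; first by exists 1 => //; apply: ELoop0.
  have [n1 H1 L1] := IH k.+1.
  have [||||b l a|n2 H2 L2] := @exec_spill _ T3 T1 (fun=> Seq (Push T2 (Some true)) (Push T2 (Some true)))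
     (fun l a t => St (code (enc m) ++ r) l a t o) (fun _ a => true :: true :: a) 2 _ _ _ _ _ (nseq (2 ^ k) true) [::] => //.
    by exists (1 + 1) => //; apply: ESeq (EPush _ _ _) _; apply: EPush.
  rewrite (D _ 0) addn0 in H2.
  have [||||b l a|n3 H3 L3] := @exec_spill _ T3 T2 (fun=> Push T1 (Some true))
     (fun l a t => St (code (enc m) ++ r) a l t o) (fun _ a => true :: a) 1 _ _ _ _ _ (nseq (2 ^ k).*2 true) [::] => //.
    by exists 1 => //; apply: EPush.
  rewrite (D' _ 0) addn0 in H3; rewrite !size_nseq in L2 L3.
  rewrite addSnnS in L1 H1 *.
  exists ((n2 + n3).+2 + n1).+2.
    apply: ELoop1 H1 => //=; apply: ECase0 => //=; apply: ESeq H2 _.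
    by rewrite expnS mul2n.
  have : 2 ^ k.+1 <= 2 ^ (m + k.+1) by rewrite leq_exp2l ?leq_addl.
  by rewrite expnS mulSn; lia.
have [n H L] := main 0; rewrite addn0 in H L.
by exists (1 + n); [apply: ESeq H; apply: EPush|rewrite mulnDl; lia].
Qed.

Definition c_guess : cmd :=
  Seq (Push T0 (Some false))
   (spill T3 T1 (fun=> Seq (Push T2 None)
      (Case T2 (push_all (true :: code (enc false))) (push_all (true :: code (enc true))) Skip))).

(** Pushing reverses the order of the oracle bits, and an exhausted oracle yields [false]. *)
Definition guessed (k : nat) (o : seq bool) : seq bool :=
  rev (take k (o ++ nseq k false)).

Lemma exec_guess k r o : exists2 n,
  exec c_guess (St r (nseq k true) [::] [::] o)
    (pure_st (code (enc (guessed k o)) ++ r) (drop k o)) n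
  & n <= k * 20 + 20.
Proof.
have [||||b l [a u]|n H L] := @exec_spill _ T3 T1 (fun=> Seq (Push T2 None)
      (Case T2 (push_all (true :: code (enc false))) (push_all (true :: code (enc true))) Skip))
     (fun l a t => St a.1 l [::] t a.2) (fun _ a => (true :: code (enc (head false a.2)) ++ a.1, behead a.2)) 10
     _ _ _ _ _ (nseq k true) (false :: r, o) => //.
  have P s := exec_push_all_gen s a l [::] [::] (behead u).
  case: u P => [|[] u] P; (eexists; [apply: ESeq (EPush _ _ _) _|]).
  - by apply: ECase0 => //; apply: P.
  - by [].
  - by apply: ECase1 => //; apply: P.
  - by [].
  - by apply: ECase0 => //; apply: P.
  - by [].
exists (1 + n); last by rewrite size_nseq in L; lia.
apply: ESeq (EPush _ _ _) _ => /=.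
suff E : foldl (fun a (_ : bool) => (true :: code (enc (head false a.2)) ++ a.1, behead a.2)) (false :: r, o) (nseq k true)
   = (code (enc (guessed k o)) ++ r, drop k o) by rewrite E in H; exact: H.
have G (s : seq bool) u : foldl (fun a (_ : bool) => (true :: code (enc (head false a.2)) ++ a.1, behead a.2)) (code (enc s) ++ r, u) (nseq k true)
   = (code (enc (guessed k u ++ s)) ++ r, drop k u).
  elim: k s u {n H L} => [|k IH] s u; first by rewrite /guessed take0 drop0.
  have := IH (head false u :: s) (behead u); rewrite /= -!catA => ->.
  have -> : guessed k (behead u) ++ head false u :: s = guessed k.+1 u ++ s; last by case: (u).
  rewrite /guessed; case: u => [|b u] /=.
    by rewrite !take_oversize ?size_nseq // rev_cons cat_rcons.
  rewrite rev_cons cat_rcons; congr (rev _ ++ _).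
  rewrite !take_cat; case: ltnP => // H; congr (_ ++ _).
  by rewrite -[false :: nseq k _]/(nseq k.+1 false) !take_nseq //; lia.
by have := G [::] o; rewrite cats0.
Qed.

Lemma guessedP k (c : seq bool) : size c = k -> guessed k (rev c) = c.
Proof. by move=> E; rewrite /guessed take_cat size_rev E ltnn subnn take0 cats0 revK. Qed.

Lemma size_guessed k o : size (guessed k o) = k.
Proof. by rewrite /guessed size_rev size_take size_cat size_nseq; case: ltnP; lia. Qed.

Lemma mpb_pow2 F q : mpoly_bounded F -> mpoly_bounded q ->
  exists p : {poly nat}, forall n, F (2 ^ q n + n) <= 2 ^ (p.[n])%R.
Proof.
move=> [_ [k H]] Hq; have [|p Hp] := @mpb_poly (fun n => (q n + n + 2) * k); first by mpb.
exists p => n; apply: leq_trans (H _) _.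
apply: leq_trans (_ : 2 ^ ((q n + n + 2) * k) <= _); last by rewrite leq_exp2l.
rewrite expnM; case: k {H Hp} => // k; rewrite leq_exp2r // !expnD.
have := ltn_expl n (isT : 1 < 2); have : 0 < 2 ^ q n by rewrite expn_gt0.
rewrite -[2 ^ 2]/4; nia.
Qed.

(** The length of the certificate is fixed by [size w], so every branch makes the same number of
    guesses, and the time bound holds uniformly in the oracle, hence for all computations. A
    polynomial of [2 ^ q n + n] is again [2 ^ poly n]. *)
Theorem FP_NEXPTIME (P : language) (q : nat -> nat) (chk : seq bool -> seq bool -> bool) :
  FP (fun p => chk p.1 p.2) -> mpoly_bounded q -> FP q ->
  (forall w, P w <-> exists2 c, size c = 2 ^ q (size w) & chk c w) ->
  NEXPTIME P.
Proof.
move=> [cc [C [HC dC Hcc]]] Hq Fq HP.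
have [cm [F [HF dF Hcm]]] : FP (fun w : seq bool => (q (size w), w)).
  by apply: FP_pair; [apply: (FP_comp (f := fun w : seq bool => size w) Fq); fp|fp].
pose c := Seq c_input (Seq cm (Case T0 Skip
  (Seq c_double (Seq c_guess (Seq (Push T0 (Some true)) cc))) Skip)).
(* The extra instruction turns the verdict into a halting address: both targets lie past the code,
   and only [(clen c).+2], reached on [true], is accepting. *)
pose cd := compile 0 c ++ [:: IPop T0 (clen c).+1 (clen c).+2 (clen c).+1].
pose G x := x * 20 + 30 + F (4 * x + 1) + (F (4 * x + 1) + 1) * (x * 40 + 40) + (x * 20 + 20) +
  C (8 * x + 3) + 10.
have HG : mpoly_bounded G by rewrite /G; mpb.
have [p Hp] := mpb_pow2 (F := fun n => 2 * G n) (mpbM (mpb_const 2) HG) Hq.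
have Hrun w o : exists n o', [/\ n <= G (2 ^ q (size w) + size w),
    fsteps cd n (0, St w [::] [::] [::] o) (if chk (guessed (2 ^ q (size w)) o) w then (clen c).+2 else (clen c).+1,
      pure_st (if chk (guessed (2 ^ q (size w)) o) w then [:: false; false] else [::]) o')
    & fstep cd (if chk (guessed (2 ^ q (size w)) o) w then (clen c).+2 else (clen c).+1,
      pure_st (if chk (guessed (2 ^ q (size w)) o) w then [:: false; false] else [::]) o') = None].
  set m := q (size w); set g := guessed _ _.
  have [n1 H1 L1] := exec_input w o.
  have [n2 [H2 L2 S2]] := Hcm w [::] o.
  have [n3 H3 L3] := exec_double m (code (enc w)) o.
  have [n4 H4 L4] := exec_guess (2 ^ m) (code (enc w)) o.
  set o' := drop _ o in H4.
  have [n5 [H5 L5 S5]] := Hcc (g, w) [::] o'.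
  have Hx : exec c (St w [::] [::] [::] o) (pure_st (code (enc (chk g w))) o') (n1 + (n2 + (n3 + (n4 + (1 + n5))).+2)).
    apply: ESeq H1 _; rewrite !cats0 in H2 H5; apply: ESeq H2 _.
    apply: ECase1 => //=; apply: ESeq H3 _; apply: ESeq H4 _; apply: ESeq (EPush _ _ _) _.
    exact: H5.
  have Hs := exec_fsteps Hx [::] [:: IPop T0 (clen c).+1 (clen c).+2 (clen c).+1].
  have sc : size (compile 0 c) = clen c by exact: size_compile.
  exists (n1 + (n2 + (n3 + (n4 + (1 + n5))).+2)).+1, o'; split.
  - have Mw : F (sz w) <= F (4 * (2 ^ m + size w) + 1).
      by apply: HF.1; have := sz_bits w; lia.
    have Mm : m <= F (sz w) by move: S2; rewrite sz_pair sz_nat -/m; lia.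
    have Mc : C (sz (g, w)) <= C (8 * (2 ^ m + size w) + 3).
      apply: HC.1; rewrite sz_pair; have := sz_bits w; have := sz_bits g; rewrite size_guessed; lia.
    have Mx : (m + 1) * (2 ^ m * 40 + 40) <= (F (4 * (2 ^ m + size w) + 1) + 1) * ((2 ^ m + size w) * 40 + 40).
      by apply: leq_mul; lia.
    rewrite /G; lia.
  - have at_end : onth cd (clen c) = Some (IPop T0 (clen c).+1 (clen c).+2 (clen c).+1).
      by rewrite /cd onth_cat sc ltnn subnn.
    by apply: fstepsSr Hs _; rewrite /fstep add0n at_end; case: (chk g w).
  - have sd : size cd = (clen c).+1 by rewrite size_cat sc addn1.
    by rewrite /fstep onth_default // sd; case: (chk g w).
exists (machine cd (clen c).+2), p; split.
  move=> w n c' Hn; apply: leq_trans (Hp _).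
  apply: (machine_bounded (repc_init cd (clen c).+2 w) _ Hn) => o.
  by have [n1 [o' [H1 H2 H3]]] := Hrun w o; eexists; eexists; split; [exact: H1|exact: H2|exact: H3].
move=> w; rewrite HP (machine_accepts (repc_init cd (clen c).+2 w)); split.
  move=> [x Hx Hc]; have [n1 [o' [H1 H2 H3]]] := Hrun w (rev x).
  rewrite guessedP // Hc in H2 H3; exists (rev x), n1; eexists; split; [exact: H2|exact: H3|by []].
move=> [o [n [y [H1 H2 H3]]]].
have [n1 [o' [H4 H5 H6]]] := Hrun w o.
exists (guessed (2 ^ q (size w)) o); first by rewrite size_guessed.
have [L R] := fsteps_halt H1 H5 H6.
case: (n1 - n) R => [|k] /=; last by case=> z; rewrite H2.
by move=> E; move: H3; rewrite E; case: (chk _ w) => //= /eqP; rewrite eqn_leq ltnn andbF.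
Qed.

(** * A verifier for non-opacity *)

(** The numbers of an instance stay binary strings, as their unary form could be exponentially long
    in the input; they become numbers only through the truncation [cv]. *)
Definition bits : Type := seq bool.
Definition rconstr : Type := (bits * (bits * (bool * bits)))%type.
Definition redge : Type :=
  (bits * (seq rconstr * (option bits * (bits * bits))))%type.
Definition rinst : Type :=
  (seq unit * (seq unit * (seq unit * (bits * (bits * (bits *
    (seq (seq rconstr) * (seq redge * bits))))))))%type.

Definition bits_codec : codec (seq_encType bool_encType) := seq_codec bool_codec.
Definition rconstr_codec := pair_codec bits_codec (pair_codec bits_codec (pair_codec bool_codec bits_codec)).
Definition redge_codec := pair_codec bits_codec (pair_codec (seq_codec rconstr_codec)
  (pair_codec (option_codec bits_codec) (pair_codec bits_codec bits_codec))).
Definition rinst_codec :=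
  pair_codec (seq_codec unit_codec) (pair_codec (seq_codec unit_codec) (pair_codec (seq_codec unit_codec)
  (pair_codec bits_codec (pair_codec bits_codec (pair_codec bits_codec
  (pair_codec (seq_codec (seq_codec rconstr_codec)) (pair_codec (seq_codec redge_codec) bits_codec))))))).

(** Horner's rule from the most significant digit, truncated at each step so that the accumulator
    never exceeds [C]; the result is the minimum of [C] and the value. *)
Definition cv (C : nat) (b : bits) : nat :=
  foldl (fun acc (x : bool) => minn (x + (acc + acc)) C) 0 (rev b).

Lemma cv_le C b : cv C b <= C.
Proof.
rewrite /cv; elim/last_ind: (rev b) => // s x _.
by rewrite -cats1 foldl_cat /= geq_minr.
Qed.

Lemma FP_cv (A : encType) (C : A -> nat) (b : A -> bits) :
  FP C -> FP (b : A -> seq_encType bool_encType) -> FP (fun x => cv (C x) (b x)).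
Proof.
move=> HC Hb; have [F HF B] := FP_size_bound HC.
apply: (@FP_foldl _ bool_encType nat_encType (fun x (acc : nat) (y : bool) => minn (y + (acc + acc)) (C x))).
- by fp.
- by apply: FP_rev.
- by fp.
- exists (fun n => F n + 1); first by mpb.
  move=> a l1 l2 _.
  apply: leq_trans (leq_trans _ (B a)) (leq_addr _ _); rewrite !sz_nat ltnS leq_double.
  by have := cv_le (C a) (rev l1); rewrite /cv revK.
Qed.

(** The image of [binary_digits]: the last digit, which is the most significant, is 1, unless the
    string has a single digit. *)
Definition canon (b : bits) : bool := head false (rev b) || (size b == 1).
Definition vidx (n : nat) (b : bits) : bool := canon b && (cv n b < n).
(** The bound 5 is the number of comparison operators. The last clause excludes a negative zero,
    which [enc_int] never produces. *)
Definition vconstr (nc : nat) (c : rconstr) : bool :=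
  vidx nc c.1 && (vidx 5 c.2.1 && (canon c.2.2.2 && (~~ c.2.2.1 || (0 < cv 1 c.2.2.2)))).
Definition vedge (na nl nc : nat) (e : redge) : bool :=
  vidx nl e.1 && (all (fun c => vconstr nc c) e.2.1 &&
  ((if e.2.2.1 is Some a then vidx na a else true) &&
   ((size e.2.2.2.1 == nc) && vidx nl e.2.2.2.2))).

Definition r_na (r : rinst) : nat := size r.1.
Definition r_nl (r : rinst) : nat := size r.2.1.
Definition r_nc (r : rinst) : nat := size r.2.2.1.
Definition r_init (r : rinst) : bits := r.2.2.2.1.
Definition r_priv (r : rinst) : bits := r.2.2.2.2.1.
Definition r_fin (r : rinst) : bits := r.2.2.2.2.2.1.
Definition r_inv (r : rinst) : seq (seq rconstr) := r.2.2.2.2.2.2.1.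
Definition r_edges (r : rinst) : seq redge := r.2.2.2.2.2.2.2.1.
Definition r_nobs (r : rinst) : bits := r.2.2.2.2.2.2.2.2.

Definition valid (r : rinst) : bool :=
  vidx (r_nl r) (r_init r) && ((size (r_priv r) == r_nl r) && ((size (r_fin r) == r_nl r) &&
  ((size (r_inv r) == r_nl r) && (all (fun g => all (fun c => vconstr (r_nc r) c) g) (r_inv r) &&
  (all (fun e => vedge (r_na r) (r_nl r) (r_nc r) e) (r_edges r) && canon (r_nobs r)))))).

Definition rconstr_encType : encType :=
  prod_encType (seq_encType bool_encType) (prod_encType (seq_encType bool_encType) (prod_encType bool_encType (seq_encType bool_encType))).
Definition redge_encType : encType :=
  prod_encType (seq_encType bool_encType) (prod_encType (seq_encType rconstr_encType)
  (prod_encType (option_encType (seq_encType bool_encType)) (prod_encType (seq_encType bool_encType) (seq_encType bool_encType)))).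
Definition rinst_encType : encType :=
  prod_encType (seq_encType unit_encType) (prod_encType (seq_encType unit_encType) (prod_encType (seq_encType unit_encType)
  (prod_encType (seq_encType bool_encType) (prod_encType (seq_encType bool_encType) (prod_encType (seq_encType bool_encType)
  (prod_encType (seq_encType (seq_encType rconstr_encType)) (prod_encType (seq_encType redge_encType) (seq_encType bool_encType)))))))).

Lemma FP_canon (A : encType) (b : A -> bits) :
  FP (b : A -> seq_encType bool_encType) -> FP (fun x => canon (b x)).
Proof. by move=> Hb; rewrite /canon; fp. Qed.

Lemma FP_vidx (A : encType) (n : A -> nat) (b : A -> bits) :
  FP n -> FP (b : A -> seq_encType bool_encType) -> FP (fun x => vidx (n x) (b x)).
Proof.
by move=> Hn Hb; have ? := FP_cv Hn Hb; have ? := FP_canon Hb; rewrite /vidx; fp.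
Qed.

Section RawProjections.
Variables (A : encType) (f : A -> rinst).
Hypothesis Hf : FP (f : A -> rinst_encType).
Lemma FP_r_na : FP ((fun x => r_na (f x)) : A -> nat_encType).
Proof. by rewrite /r_na; fp. Qed.
Lemma FP_r_nl : FP ((fun x => r_nl (f x)) : A -> nat_encType).
Proof. by rewrite /r_nl; fp. Qed.
Lemma FP_r_nc : FP ((fun x => r_nc (f x)) : A -> nat_encType).
Proof. by rewrite /r_nc; fp. Qed.
Lemma FP_r_init : FP ((fun x => r_init (f x)) : A -> seq_encType bool_encType).
Proof. by rewrite /r_init; fp. Qed.
Lemma FP_r_priv : FP ((fun x => r_priv (f x)) : A -> seq_encType bool_encType).
Proof. by rewrite /r_priv; fp. Qed.
Lemma FP_r_fin : FP ((fun x => r_fin (f x)) : A -> seq_encType bool_encType).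
Proof. by rewrite /r_fin; fp. Qed.
Lemma FP_r_inv : FP ((fun x => r_inv (f x)) : A -> seq_encType (seq_encType rconstr_encType)).
Proof. by rewrite /r_inv; fp. Qed.
Lemma FP_r_edges : FP ((fun x => r_edges (f x)) : A -> seq_encType redge_encType).
Proof. by rewrite /r_edges; fp. Qed.
Lemma FP_r_nobs : FP ((fun x => r_nobs (f x)) : A -> seq_encType bool_encType).
Proof. by rewrite /r_nobs; fp. Qed.
End RawProjections.

Lemma FP_vconstr (A : encType) (n : A -> nat) (c : A -> rconstr) :
  FP n -> FP (c : A -> rconstr_encType) -> FP (fun x => vconstr (n x) (c x)).
Proof.
move=> Hn Hc; rewrite /vconstr; repeat first [match goal with
  | |- FP (fun x => cv (@?n x) (@?b x)) => apply: (@FP_cv _ n b)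
  | |- FP (fun x => vidx (@?n x) (@?b x)) => apply: (@FP_vidx _ n b)
  | |- FP (fun x => canon (@?b x)) => apply: (@FP_canon _ b) end; cbn beta | fp1].
Qed.

Ltac fpv := repeat first [match goal with
  | |- FP (fun x => cv (@?n x) (@?b x)) => apply: (@FP_cv _ n b)
  | |- FP (fun x => vidx (@?n x) (@?b x)) => apply: (@FP_vidx _ n b)
  | |- FP (fun x => canon (@?b x)) => apply: (@FP_canon _ b)
  | |- FP (fun x => vconstr (@?n x) (@?b x)) => apply: (@FP_vconstr _ n b)
  | |- FP (fun x => r_na (@?b x)) => apply: (@FP_r_na _ b)
  | |- FP (fun x => r_nl (@?b x)) => apply: (@FP_r_nl _ b)
  | |- FP (fun x => r_nc (@?b x)) => apply: (@FP_r_nc _ b)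
  | |- FP (fun x => r_init (@?b x)) => apply: (@FP_r_init _ b)
  | |- FP (fun x => r_priv (@?b x)) => apply: (@FP_r_priv _ b)
  | |- FP (fun x => r_fin (@?b x)) => apply: (@FP_r_fin _ b)
  | |- FP (fun x => r_inv (@?b x)) => apply: (@FP_r_inv _ b)
  | |- FP (fun x => r_edges (@?b x)) => apply: (@FP_r_edges _ b)
  | |- FP (fun x => r_nobs (@?b x)) => apply: (@FP_r_nobs _ b)
  end; cbn beta | fp1].

Lemma FP_valid : FP (valid : rinst_encType -> bool).
Proof. by rewrite /valid /vedge; fpv. Qed.

(** Location, truncated clock values, and whether a private location has been visited. *)
Definition node : Type := (nat * (seq nat * bool))%type.
Definition node_encType : encType :=
  prod_encType nat_encType (prod_encType (seq_encType nat_encType) bool_encType).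
Definition pairs_encType : encType := seq_encType (prod_encType node_encType node_encType).

Definition cmpn (k m d : nat) : bool :=
  if k == 0 then m < d else if k == 1 then m <= d else if k == 2 then m == d
  else if k == 3 then d <= m else d < m.

(* The constant of a constraint is compared after truncation to [C]; a negative
   one is below every clock value. *)
Definition satc (C : nat) (v : seq nat) (c : rconstr) : bool :=
  if c.2.2.1 then 3 <= cv 5 c.2.1
  else cmpn (cv 5 c.2.1) (nth 0 v (cv (size v) c.1)) (cv C c.2.2.2).

Definition invat (C : nat) (r : rinst) (l : nat) (v : seq nat) : bool :=
  all (fun c => satc C v c) (nth [::] (r_inv r) l).

Definition tickv (C : nat) (v : seq nat) : seq nat := [seq minn x.+1 C | x <- v].

Definition resetv (R : bits) (v : seq nat) : seq nat :=
  [seq (if nth false R k then 0 else nth 0 v k) | k <- iota 0 (size v)].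

(** A final location has no successor, here and in [edge_succ]: a run stops at its first final
    location. *)
Definition tick_succ (C : nat) (r : rinst) (x : node) : seq node :=
  if ~~ nth false (r_fin r) x.1 && invat C r x.1 (tickv C x.2.1)
  then [:: (x.1, (tickv C x.2.1, x.2.2))] else [::].

Definition edge_succ (C : nat) (r : rinst) (x : node) (e : redge) : seq node :=
  if (cv (r_nl r) e.1 == x.1) && (~~ nth false (r_fin r) x.1 &&
     (all (fun c => satc C x.2.1 c) e.2.1 &&
      invat C r (cv (r_nl r) e.2.2.2.2) (resetv e.2.2.2.1 x.2.1)))
  then [:: (cv (r_nl r) e.2.2.2.2, (resetv e.2.2.2.1 x.2.1,
            x.2.2 || nth false (r_priv r) (cv (r_nl r) e.2.2.2.2)))]
  else [::].

Definition eps_succ (C : nat) (r : rinst) (x : node) : seq node :=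
  flatten [seq (if e.2.2.1 is Some b then [::] else edge_succ C r x e) | e <- r_edges r].

(** Truncation at [a.+1] is just enough to decide whether the action of the edge is exactly [a]. *)
Definition obs_succ (C : nat) (r : rinst) (a : nat) (x : node) : seq node :=
  flatten [seq (if e.2.2.1 is Some b then
                  if cv a.+1 b == a then edge_succ C r x e else [::]
                else [::]) | e <- r_edges r].

Definition all_succ (C : nat) (r : rinst) (x : node) : seq node :=
  flatten [seq edge_succ C r x e | e <- r_edges r].

Definition meq (x y : node) : bool := (x.1 == y.1) && ((x.2.1 == y.2.1) && (x.2.2 == y.2.2)).
Definition nmem (x : node) (l : seq node) : bool := has (fun y => meq x y) l.
Definition pmem (x y : node) (R : seq (node * node)) : bool :=
  has (fun q => meq x q.1 && meq y q.2) R.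
Definition square (V : seq node) : seq (node * node) :=
  flatten [seq [seq (x, y) | y <- V] | x <- V].
Definition rcomp (V : seq node) (R S : seq (node * node)) : seq (node * node) :=
  [seq p <- square V | has (fun y => pmem p.1 y R && pmem y p.2 S) V].
Definition prefl (V : seq node) (R : seq (node * node)) : seq (node * node) :=
  [seq p <- square V | meq p.1 p.2 || pmem p.1 p.2 R].
(** Reflexive transitive closure by repeated squaring. One squaring per element of [V] reaches paths
    of length [2 ^ size V], far beyond the length of simple paths. *)
Definition clo (V : seq node) (R : seq (node * node)) : seq (node * node) :=
  foldl (fun M (_ : node) => rcomp V M M) (prefl V R) V.
Definition img (V S : seq node) (R : seq (node * node)) : seq node :=
  [seq y <- V | has (fun x => pmem x y R) S].
(** Binary exponentiation, least significant digit first: the state is the set advanced so far and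
    the current power [M ^ (2 ^ j)]. The order of the digits is harmless because powers of one
    relation commute. *)
Definition ipow (V S : seq node) (M : seq (node * node)) (b : bits) : seq node :=
  (foldl (fun p (x : bool) => ((if x then img V p.1 p.2 else p.1), rcomp V p.2 p.2)) (S, M) b).1.

Definition rtick C r V := [seq p <- square V | nmem p.2 (tick_succ C r p.1)].
Definition reps C r V := [seq p <- square V | nmem p.2 (eps_succ C r p.1)].
Definition robs C r V a := [seq p <- square V | nmem p.2 (obs_succ C r a p.1)].
Definition rall C r V := [seq p <- square V | nmem p.2 (all_succ C r p.1)].

(** [T] and the letter relations end with the silent closure [E], so silent edges are absorbed after
    each time unit and each letter. *)
Definition run_sets (C : nat) (r : rinst) (V : seq node) (E T : seq (node * node))
    (S : seq node) (w : seq (bits * nat)) : seq node :=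
  foldl (fun S p => img V (ipow V S T p.1) (rcomp V (robs C r V p.2) E)) S w.

Definition init_node (r : rinst) : node :=
  (cv (r_nl r) (r_init r), (nseq (r_nc r) 0, nth false (r_priv r) (cv (r_nl r) (r_init r)))).

Definition start (C : nat) (r : rinst) : seq node :=
  if invat C r (init_node r).1 (init_node r).2.1 then [:: init_node r] else [::].

Definition good (r : rinst) (V S : seq node) (G : seq (node * node)) (f : bool) : bool :=
  has (fun x => has (fun y => pmem x y G && (nth false (r_fin r) y.1 && (y.2.2 == f))) V) S.

Definition const_ok (C : nat) (g : seq rconstr) : bool := all (fun c => cv C c.2.2.2 < C) g.

Definition closedV (C : nat) (r : rinst) (V : seq node) : bool :=
  all (fun x => all (fun y => nmem y V) (tick_succ C r x ++ all_succ C r x)) V.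

(** [C] and [V] come from the certificate: the constants must lie below [C], and [V] must contain
    the initial node and be closed under successors. After the last letter of [w], the run may
    continue with any edge if [w] already has [N] letters, since later observations are cut off;
    otherwise [w] is its whole trace and only silent edges may follow. *)
Definition verify (C : nat) (r : rinst) (V : seq node) (w : seq (bits * nat)) (f : bool) : bool :=
  all (fun g => const_ok C g) (r_inv r) && (all (fun e => const_ok C e.2.1) (r_edges r) &&
  ((cv C (r_nobs r) < C) && ((size w <= cv C (r_nobs r)) && (nmem (init_node r) V &&
  (closedV C r V &&
   let E := clo V (reps C r V) in
   let S := run_sets C r V E (rcomp V (rtick C r V) E) (img V (start C r) E) w in
   let G := clo V (rtick C r V ++
      (if size w == cv C (r_nobs r) then rall C r V else reps C r V)) in
   good r V S G f && ~~ good r V S G (~~ f)))))).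

(** * The verifier runs in polynomial time *)

Lemma FP_cmpn (A : encType) (k m d : A -> nat) :
  FP k -> FP m -> FP d -> FP (fun x => cmpn (k x) (m x) (d x)).
Proof. by move=> Hk Hm Hd; rewrite /cmpn; fp. Qed.

Ltac fpn tac := repeat first [match goal with
  | |- FP (fun x => cmpn (@?k x) (@?m x) (@?d x)) => apply: (@FP_cmpn _ k m d) end; cbn beta
  | tac | match goal with
  | |- FP (fun x => cv (@?n x) (@?b x)) => apply: (@FP_cv _ n b)
  | |- FP (fun x => r_nl (@?b x)) => apply: (@FP_r_nl _ b)
  | |- FP (fun x => r_nc (@?b x)) => apply: (@FP_r_nc _ b)
  | |- FP (fun x => r_init (@?b x)) => apply: (@FP_r_init _ b)
  | |- FP (fun x => r_priv (@?b x)) => apply: (@FP_r_priv _ b)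
  | |- FP (fun x => r_fin (@?b x)) => apply: (@FP_r_fin _ b)
  | |- FP (fun x => r_inv (@?b x)) => apply: (@FP_r_inv _ b)
  | |- FP (fun x => r_edges (@?b x)) => apply: (@FP_r_edges _ b)
  | |- FP (fun x => r_nobs (@?b x)) => apply: (@FP_r_nobs _ b)
  end; cbn beta | fp1].

Section VerifierFP.

Variable A : encType.
Variables (C l k : A -> nat) (r : A -> rinst) (v : A -> seq nat) (x y : A -> node) (c : A -> rconstr)
  (e : A -> redge) (b : A -> bits) (V S : A -> seq node) (P Q R : A -> seq (node * node)).
Hypotheses (HC : FP C) (Hl : FP l) (Hk : FP k) (Hr : FP (r : A -> rinst_encType)) (Hv : FP v)
  (Hx : FP (x : A -> node_encType)) (Hy : FP (y : A -> node_encType)) (Hc : FP (c : A -> rconstr_encType))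
  (He : FP (e : A -> redge_encType)) (Hb : FP (b : A -> seq_encType bool_encType))
  (HV : FP (V : A -> seq_encType node_encType)) (HS : FP (S : A -> seq_encType node_encType))
  (HP : FP (P : A -> pairs_encType)) (HQ : FP (Q : A -> pairs_encType)) (HR : FP (R : A -> pairs_encType)).

Lemma FP_satc : FP (fun a => satc (C a) (v a) (c a)).
Proof using HC Hv Hc. by rewrite /satc; fpn fail. Qed.

Lemma FP_tickv : FP (fun a => tickv (C a) (v a)).
Proof using HC Hv. by rewrite /tickv; fpn fail. Qed.

Lemma FP_resetv : FP (fun a => resetv (b a) (v a)).
Proof using Hb Hv. by rewrite /resetv; fpn fail. Qed.

Lemma FP_meq : FP (fun a => meq (x a) (y a)).
Proof using Hx Hy. by rewrite /meq; fpn fail. Qed.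

Lemma FP_square : FP ((fun a => square (V a)) : A -> pairs_encType).
Proof using HV. by rewrite /square; fpn fail. Qed.
End VerifierFP.

Section VerifierFP2.

Variable A : encType.
Variables (C l k : A -> nat) (r : A -> rinst) (v : A -> seq nat) (x y : A -> node)
  (e : A -> redge) (b : A -> bits) (V S : A -> seq node) (P Q R : A -> seq (node * node)).
Hypotheses (HC : FP C) (Hl : FP l) (Hk : FP k) (Hr : FP (r : A -> rinst_encType)) (Hv : FP v)
  (Hx : FP (x : A -> node_encType)) (Hy : FP (y : A -> node_encType))
  (He : FP (e : A -> redge_encType)) (Hb : FP (b : A -> seq_encType bool_encType))
  (HV : FP (V : A -> seq_encType node_encType)) (HS : FP (S : A -> seq_encType node_encType))
  (HP : FP (P : A -> pairs_encType)) (HQ : FP (Q : A -> pairs_encType)) (HR : FP (R : A -> pairs_encType)).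

Ltac t1 := match goal with
  | |- FP (fun x => satc (@?k x) (@?m x) (@?d x)) => apply: (@FP_satc _ k m d)
  | |- FP (fun x => tickv (@?k x) (@?m x)) => apply: (@FP_tickv _ k m)
  | |- FP (fun x => resetv (@?k x) (@?m x)) => apply: (@FP_resetv _ m k)
  | |- FP (fun x => meq (@?k x) (@?m x)) => apply: (@FP_meq _ k m)
  | |- FP (fun x => square (@?k x)) => apply: (@FP_square _ k)
  end; cbn beta.

Lemma FP_invat : FP (fun a => invat (C a) (r a) (l a) (v a)).
Proof using HC Hr Hl Hv. by rewrite /invat; fpn t1. Qed.

Lemma FP_nmem : FP (fun a => nmem (x a) (V a)).
Proof using Hx HV. by rewrite /nmem; fpn t1. Qed.

Lemma FP_pmem : FP (fun a => pmem (x a) (y a) (R a)).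
Proof using Hx Hy HR. by rewrite /pmem; fpn t1. Qed.
End VerifierFP2.

Ltac t2 := match goal with
  | |- FP (fun x => satc (@?k x) (@?m x) (@?d x)) => apply: (@FP_satc _ k m d)
  | |- FP (fun x => tickv (@?k x) (@?m x)) => apply: (@FP_tickv _ k m)
  | |- FP (fun x => resetv (@?k x) (@?m x)) => apply: (@FP_resetv _ m k)
  | |- FP (fun x => meq (@?k x) (@?m x)) => apply: (@FP_meq _ k m)
  | |- FP (fun x => square (@?k x)) => apply: (@FP_square _ k)
  | |- FP (fun x => invat (@?c x) (@?r x) (@?l x) (@?v x)) => apply: (@FP_invat _ c l r v)
  | |- FP (fun x => nmem (@?k x) (@?m x)) => apply: (@FP_nmem _ k m)
  | |- FP (fun x => pmem (@?k x) (@?m x) (@?d x)) => apply: (@FP_pmem _ k m d)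
  end; cbn beta.

Section VerifierFP3.

Variable A : encType.
Variables (C k : A -> nat) (r : A -> rinst) (x : A -> node)
  (e : A -> redge) (V S : A -> seq node) (P Q R : A -> seq (node * node)).
Hypotheses (HC : FP C) (Hk : FP k) (Hr : FP (r : A -> rinst_encType))
  (Hx : FP (x : A -> node_encType)) 
  (He : FP (e : A -> redge_encType)) 
  (HV : FP (V : A -> seq_encType node_encType)) (HS : FP (S : A -> seq_encType node_encType))
  (HP : FP (P : A -> pairs_encType)) (HQ : FP (Q : A -> pairs_encType)) (HR : FP (R : A -> pairs_encType)).

Lemma FP_tick_succ : FP ((fun a => tick_succ (C a) (r a) (x a)) : A -> seq_encType node_encType).
Proof using HC Hr Hx. by rewrite /tick_succ; fpn t2. Qed.

Lemma FP_edge_succ : FP ((fun a => edge_succ (C a) (r a) (x a) (e a)) : A -> seq_encType node_encType).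
Proof using HC Hr Hx He. by rewrite /edge_succ; fpn t2. Qed.

Lemma FP_rcomp : FP ((fun a => rcomp (V a) (P a) (Q a)) : A -> pairs_encType).
Proof using HV HP HQ. by rewrite /rcomp; fpn t2. Qed.

Lemma FP_prefl : FP ((fun a => prefl (V a) (P a)) : A -> pairs_encType).
Proof using HV HP. by rewrite /prefl; fpn t2. Qed.

Lemma FP_img : FP ((fun a => img (V a) (S a) (P a)) : A -> seq_encType node_encType).
Proof using HV HS HP. by rewrite /img; fpn t2. Qed.
End VerifierFP3.

Ltac t3 := first [t2 | match goal with
  | |- FP (fun x => tick_succ (@?k x) (@?m x) (@?d x)) => apply: (@FP_tick_succ _ k m d)
  | |- FP (fun x => edge_succ (@?k x) (@?m x) (@?d x) (@?e x)) => apply: (@FP_edge_succ _ k m d e)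
  | |- FP (fun x => rcomp (@?k x) (@?m x) (@?d x)) => apply: (@FP_rcomp _ k m d)
  | |- FP (fun x => prefl (@?k x) (@?m x)) => apply: (@FP_prefl _ k m)
  | |- FP (fun x => img (@?k x) (@?m x) (@?d x)) => apply: (@FP_img _ k m d)
  end; cbn beta].

Lemma sz_filter (B : encType) (p : pred B) (s : seq B) : sz (filter p s) <= sz s.
Proof. by elim: s => //= z s IH; case: ifP => _; rewrite !sz_cons; lia. Qed.

Section VerifierFP4.

Variable A : encType.
Variables (C k : A -> nat) (r : A -> rinst) (x : A -> node) (b : A -> bits)
  (V S : A -> seq node) (P Q : A -> seq (node * node)).
Hypotheses (HC : FP C) (Hk : FP k) (Hr : FP (r : A -> rinst_encType))
  (Hx : FP (x : A -> node_encType)) (Hb : FP (b : A -> seq_encType bool_encType))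
  (HV : FP (V : A -> seq_encType node_encType)) (HS : FP (S : A -> seq_encType node_encType))
  (HP : FP (P : A -> pairs_encType)) (HQ : FP (Q : A -> pairs_encType)).

Lemma FP_eps_succ : FP ((fun a => eps_succ (C a) (r a) (x a)) : A -> seq_encType node_encType).
Proof using HC Hr Hx. by rewrite /eps_succ; fpn t3. Qed.

Lemma FP_obs_succ : FP ((fun a => obs_succ (C a) (r a) (k a) (x a)) : A -> seq_encType node_encType).
Proof using HC Hr Hx Hk. by rewrite /obs_succ; fpn t3. Qed.

Lemma FP_all_succ : FP ((fun a => all_succ (C a) (r a) (x a)) : A -> seq_encType node_encType).
Proof using HC Hr Hx. by rewrite /all_succ; fpn t3. Qed.

(** Every intermediate relation is a sublist of [square V], which supplies the accumulator bound;
    [FP_ipow] and [FP_run_sets] bound their accumulators in the same way. *)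
Lemma FP_clo : FP ((fun a => clo (V a) (P a)) : A -> pairs_encType).
Proof using HV HP.
rewrite /clo; have [F HF B] := FP_size_bound (FP_square HV).
apply: (@FP_foldl A node_encType pairs_encType (fun a M _ => rcomp (V a) M M)); [by fpn t3| |by fpn t3|].
  by [].
exists F => // a l1 l2 _; apply: leq_trans (B a).
elim/last_ind: l1 => [|l1 z _]; first exact: sz_filter.
by rewrite -cats1 foldl_cat; apply: sz_filter.
Qed.

Lemma FP_ipow : FP ((fun a => ipow (V a) (S a) (P a) (b a)) : A -> seq_encType node_encType).
Proof using HV HS HP Hb.
rewrite /ipow; apply: FP_fst; have [F HF BF] := FP_size_bound (FP_square HV).
have [G HG BG] := FP_size_bound HS; have [K HK BK] := FP_size_bound HP.
have [L HL BL] := FP_size_bound HV.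
apply: (@FP_foldl A bool_encType (prod_encType (seq_encType node_encType) pairs_encType)
  (fun a p x => ((if x then img (V a) p.1 p.2 else p.1), rcomp (V a) p.2 p.2))); [by fpn t3|by []|by fpn t3|].
exists (fun n => F n + G n + K n + L n + 1); first by mpb.
move=> a l1 l2 _; set s := foldl _ _ _.
suff [H1 H2] : sz (s.1 : seq_encType node_encType) <= G (sz a) + L (sz a) /\
    sz (s.2 : pairs_encType) <= F (sz a) + K (sz a).
  by rewrite [s]surjective_pairing sz_pair; lia.
rewrite {}/s; elim/last_ind: l1 => [|l1 z [IH1 IH2]] /=.
  by split; [apply: leq_trans (BG a) (leq_addr _ _)|apply: leq_trans (BK a) (leq_addl _ _)].
rewrite -cats1 foldl_cat /=; split.
  case: z => //; apply: leq_trans (leq_addl _ _); apply: leq_trans (BL a); exact: sz_filter.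
apply: leq_trans (leq_addr _ _); apply: leq_trans (BF a); exact: sz_filter.
Qed.
End VerifierFP4.

Ltac t4 := first [t3 | match goal with
  | |- FP (fun x => eps_succ (@?k x) (@?m x) (@?d x)) => apply: (@FP_eps_succ _ k m d)
  | |- FP (fun x => obs_succ (@?k x) (@?m x) (@?a x) (@?d x)) => apply: (@FP_obs_succ _ k a m d)
  | |- FP (fun x => all_succ (@?k x) (@?m x) (@?d x)) => apply: (@FP_all_succ _ k m d)
  | |- FP (fun x => clo (@?k x) (@?m x)) => apply: (@FP_clo _ k m)
  | |- FP (fun x => ipow (@?k x) (@?m x) (@?d x) (@?b x)) => apply: (@FP_ipow _ b k m d)
  end; cbn beta].

Section VerifierFP5.

Variable A : encType.
Variables (C k : A -> nat) (r : A -> rinst) (w : A -> seq (bits * nat)) (f : A -> bool)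
  (V S : A -> seq node) (P Q : A -> seq (node * node)).
Hypotheses (HC : FP C) (Hk : FP k) (Hr : FP (r : A -> rinst_encType)) (Hf : FP f)
  (Hw : FP (w : A -> seq_encType (prod_encType (seq_encType bool_encType) nat_encType)))
  (HV : FP (V : A -> seq_encType node_encType)) (HS : FP (S : A -> seq_encType node_encType))
  (HP : FP (P : A -> pairs_encType)) (HQ : FP (Q : A -> pairs_encType)).

Lemma FP_rtick : FP ((fun a => rtick (C a) (r a) (V a)) : A -> pairs_encType).
Proof using HC Hr HV. by rewrite /rtick; fpn t4. Qed.
Lemma FP_reps : FP ((fun a => reps (C a) (r a) (V a)) : A -> pairs_encType).
Proof using HC Hr HV. by rewrite /reps; fpn t4. Qed.
Lemma FP_rall : FP ((fun a => rall (C a) (r a) (V a)) : A -> pairs_encType).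
Proof using HC Hr HV. by rewrite /rall; fpn t4. Qed.
Lemma FP_robs : FP ((fun a => robs (C a) (r a) (V a) (k a)) : A -> pairs_encType).
Proof using HC Hr HV Hk. by rewrite /robs; fpn t4. Qed.
Lemma FP_start : FP ((fun a => start (C a) (r a)) : A -> seq_encType node_encType).
Proof using HC Hr. by rewrite /start /init_node; fpn t4. Qed.
Lemma FP_good : FP (fun a => good (r a) (V a) (S a) (P a) (f a)).
Proof using Hr HV HS HP Hf. by rewrite /good; fpn t4. Qed.
Lemma FP_closedV : FP (fun a => closedV (C a) (r a) (V a)).
Proof using HC Hr HV. by rewrite /closedV; fpn t4. Qed.
End VerifierFP5.

Ltac t5 := first [t4 | match goal with
  | |- FP (fun x => rtick (@?k x) (@?m x) (@?d x)) => apply: (@FP_rtick _ k m d)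
  | |- FP (fun x => reps (@?k x) (@?m x) (@?d x)) => apply: (@FP_reps _ k m d)
  | |- FP (fun x => rall (@?k x) (@?m x) (@?d x)) => apply: (@FP_rall _ k m d)
  | |- FP (fun x => robs (@?k x) (@?m x) (@?d x) (@?a x)) => apply: (@FP_robs _ k a m d)
  | |- FP (fun x => start (@?k x) (@?m x)) => apply: (@FP_start _ k m)
  | |- FP (fun x => good (@?r x) (@?v x) (@?s x) (@?g x) (@?f x)) => apply: (@FP_good _ r f v s g)
  | |- FP (fun x => closedV (@?k x) (@?m x) (@?d x)) => apply: (@FP_closedV _ k m d)
  end; cbn beta].

Section VerifierFP6.

Variable A : encType.
Variables (C : A -> nat) (r : A -> rinst) (w : A -> seq (bits * nat)) (f : A -> bool)
  (V S : A -> seq node) (P Q : A -> seq (node * node)).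
Hypotheses (HC : FP C) (Hr : FP (r : A -> rinst_encType)) (Hf : FP f)
  (Hw : FP (w : A -> seq_encType (prod_encType (seq_encType bool_encType) nat_encType)))
  (HV : FP (V : A -> seq_encType node_encType)) (HS : FP (S : A -> seq_encType node_encType))
  (HP : FP (P : A -> pairs_encType)) (HQ : FP (Q : A -> pairs_encType)).

Lemma FP_run_sets : FP ((fun a => run_sets (C a) (r a) (V a) (P a) (Q a) (S a) (w a)) : A -> seq_encType node_encType).
Proof using HC Hr HV HP HQ HS Hw.
rewrite /run_sets; have [G HG BG] := FP_size_bound HS; have [L HL BL] := FP_size_bound HV.
apply: (@FP_foldl A (prod_encType (seq_encType bool_encType) nat_encType) (seq_encType node_encType)
  (fun a S p => img (V a) (ipow (V a) S (Q a) p.1) (rcomp (V a) (robs (C a) (r a) (V a) p.2) (P a)))) => //.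
  by fpn t5.
exists (fun n => G n + L n); first by mpb.
move=> a l1 l2 _; elim/last_ind: l1 => [|l1 z _] /=; first exact: leq_trans (BG a) (leq_addr _ _).
rewrite -cats1 foldl_cat /=; apply: leq_trans (leq_addl _ _); apply: leq_trans (BL a); exact: sz_filter.
Qed.
End VerifierFP6.

Lemma FP_verify (A : encType) (C : A -> nat) (r : A -> rinst) (w : A -> seq (bits * nat)) (f : A -> bool)
  (V : A -> seq node) : FP C -> FP (r : A -> rinst_encType) -> FP f ->
  FP (w : A -> seq_encType (prod_encType (seq_encType bool_encType) nat_encType)) ->
  FP (V : A -> seq_encType node_encType) ->
  FP (fun a => verify (C a) (r a) (V a) (w a) (f a)).
Proof.
move=> HC Hr Hf Hw HV; rewrite /verify /const_ok /=.
have HE : FP ((fun a => clo (V a) (reps (C a) (r a) (V a))) : A -> pairs_encType) by fpn t5.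
have HG : FP ((fun a => clo (V a) (rtick (C a) (r a) (V a) ++
      (if size (w a) == cv (C a) (r_nobs (r a)) then rall (C a) (r a) (V a) else reps (C a) (r a) (V a)))) : A -> pairs_encType) by fpn t5.
have HS : FP ((fun a => run_sets (C a) (r a) (V a) (clo (V a) (reps (C a) (r a) (V a)))
   (rcomp (V a) (rtick (C a) (r a) (V a)) (clo (V a) (reps (C a) (r a) (V a))))
   (img (V a) (start (C a) (r a)) (clo (V a) (reps (C a) (r a) (V a)))) (w a)) : A -> seq_encType node_encType).
  by apply: FP_run_sets => //; fpn t5.
have HI : FP ((fun a => init_node (r a)) : A -> node_encType) by rewrite /init_node; fpn t5.
by fpn t5.
Qed.

(** * Binary numbers and the raw form of instances *)

Definition value (b : bits) : nat := foldr (fun (x : bool) n => x + n.*2) 0 b.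

Lemma cvE C b : cv C b = minn (value b) C.
Proof.
rewrite /cv foldl_rev; elim: b => [|x b IH] /=; first by rewrite min0n.
by rewrite IH; case: x; lia.
Qed.

Lemma binary_digitsE n :
  binary_digits n = if n <= 1 then [:: odd n] else odd n :: binary_digits n./2.
Proof.
case: leqP => Hn; first by case: n Hn => [|[|]].
rewrite /binary_digits trunc_log2S //; set t := trunc_log 2 n./2.
rewrite -[iota 0 t.+2]/(0 :: iota (1 + 0) t.+1) iotaDl map_cons expn0 divn1 -map_comp.
by congr (_ :: _); apply: eq_map => i /=; rewrite add1n expnS divnMA divn2.
Qed.

Lemma value_digits n : value (binary_digits n) = n.
Proof.
have [m] := ubnP n; elim: m n => // m IH n Hm.
rewrite binary_digitsE; case: leqP => Hn; first by case: n Hn {Hm} => [|[|]].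
rewrite -[value _]/(odd n + (value (binary_digits n./2)).*2) IH ?odd_double_half //.
by lia.
Qed.

Lemma canonE b : canon b -> binary_digits (value b) = b.
Proof.
have H : forall b, head false (rev b) -> 0 < value b /\ binary_digits (value b) = b.
  move=> {b}; elim=> // x b IH; rewrite rev_cons; case: b IH => [|y b] IH.
    by case: x.
  rewrite [head _ _](_ : _ = head false (rev (y :: b))); last first.
    by rewrite !rev_cons; case: (rev b).
  move=> /IH [Hp E]; set v := value (y :: b) in Hp E *.
  have -> : value [:: x, y & b] = x + v.*2 by [].
  split; first by lia.
  rewrite binary_digitsE; case: leqP => [|_]; first by lia.
  rewrite oddD odd_double oddb addbF -[in RHS]E; congr (_ :: binary_digits _).
  by case: (x); rewrite ?add0n ?doubleK // add1n /= uphalf_double.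
case/orP=> [/H []|] //; by case: b => [|[] []].
Qed.

Lemma canon_digits n : canon (binary_digits n).
Proof.
rewrite /canon; have [m] := ubnP n; elim: m n => // m IH n Hm.
rewrite binary_digitsE; case: leqP => Hn /=; first by rewrite orbT.
have [] := orP (IH n./2 ltac:(lia)) => H.
  rewrite rev_cons; case: (rev _) H => //= x s -> //.
have Hs : n./2 = 1.
  move: H; rewrite binary_digitsE; case: leqP => // H1; first by move=> _; lia.
by rewrite Hs.
Qed.

Lemma vidxP n b : reflect (exists i : 'I_n, binary_digits i = b) (vidx n b).
Proof.
apply: (iffP andP) => [[Hc]|[i <-]].
  by rewrite cvE ltnNge => H; have Hi : value b < n by [lia]; exists (Ordinal Hi); apply: canonE.
by rewrite canon_digits cvE value_digits; have := ltn_ord i; lia.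
Qed.

Definition nat_codec : codec nat_encType.
Proof.
apply: (@Codec nat_encType enc_unary
  (fun s => if cdec (seq_codec unit_codec) s is Some p then Some (size p.1, p.2) else None)).
- move=> n r; have -> : enc_unary n = cenc (seq_codec unit_codec) (nseq n tt).
    by elim: n => //= n; rewrite /enc_unary /= => ->.
  by rewrite cencK size_nseq.
- move=> s n r; case E: (cdec _ s) => [[u r']|//] [<- <-]; rewrite (cdecK E).
  congr (_ ++ _); elim: u {E} => //= -[] u; rewrite /enc_unary /= => ->.
  by [].
- by fpc.
Defined.

Lemma enc_unaryE n : enc_unary n = cenc (seq_codec unit_codec) (nseq n tt).
Proof. by elim: n => //= n; rewrite /enc_unary /= => ->. Qed.

Definition raw_constr (n : nat) (c : constraint 'I_n) : rconstr :=
  (binary_digits c.1.1, (binary_digits (nat_of_cmp c.1.2), ((c.2 < 0)%R, binary_digits `|c.2|%N))).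

Definition raw_guard (n : nat) (g : guard 'I_n) : seq rconstr := map (@raw_constr n) g.

Definition raw_set (n : nat) (S : {set 'I_n}) : bits := [seq i \in S | i <- enum 'I_n].

Definition raw_edge (na nl nc : nat) (e : edge 'I_na 'I_nl 'I_nc) : redge :=
  (binary_digits (src e), (raw_guard (eguard e),
   (omap (fun a : 'I_na => binary_digits a) (eact e), (raw_set (resets e), binary_digits (tgt e))))).

Definition raw_of (i : instance) : rinst :=
  let A := automaton i in
  (nseq (nact i) tt, (nseq (nloc i) tt, (nseq (nclk i) tt, (binary_digits (init_loc A),
   (raw_set (private_locs A), (raw_set (final_locs A),
    ([seq raw_guard (loc_inv A l) | l <- enum 'I_(nloc i)],
     (map (@raw_edge _ _ _) (edges A), binary_digits (nobs i))))))))).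

Lemma enc_seq_map (T U : Type) (f : T -> U) (e : U -> seq bool) (g : T -> seq bool) s :
  (forall x, e (f x) = g x) -> enc_seq e (map f s) = enc_seq g s.
Proof. by move=> H; elim: s => //= x s ->; rewrite H. Qed.

Lemma cenc_pair (A B : encType) (c : codec A) (d : codec B) x y :
  cenc (pair_codec c d) (x, y) = cenc c x ++ cenc d y.
Proof. by []. Qed.

(** Factors the encoding of the statement through the codec: inverting [enc_instance] becomes
    decoding, followed by the inversion of [raw_of] in [validP]. *)
Lemma enc_raw i : enc_instance i = cenc rinst_codec (raw_of i).
Proof.
have Hc n (c : constraint 'I_n) : cenc rconstr_codec (raw_constr c) = enc_constraint c.
  by case: c => -[x c] d.
have Hg n (g : guard 'I_n) : cenc (seq_codec rconstr_codec) (raw_guard g) = enc_guard g.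
  by apply: enc_seq_map => c; apply: Hc.
case: i => na nl nc A N; rewrite /enc_instance /enc_TA /raw_of /rinst_codec.
rewrite [nact _]/= [nloc _]/= [nclk _]/= [automaton _]/= [nobs _]/= !cenc_pair !enc_unaryE -!catA.
congr (_ ++ (_ ++ (_ ++ (_ ++ (_ ++ (_ ++ (_ ++ (_ ++ _)))))))).
  rewrite (map_comp (@raw_guard nc) (loc_inv A)); apply: esym; apply: enc_seq_map.
  by move=> g; apply: Hg.
apply/esym; apply: enc_seq_map => -[s g a R t].
rewrite /raw_edge /redge_codec !cenc_pair Hg /enc_edge.
by congr (_ ++ (_ ++ (_ ++ (_ ++ _)))); case: a.
Qed.

Lemma map_exists (T U : Type) (f : T -> U) (p : pred U) :
  (forall u, p u -> exists x, f x = u) -> forall s, all p s -> exists l, map f l = s.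
Proof.
move=> H; elim=> [|u s IH] /=; first by exists [::].
by case/andP=> /H [x <-] /IH [l <-]; exists (x :: l).
Qed.

Lemma vconstrP n c : reflect (exists x : constraint 'I_n, raw_constr x = c) (vconstr n c).
Proof.
apply: (iffP and4P) => [[/vidxP [x E1] /vidxP [k E2] Hc Hs]|[[[x k] d] <-]] /=; last first.
  split; [by apply/vidxP; exists x| |exact: canon_digits|].
    by apply/vidxP; exists (inord (nat_of_cmp k)); rewrite inordK //; case: k.
  rewrite cvE value_digits; lia.
have [cc Hcc] : exists cc, nat_of_cmp cc = k.
  by have := ltn_ord k; case: (nat_of_ord k) => [|[|[|[|[|m]]]]] // _; [exists CmpLt|exists CmpLe|exists CmpEq|exists CmpGe|exists CmpGt].
exists (x, cc, if c.2.2.1 then (- Posz (value c.2.2.2))%R else Posz (value c.2.2.2)).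
case: c E1 E2 Hc Hs => [a [b [s d]]] /= E1 E2 Hc Hs.
rewrite /raw_constr /= E1 Hcc E2; congr (_, (_, (_, _))).
  by rewrite cvE in Hs; case: (s) Hs => /=; lia.
by rewrite -[RHS]canonE //; congr binary_digits; case: (s); lia.
Qed.

Lemma vguardP n g : reflect (exists x : guard 'I_n, raw_guard x = g) (all (fun c => vconstr n c) g).
Proof.
apply: (iffP idP) => [H|[x <-]].
  by apply: map_exists H => u /vconstrP.
by rewrite all_map; apply/allP => c _ /=; apply/vconstrP; exists c.
Qed.

Lemma raw_setP n b : size b = n -> exists S : {set 'I_n}, raw_set S = b.
Proof.
move=> E; exists [set i : 'I_n | nth false b i]; rewrite /raw_set.
apply: (@eq_from_nth _ false); rewrite size_map size_enum_ord // => i Hi.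
by rewrite (nth_map (Ordinal Hi)) ?size_enum_ord // inE nth_enum_ord.
Qed.

Lemma size_raw_set n (S : {set 'I_n}) : size (raw_set S) = n.
Proof. by rewrite size_map size_enum_ord. Qed.

Lemma vedgeP na nl nc e :
  reflect (exists x : edge 'I_na 'I_nl 'I_nc, raw_edge x = e) (vedge na nl nc e).
Proof.
case: e => s [g [a [R t]]]; rewrite /vedge /=.
apply: (iffP and5P) => [[/vidxP [xs <-] /vguardP [xg <-] Ha /eqP/raw_setP [xR <-] /vidxP [xt <-]]|[[xs xg xa xR xt] [<- <- <- <- <-]]] /=.
  have [xa Hxa] : exists xa : option 'I_na, omap (fun a : 'I_na => binary_digits a) xa = a.
    by case: a Ha => [a /vidxP [x <-]|_]; [exists (Some x)|exists None].
  by exists (Edge xs xg xa xR xt); rewrite /raw_edge /= Hxa.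
split; [by apply/vidxP; exists xs|by apply/vguardP; exists xg| |by rewrite size_raw_set|by apply/vidxP; exists xt].
by case: xa => //= xa; apply/vidxP; exists xa.
Qed.

Lemma validP r : reflect (exists i, raw_of i = r) (valid r).
Proof.
case: r => na [nl [nc [i0 [pr [fi [iv [ed nb]]]]]]].
rewrite /valid /r_nl /r_nc /r_na /r_init /r_priv /r_fin /r_inv /r_edges /r_nobs /=.
have En s : nseq (size s) tt = s by elim: s => //= -[] s ->.
apply: (iffP and5P).
  case=> /vidxP [xi <-] /eqP/raw_setP [xp <-] /eqP/raw_setP [xf <-] /eqP Hs /and3P[Hi He Hn].
  have [xe <-] : exists xe, map (@raw_edge (size na) (size nl) (size nc)) xe = ed.
    by apply: map_exists He => u /vedgeP.
  have [li Hl] : exists li, map (@raw_guard (size nc)) li = iv.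
    by apply: map_exists Hi => u /vguardP.
  exists (@MkInstance (size na) (size nl) (size nc)
    (MkTA xi xp xf [ffun l : 'I_(size nl) => nth [::] li l] xe) (value nb)).
  rewrite /raw_of /= !En canonE //; congr (_, (_, (_, (_, (_, (_, (_, _))))))).
  rewrite -Hl; apply: (@eq_from_nth _ [::]); rewrite size_map size_enum_ord.
    by rewrite -Hs -Hl !size_map.
  move=> i Hi'; rewrite (nth_map xi) ?size_enum_ord // ffunE nth_enum_ord //.
  by rewrite (nth_map [::]) // -(size_map (@raw_guard (size nc))) Hl Hs.
move=> [[ka kl kc A N] [<- <- <- <- <- <- <- <- <-]] /=; rewrite !size_nseq.
split; [by apply/vidxP; exists (init_loc A)|by rewrite size_raw_set|by rewrite size_raw_set|by rewrite size_map size_enum_ord|].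
apply/and3P; split; last exact: canon_digits.
  by rewrite all_map; apply/allP => l _ /=; apply/vguardP; exists (loc_inv A l).
by rewrite all_map; apply/allP => e _ /=; apply/vedgeP; exists e.
Qed.

(** * Relations on a finite list of nodes *)

Definition nodeq : eqType := (nat * (seq nat * bool))%type.

Lemma meqE (x y : nodeq) : meq x y = (x == y).
Proof. by case: x => a [b c]; case: y => a' [b' c']; rewrite /meq /= !xpair_eqE. Qed.

Lemma nmemE (x : nodeq) (l : seq nodeq) : nmem x l = (x \in l).
Proof. by elim: l => //= y l IH; rewrite /nmem /= meqE -/(nmem x l) IH inE. Qed.

Lemma pmemE (x y : nodeq) (R : seq (nodeq * nodeq)) : pmem x y R = ((x, y) \in R).
Proof.
by elim: R => //= -[a b] R IH; rewrite /pmem /= !meqE -/(pmem x y R) IH inE xpair_eqE.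
Qed.

Definition pairq : eqType := (nodeq * nodeq)%type.
Definition inrel (R : seq pairq) : rel nodeq := [rel x y | (x, y) \in R].

Definition conn (r : rel nodeq) (x y : nodeq) : Prop := exists2 p, path r x p & last x p = y.

Lemma conn_trans r x y z : conn r x y -> conn r y z -> conn r x z.
Proof. by move=> [p Hp <-] [q Hq <-]; exists (p ++ q); rewrite ?cat_path ?Hp ?last_cat. Qed.

Lemma conn1 (r : rel nodeq) x y : r x y -> conn r x y.
Proof. by move=> H; exists [:: y]; rewrite /= ?H. Qed.

Lemma conn0 r x : conn r x x. Proof. by exists [::]. Qed.

Section Graph.

Variable V : seq nodeq.
Implicit Types (R M : seq pairq) (S : seq nodeq) (x y z : nodeq).

Lemma mem_square x y : ((x, y) \in (square V : seq pairq)) = (x \in V) && (y \in V).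
Proof.
apply/flatten_mapP/andP => [[a Ha /mapP [b Hb [-> ->]]]|[Hx Hy]] //.
by exists x => //; apply/mapP; exists y.
Qed.

Definition onV R : Prop := forall x y, (x, y) \in R -> (x \in V) && (y \in V).

Lemma onV_filter (p : pred pairq) : onV [seq q <- square V | p q].
Proof. by move=> x y; rewrite mem_filter mem_square => /andP[]. Qed.

Lemma mem_rcomp R M x z : (x, z) \in (rcomp V R M : seq pairq) <->
  [/\ x \in V, z \in V & exists y, [/\ y \in V, (x, y) \in R & (y, z) \in M]].
Proof.
rewrite mem_filter mem_square; split.
  case/and3P=> /hasP [y Hy]; rewrite !pmemE => /andP[H1 H2] Hx Hz.
  by split => //; exists y.
move=> [-> -> [y [Hy H1 H2]]]; rewrite !andbT; apply/hasP; exists y => //.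
by rewrite !pmemE H1.
Qed.

Lemma mem_img S R y : y \in img V S R <-> y \in V /\ exists2 x, x \in S & (x, y) \in R.
Proof.
rewrite mem_filter; split.
  by case/andP=> /hasP [x Hx]; rewrite pmemE => H Hy; split => //; exists x.
move=> [-> [x Hx H]]; rewrite andbT; apply/hasP; exists x => //; by rewrite pmemE.
Qed.

(** After [k] squarings all paths of length at most [2 ^ k] are covered, by cutting a path at
    [2 ^ k]. A path can be made simple, so its length is at most [size V], which is below
    [2 ^ size V]. *)
Lemma mem_clo R x y : onV R ->
  (x, y) \in (clo V R : seq pairq) <-> [/\ x \in V, y \in V & conn (inrel R) x y].
Proof.
move=> HR.
pose cl k := iter k (fun M => rcomp V M M) (prefl V R).
have -> : clo V R = cl (size V).
  have E (s : seq nodeq) : foldl (fun M (_ : nodeq) => rcomp V M M) (prefl V R) s = cl (size s).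
    by elim/last_ind: s => // s z IH; rewrite size_rcons -cats1 foldl_cat IH.
  exact: E.
have sound k a b : (a, b) \in (cl k : seq pairq) -> [/\ a \in V, b \in V & conn (inrel R) a b].
  elim: k a b => [|k IH] a b.
    rewrite mem_filter mem_square meqE pmemE => /andP[H /andP[Ha Hb]]; split => //.
    by case/orP: H => [/eqP /= ->|H]; [apply: conn0|apply: conn1].
  case/mem_rcomp=> Ha Hb [c [_ /IH [_ _ H1] /IH [_ _ H2]]]; split => //.
  exact: conn_trans H1 H2.
split; first exact: sound.
move=> [Hx Hy [p Hp Ep]].
have complete k q a : a \in V -> path (inrel R) a q -> size q <= 2 ^ k -> last a q \in V /\ (a, last a q) \in (cl k : seq pairq).
  elim: k q a => [|k IH] q a Ha.
    case: q => [|b [|]] //=; rewrite ?andbT => H _.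
      by rewrite mem_filter mem_square meqE eqxx Ha.
    have /andP[_ Hb] := HR _ _ H.
    by rewrite mem_filter mem_square pmemE [_ \in R]H orbT Ha Hb.
  move=> Hq Hs; move: (Hq); rewrite -(cat_take_drop (2 ^ k) q) cat_path last_cat => /andP[H1 H2].
  have [|Hm M1] := IH _ _ Ha H1; first by rewrite size_take; case: ltnP.
  have [|Hb M2] := IH _ _ Hm H2; first by rewrite size_drop leq_subLR addnn -mul2n -expnS.
  by split => //; apply/mem_rcomp; split => //; exists (last a (take (2 ^ k) q)).
case/shortenP: Hp Ep => q Hq Uq _ <-.
have Sub : {subset x :: q <= V}.
  elim: q x Hq Hx {Uq} => [|b q IHq] a /= H Ha z; first by rewrite inE => /eqP ->.
  rewrite inE; case/orP=> [/eqP-> //|]; case/andP: H => H1 H2.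
  by apply: IHq => //; have /andP[] := HR _ _ H1.
have Sq : size q <= size V by apply: leq_trans (uniq_leq_size Uq Sub).
by have [] := complete (size V) q x Hx Hq (leq_trans Sq (ltnW (ltn_expl _ (isT : 1 < 2)))).
Qed.

Lemma img_rcomp S M : onV M -> img V S (rcomp V M M) = img V (img V S M) M.
Proof.
move=> HM; apply: eq_in_filter => z Hz; apply/hasP/hasP.
  move=> [x Hx]; rewrite pmemE => /mem_rcomp [Vx _ [y [Vy H1 H2]]].
  by exists y; [apply/mem_img; split => //; exists x|rewrite pmemE].
move=> [y /mem_img [Vy [x Hx H1]]]; rewrite pmemE => H2; exists x => //.
by rewrite pmemE; apply/mem_rcomp; split => //; [have /andP[] := HM _ _ H1|exists y].
Qed.

Lemma ipowE S M b : onV M -> ipow V S M b = iter (value b) (fun S => img V S M) S.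
Proof.
rewrite /ipow; elim: b S M => // x b IH S M HM.
rewrite [foldl _ _ _]/= IH; last exact: onV_filter.
rewrite /= -/(value b) iterD -addnn.
have E n T : iter n (fun S => img V S (rcomp V M M)) T = iter (n + n) (fun S => img V S M) T.
  by elim: n => // n IHn; rewrite iterS IHn img_rcomp // addnS addSn !iterS.
by rewrite E; case: x => //=; have /= <- := iterSr (value b + value b) (fun S => img V S M) S.
Qed.

(* The iterates are sublists of [V], hence at most [2 ^ size V] in number. *)
Lemma iter_img_bound M t (p : pred nodeq) :
  let f S := img V S M in let S := [seq y <- V | p y] in
  exists2 u, u < 2 ^ size V & iter t f S = iter u f S.
Proof.
move=> f S; have ex : exists u, (iter u f S : seq nodeq) == iter t f S by exists t.
have [u /eqP Hu Hmin] := ex_minnP ex; exists u => //.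
pose masks := [seq (mask (val m) V : seq nodeq) | m <- enum {: (size V).-tuple bool}].
have Hmask (q : pred nodeq) : [seq y <- V | q y] \in masks.
  have Hs : size [seq q y | y <- V] == size V by rewrite size_map.
  by apply/mapP; exists (Tuple Hs); rewrite ?mem_enum // filter_mask.
have Hsub : {subset [seq (iter i f S : seq nodeq) | i <- iota 0 u.+1] <= masks}.
  by move=> T /mapP [[|i] _ ->]; apply: Hmask.
have Huniq : uniq [seq (iter i f S : seq nodeq) | i <- iota 0 u.+1].
  rewrite map_inj_in_uniq ?iota_uniq //.
  (* If the iterates [i < j] agreed, [u] could be lowered by [j - i], against its minimality. *)
  have W i j : i < j -> j <= u -> iter i f S <> iter j f S.
    move=> ij ju E; have := Hmin (u - j + i).
    rewrite iterD E -iterD subnK // Hu eqxx => /(_ isT); lia.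
  move=> i j; rewrite !mem_iota !add0n !ltnS /= => iu ju E.
  by case: (ltngtP i j) => // H; [case: (W i j)|case: (W j i)].
have := uniq_leq_size Huniq Hsub.
have -> : size masks = 2 ^ size V by rewrite size_map -cardT card_tuple card_bool.
by rewrite size_map size_iota.
Qed.

End Graph.

Lemma bits_of_nat k u : u < 2 ^ k -> exists2 b : bits, size b = k & value b = u.
Proof.
elim: k u => [|k IH] u; first by case: u => // _; exists [::].
rewrite expnS => H; have [|b Hs Hv] := IH u./2; first by lia.
exists (odd u :: b); first by rewrite /= Hs.
by rewrite /= -/(value b) Hv odd_double_half.
Qed.

(** * Runs as labelled paths of truncated configurations *)

Section Paths.

Variables (C : nat) (r : rinst).

(* [None] is one time unit, [Some None] a silent edge, [Some (Some a)] an edge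
   with action [a]. *)
Definition label : Type := option (option nat).

Definition lstep (lb : label) (x : nodeq) : seq nodeq :=
  match lb with
  | None => tick_succ C r x
  | Some None => eps_succ C r x
  | Some (Some a) => obs_succ C r a x
  end.

Fixpoint lpath (ls : seq label) (x y : nodeq) : Prop :=
  if ls is lb :: ls' then exists2 z, z \in lstep lb x & lpath ls' z y else x = y.

(** The state is the delay word read so far, each action preceded by the time since the previous
    one, and the time elapsed since the last letter. *)
Definition adv (wd : seq (nat * nat) * nat) (lb : label) : seq (nat * nat) * nat :=
  match lb with
  | None => (wd.1, wd.2.+1)
  | Some None => wd
  | Some (Some a) => (rcons wd.1 (wd.2, a), 0)
  end.

Definition advs (ls : seq label) : seq (nat * nat) * nat := foldl adv ([::], 0) ls.

Lemma lpath_cat ls1 ls2 x y : lpath (ls1 ++ ls2) x y <-> exists2 z, lpath ls1 x z & lpath ls2 z y.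
Proof.
elim: ls1 x => [|lb ls IH] x /=; first by split=> [H|[z <-]] //; exists x.
split=> [[z Hz /IH [u H1 H2]]|[u [z Hz H1] H2]].
  by exists u => //; exists z.
by exists z => //; apply/IH; exists u.
Qed.

Lemma lpath_rcons ls lb x y : lpath (rcons ls lb) x y <-> exists2 z, lpath ls x z & y \in lstep lb z.
Proof.
rewrite -cats1 lpath_cat; split=> [[z H [u Hu <-]]|[z H Hy]]; exists z => //.
by exists y.
Qed.

Lemma advs_rcons ls lb : advs (rcons ls lb) = adv (advs ls) lb.
Proof. by rewrite /advs -cats1 foldl_cat. Qed.

Lemma all_succE x y : y \in (all_succ C r x : seq nodeq) <-> exists oa, y \in lstep (Some oa) x.
Proof.
rewrite /lstep; split.
  case/flatten_mapP=> e He Hy; case Ea: e.2.2.1 => [b|].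
    exists (Some (value b)); apply/flatten_mapP; exists e => //.
    by rewrite Ea cvE (minn_idPl (leqnSn _)) eqxx.
  by exists None; apply/flatten_mapP; exists e => //; rewrite Ea.
case=> -[a|] /flatten_mapP [e He Hy]; apply/flatten_mapP; exists e => //; move: Hy.
  by case: e.2.2.1 => // b; case: ifP.
by case: e.2.2.1.
Qed.

Variable V : seq nodeq.
Hypothesis HV : closedV C r V.

Lemma V_closed lb x y : x \in V -> y \in lstep lb x -> y \in V.
Proof.
move=> Hx Hy; have := allP HV _ Hx => /allP /(_ y); rewrite nmemE; apply.
rewrite mem_cat; case: lb Hy => [oa|] Hy; last by rewrite /= in Hy; rewrite Hy.
by apply/orP; right; apply/all_succE; exists oa.
Qed.

Lemma mem_rel (f : node -> seq node) x y :
  (x, y) \in ([seq p <- square V | nmem p.2 (f p.1)] : seq pairq) <-> [/\ x \in V, y \in V & y \in (f x : seq nodeq)].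
Proof.
rewrite mem_filter mem_square nmemE; split=> [/and3P[-> -> ->]|[-> -> ->]] //.
Qed.

Let E := clo V (reps C r V).
Let Tk := rcomp V (rtick C r V) E.
Let S0 := img V (start C r) E.
Hypothesis init_in : init_node r \in V.

Lemma E_onV : onV V (reps C r V). Proof. exact: onV_filter. Qed.

Lemma start_sub x : x \in (start C r : seq nodeq) -> x \in V.
Proof. by rewrite /start; case: ifP => // _; rewrite inE => /eqP ->. Qed.

Lemma E_eps x y z : (x, y) \in (E : seq pairq) -> z \in lstep (Some None) y -> (x, z) \in (E : seq pairq).
Proof.
move=> /(mem_clo _ _ E_onV) [Hx Hy Hc] Hz; have Hz' := V_closed Hy Hz.
apply/(mem_clo _ _ E_onV); split => //; apply: conn_trans Hc (conn1 _).
by apply/mem_rel.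
Qed.

Lemma E_refl x : x \in V -> (x, x) \in (E : seq pairq).
Proof. by move=> Hx; apply/(mem_clo _ _ E_onV); split => //; apply: conn0. Qed.

(* The nodes reached by the runs whose delay word is [w], [d] time units after
   its last letter. *)
Definition Q (w : seq (nat * nat)) (d : nat) : seq nodeq :=
  iter d (fun S => img V S Tk)
    (foldl (fun S p => img V (iter p.1 (fun S => img V S Tk) S) (rcomp V (robs C r V p.2) E)) S0 w).

Lemma Q_rcons w d a : Q (rcons w (d, a)) 0 = img V (Q w d) (rcomp V (robs C r V a) E).
Proof. by rewrite /Q /= -cats1 foldl_cat. Qed.

(** The relation applied last to form [Q w d] always ends with the closure [E], whether it is a time
    unit, a letter or the start. *)
Lemma Q_eps w d y z : y \in Q w d -> z \in lstep (Some None) y -> z \in Q w d.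
Proof.
have H S (R : seq pairq) : (forall a b c, (a, b) \in R -> c \in lstep (Some None) b -> (a, c) \in R) ->
    y \in img V S R -> z \in lstep (Some None) y -> z \in img V S R.
  move=> HR /mem_img [Hy [x Hx Hxy]] Hz; apply/mem_img; split; first exact: V_closed Hy Hz.
  by exists x => //; apply: HR Hxy Hz.
have HX (X : seq pairq) a b c : (a, b) \in (rcomp V X E : seq pairq) -> c \in lstep (Some None) b -> (a, c) \in (rcomp V X E : seq pairq).
  move=> /mem_rcomp [Ha Hb [u [Hu H1 H2]]] Hc; apply/mem_rcomp; split => //; first exact: V_closed Hb Hc.
  by exists u; split => //; apply: E_eps H2 Hc.
case: d => [|d]; last exact/H/HX.
case/lastP: w => [|w [d a]]; first exact/H/E_eps.
by rewrite Q_rcons; apply/H/HX.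
Qed.

Lemma Q_complete ls x y : x \in (start C r : seq nodeq) -> lpath ls x y ->
  y \in Q (advs ls).1 (advs ls).2 /\ y \in V.
Proof.
move=> Hx; elim/last_ind: ls y => [|ls lb IH] y.
  move=> <-; have Vx := start_sub Hx; split => //.
  by apply/mem_img; split => //; exists x => //; apply: E_refl.
move=> /lpath_rcons [z /IH [Hz Vz] Hy]; have Vy := V_closed Vz Hy; split => //.
rewrite advs_rcons; case: lb Hy => [[a|]|] Hy; rewrite [(adv _ _).1]/= [(adv _ _).2]/=.
- rewrite Q_rcons; apply/mem_img; split => //; exists z => //.
  by apply/mem_rcomp; split => //; exists y; split => //; [apply/mem_rel|apply: E_refl].
- exact: Q_eps Hz Hy.
- apply/mem_img; split => //; exists z => //.
  by apply/mem_rcomp; split => //; exists y; split => //; [apply/mem_rel|apply: E_refl].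
Qed.

Lemma E_path x y : (x, y) \in (E : seq pairq) ->
  exists2 ls, lpath ls x y & forall u, foldl adv u ls = u.
Proof.
move=> /(mem_clo _ _ E_onV) [_ _ [p Hp <-]].
elim: p x Hp => [|z p IH] x /=; first by exists [::].
case/andP=> /mem_rel [_ _ Hz] /IH [ls H1 H2].
by exists (Some None :: ls) => //; exists z.
Qed.

Lemma path_extend x ls lb z y y' u : lpath ls x z -> advs ls = u -> y' \in lstep lb z ->
  (y', y) \in (E : seq pairq) -> exists2 ls', lpath ls' x y & advs ls' = adv u lb.
Proof.
move=> H1 H2 H3 /E_path [ls2 H4 H5]; exists (rcons ls lb ++ ls2).
  by apply/lpath_cat; exists y' => //; apply/lpath_rcons; exists z.
by rewrite /advs foldl_cat -/(advs _) advs_rcons H2 H5.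
Qed.

Lemma Q_sound w d y : y \in Q w d ->
  exists x ls, [/\ x \in (start C r : seq nodeq), lpath ls x y & advs ls = (w, d)].
Proof.
have ext lb u S (R : seq pairq) y' : (forall z, z \in S ->
      exists x ls, [/\ x \in (start C r : seq nodeq), lpath ls x z & advs ls = u]) ->
    (forall a b, (a, b) \in R -> b \in lstep lb a) -> y' \in img V S (rcomp V R E) ->
    exists x ls, [/\ x \in (start C r : seq nodeq), lpath ls x y' & advs ls = adv u lb].
  move=> HS HR /mem_img [Vy [z Hz /mem_rcomp [_ _ [y1 [_ /HR H1 H2]]]]].
  have [x [ls [Hx Hl He]]] := HS z Hz; have [ls' H3 H4] := path_extend Hl He H1 H2.
  by exists x, ls'.
have tick w1 d1 y' : (forall z, z \in Q w1 d1 ->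
      exists x ls, [/\ x \in (start C r : seq nodeq), lpath ls x z & advs ls = (w1, d1)]) ->
    y' \in Q w1 d1.+1 -> exists x ls, [/\ x \in (start C r : seq nodeq), lpath ls x y' & advs ls = (w1, d1.+1)].
  move=> H; apply: (ext None (w1, d1)) H _ => a b.
  by move/(mem_rel (tick_succ C r)) => [].
elim/last_ind: w d y => [|w [d' a] IHw] d; elim: d => [|d IHd] y; try exact: tick.
- move=> /mem_img [_ [x Hx /E_path [ls H1 H2]]]; exists x, ls; split => //.
  exact: H2.
- rewrite Q_rcons; apply: (ext (Some (Some a)) (w, d')); first exact: IHw.
  by move=> u v /(mem_rel (obs_succ C r a)) [].
Qed.

End Paths.

Definition is_obs (lb : label) : bool := if lb is Some (Some _) then true else false.

Lemma size_adv u ls : size (foldl adv u ls).1 = size u.1 + count is_obs ls.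
Proof.
elim: ls u => [|[[a|]|] ls IH] u /=; rewrite ?addn0 // IH //=.
by rewrite size_rcons addSnnS.
Qed.

Lemma adv_prefix u ls : exists w, (foldl adv u ls).1 = u.1 ++ w.
Proof.
elim: ls u => [|lb ls IH] u /=; first by exists [::]; rewrite cats0.
have [w ->] := IH (adv u lb); case: lb => [[a|]|] /=; try by exists w.
by exists ((u.2, a) :: w); rewrite cat_rcons.
Qed.

Lemma adv_noobs u ls : ~~ has is_obs ls -> (foldl adv u ls).1 = u.1.
Proof.
by elim: ls u => // lb ls IH u /=; rewrite negb_or => /andP[H1 H2]; rewrite IH //; case: lb H1 => [[]|].
Qed.

(** Cuts the path just after its letter number [k], or at its start if [k = 0]; in both cases the
    time since the last letter is 0. *)
Lemma advs_split ls k : k <= size (advs ls).1 ->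
  exists ls1 ls2, ls = ls1 ++ ls2 /\ advs ls1 = (take k (advs ls).1, 0).
Proof.
elim/last_ind: ls k => [|ls lb IH] k Hk; first by exists [::], [::].
case: (leqP k (size (advs ls).1)) => H.
  have [ls1 [ls2 [El E]]] := IH k H; exists ls1, (rcons ls2 lb).
  rewrite E -rcons_cat -El; split => //; rewrite advs_rcons.
  by have [w /= ->] := adv_prefix (advs ls) [:: lb]; rewrite takel_cat.
have Hlb : (advs (rcons ls lb)).1 = rcons (advs ls).1 ((advs ls).2, if lb is Some (Some a) then a else 0) /\ (advs (rcons ls lb)).2 = 0.
  by move: Hk H; rewrite advs_rcons; case: lb => [[a|]|] //=; lia.
exists (rcons ls lb), [::]; rewrite cats0; split => //.
rewrite take_oversize; last by rewrite Hlb.1 size_rcons.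
by case: Hlb => H1 H2; rewrite [LHS]surjective_pairing H2.
Qed.

Section Acceptance.

Variables (C : nat) (r : rinst).

Definition finals (f : bool) (y : nodeq) : bool := nth false (r_fin r) y.1 && (y.2.2 == f).

Definition accepts (f : bool) (N : nat) (w : seq (nat * nat)) : Prop :=
  exists x ls y, [/\ x \in (start C r : seq nodeq), lpath C r ls x y, finals f y
                  & take N (advs ls).1 = w].

Variable V : seq nodeq.
Hypotheses (HV : closedV C r V) (init_in : init_node r \in V).

Definition gmat (b : bool) : seq pairq :=
  clo V (rtick C r V ++ (if b then rall C r V else reps C r V)).

Lemma acceptsP f N w : size w <= N ->
  accepts f N w <-> good r V (Q C r V w 0) (gmat (size w == N)) f.
Proof.
move=> Hw; set b := size w == N.
pose R : seq pairq := rtick C r V ++ (if b then rall C r V else reps C r V).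
have HR : onV V R.
  move=> x y; rewrite mem_cat => /orP[|]; first by apply: onV_filter.
  by case: (b); apply: onV_filter.
have Rstep x y lb : x \in V -> y \in lstep C r lb x -> ~~ is_obs lb || b -> (x, y) \in R.
  move=> Hx Hy Hlb; have Vy := V_closed HV Hx Hy; rewrite mem_cat.
  case: lb Hy Hlb => [oa|] Hy Hlb; last by apply/orP; left; apply/mem_rel.
  apply/orP; right; case: (b) Hlb.
    by move=> _; apply/mem_rel; split => //; apply/all_succE; exists oa.
  by case: oa Hy => // Hy _; apply/mem_rel.
have stepR x y : (x, y) \in R -> exists2 lb, y \in lstep C r lb x & ~~ is_obs lb || b.
  rewrite mem_cat => /orP[/mem_rel [_ _ H]|]; first by exists None.
  case: (b) => /mem_rel [_ _ H]; last by exists (Some None).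
  by have /all_succE [oa Hoa] := H; exists (Some oa) => //; rewrite orbT.
split.
- move=> [x [ls [y [Hx Hl Hy Ht]]]].
  have Hk : size w <= size (advs ls).1 by rewrite -Ht size_take_min geq_minr.
  have [ls1 [ls2 [El E1]]] := advs_split Hk.
  have Ew : take (size w) (advs ls).1 = w.
    by rewrite -{2}Ht -{1}Ht size_take_min take_min take_size.
  rewrite Ew in E1; move: Hl; rewrite El => /lpath_cat [z H1 H2].
  have [Qz Vz] := Q_complete HV init_in Hx H1; rewrite E1 /= in Qz.
  have Hobs : all (fun lb => ~~ is_obs lb || b) ls2.
    rewrite /b; case: eqP => HwN; first by apply/allP => lb _; rewrite orbT.
    have Hs : size (advs ls).1 = size w.
      by rewrite -Ht size_take; case: ltnP => // HN; move: HwN; rewrite -Ht size_take HN.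
    have Hc : count is_obs ls2 = 0.
      move: Hs; rewrite El /advs foldl_cat -/(advs ls1) E1 size_adv /=; lia.
    have : ~~ has is_obs ls2 by rewrite has_count Hc.
    by rewrite -all_predC; apply: sub_all => lb /= ->.
  have [Vy Hc] : y \in V /\ conn (inrel R) z y.
    elim: ls2 z Vz H2 Hobs {El H1 Qz} => [|lb ls2 IH] z Vz /=.
      by move=> <-; split => //; apply: conn0.
    move=> [u Hu /IH H3] /andP[H4 H5]; have [|//|Vy H6] := H3; first by apply (V_closed HV Vz Hu).
    by split => //; apply: conn_trans (conn1 _) H6; apply: Rstep Hu H4.
  apply/hasP; exists z => //; apply/hasP; exists y => //; rewrite pmemE.
  by rewrite -[_ && (_ == f)]/(finals f y) Hy andbT; apply/mem_clo.
- case/hasP=> z Qz /hasP [y Vy]; rewrite pmemE => /andP[/(mem_clo _ _ HR) [Vz _ [p Hp Ep]] Hy].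
  have [x [ls1 [Hx H1 E1]]] := Q_sound Qz.
  have [ls2 H2 Hobs] : exists2 ls2, lpath C r ls2 z y & all (fun lb => ~~ is_obs lb || b) ls2.
    elim: p z Hp Ep {Qz Vz H1} => [|u p IH] z /=; first by move=> _ <-; exists [::].
    case/andP=> /stepR [lb H3 H4] H5 H6; have [ls2 H7 H8] := IH _ H5 H6.
    by exists (lb :: ls2); [exists u|rewrite /= H4].
  exists x, (ls1 ++ ls2), y; split => //; first by apply/lpath_cat; exists z.
  rewrite /advs foldl_cat -/(advs ls1) E1; move: Hobs; rewrite /b; case: eqP => HwN Hobs.
    have [w' ->] := adv_prefix (w, 0) ls2; rewrite /= -HwN take_size_cat //.
  rewrite adv_noobs /= ?take_oversize //.
  by rewrite -all_predC; apply: sub_all Hobs => lb /=; rewrite orbF.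
Qed.

Lemma run_setsE w (S : seq nodeq) : run_sets C r V (clo V (reps C r V)) (rcomp V (rtick C r V) (clo V (reps C r V))) S w =
  foldl (fun S p => img V (iter p.1 (fun S => img V S (rcomp V (rtick C r V) (clo V (reps C r V)))) S)
     (rcomp V (robs C r V p.2) (clo V (reps C r V)))) S [seq (value p.1, p.2) | p <- w].
Proof.
by rewrite /run_sets; elim: w S => //= p w IH S; rewrite IH ipowE //; apply: onV_filter.
Qed.

(** Each delay is replaced by one below [2 ^ size V] that leads to the same set, written with
    [size V] bits. [iter_img_bound] applies again after each letter, because the image reached is
    itself a filter of [V]. *)
Lemma run_sets_exists w (S : seq nodeq) (q : pred nodeq) : S = [seq y <- V | q y] ->
  exists w' : seq (bits * nat), [/\ [seq p.2 | p <- w'] = [seq p.2 | p <- w],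
    all (fun p => size p.1 == size V) w' &
    run_sets C r V (clo V (reps C r V)) (rcomp V (rtick C r V) (clo V (reps C r V))) S w' =
    foldl (fun S p => img V (iter p.1 (fun S => img V S (rcomp V (rtick C r V) (clo V (reps C r V)))) S)
     (rcomp V (robs C r V p.2) (clo V (reps C r V)))) S w].
Proof.
set Tk := rcomp V (rtick C r V) _.
elim: w S q => [|[t a] w IH] S q ES; first by exists [::].
have [u Hu Eu] := iter_img_bound V (Tk : seq pairq) t q.
have [b Hb Vb] := bits_of_nat Hu.
have [w' [H1 H2 H3]] := IH _ _ (erefl (img V (iter t (fun S => img V S Tk) S) (rcomp V (robs C r V a) (clo V (reps C r V))))).
exists ((b, a) :: w'); split; [by rewrite /= H1|by rewrite /= Hb eqxx|].
rewrite /= -H3 /run_sets /= ipowE; last exact: onV_filter.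
by rewrite Vb ES Eu.
Qed.

End Acceptance.

Theorem verify_sound C r V w f : verify C r V w f -> exists wd : seq (nat * nat),
  [/\ all (const_ok C) (r_inv r), all (fun e => const_ok C e.2.1) (r_edges r), value (r_nobs r) < C,
      accepts C r f (value (r_nobs r)) wd & ~ accepts C r (~~ f) (value (r_nobs r)) wd].
Proof.
rewrite /verify => /and5P[H1 H2 H3 H4 /and3P[H5 H6 /andP[H7 H8]]].
have EN : cv C (r_nobs r) = value (r_nobs r) by rewrite cvE in H3 *; lia.
rewrite nmemE in H5; rewrite EN in H3 H4 H7 H8.
pose wd := [seq (value p.1, p.2) | p <- w].
have Es : size w = size wd by rewrite size_map.
have EQ : run_sets C r V (clo V (reps C r V)) (rcomp V (rtick C r V) (clo V (reps C r V)))
    (img V (start C r) (clo V (reps C r V))) w = Q C r V wd 0 by rewrite run_setsE.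
rewrite EQ Es in H4 H7 H8; exists wd; split => //.
  by apply/(acceptsP H6 H5).
by move/(acceptsP H6 H5 (~~ f) H4); apply/negP.
Qed.

Theorem verify_complete C r V wd f :
  all (const_ok C) (r_inv r) -> all (fun e => const_ok C e.2.1) (r_edges r) -> value (r_nobs r) < C ->
  init_node r \in (V : seq nodeq) -> closedV C r V -> size wd <= value (r_nobs r) ->
  accepts C r f (value (r_nobs r)) wd -> ~ accepts C r (~~ f) (value (r_nobs r)) wd ->
  exists w : seq (bits * nat), [/\ [seq p.2 | p <- w] = [seq p.2 | p <- wd],
    all (fun p => size p.1 == size V) w & verify C r V w f].
Proof.
move=> H1 H2 H3 H5 H6 H4 /(acceptsP H6 H5 f H4) H7 H8.
have {}H8 : ~~ good r V (Q C r V wd 0) (gmat C r V (size wd == value (r_nobs r))) (~~ f).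
  by apply/negP => H; apply: H8; apply/(acceptsP H6 H5).
have EN : cv C (r_nobs r) = value (r_nobs r) by rewrite cvE; lia.
have [w [W1 W2 W3]] := run_sets_exists C r (V := V) wd (erefl (img V (start C r) (clo V (reps C r V)))).
have Es : size w = size wd by rewrite -(size_map snd) W1 size_map.
exists w; split => //; rewrite /verify H1 H2 EN H3 Es H4 nmemE H5 H6 /= W3.
by apply/andP; split.
Qed.

Lemma cv_digits n m : m < n -> cv n (binary_digits m) = m.
Proof. by move=> H; rewrite cvE value_digits; lia. Qed.

Lemma nth_raw_set n (S : {set 'I_n}) (i : 'I_n) : nth false (raw_set S) i = (i \in S).
Proof. by rewrite (nth_map i) ?size_enum_ord // nth_ord_enum. Qed.

(** * Runs of the automaton and labelled paths *)

Fixpoint delays (Act : Type) (t : nat) (w : seq (Act * nat)) : seq (nat * Act) :=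
  if w is (a, u) :: w' then (u - t, a) :: delays u w' else [::].

Lemma addn_subn_subn k t d : k <= t -> t + d - (t - k) = k + d.
Proof. lia. Qed.

Section Runs.

Variables (na nl nc : nat) (A : TA 'I_na 'I_nl 'I_nc) (N C : nat).
Let r := raw_of (MkInstance A N).
Hypotheses (inv_ok : all (const_ok C) (r_inv r)) (edges_ok : all (fun e => const_ok C e.2.1) (r_edges r)).

Definition trunc (mu : valuation 'I_nc) : seq nat := [seq minn (mu x) C | x <- enum 'I_nc].

Definition node_of (l : 'I_nl) (mu : valuation 'I_nc) (f : bool) : nodeq := (val l, (trunc mu, f)).

Lemma size_trunc mu : size (trunc mu) = nc.
Proof. by rewrite size_map size_enum_ord. Qed.

Lemma nth_trunc mu (x : 'I_nc) : nth 0 (trunc mu) x = minn (mu x) C.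
Proof. by rewrite (nth_map x) ?size_enum_ord // nth_ord_enum. Qed.

(** The absolute value of the constant is strictly below [C], so a clock value truncated to [C]
    still compares with it as the true value does. *)
Lemma satcE mu (c : constraint 'I_nc) : cv C (raw_constr c).2.2.2 < C ->
  satc C (trunc mu) (raw_constr c) = (let: (x, k, d) := c in cmp_sem k (Posz (mu x)) d).
Proof.
case: c => -[x k] d; rewrite /satc /raw_constr /= size_trunc.
have -> : cv 5 (binary_digits (nat_of_cmp k)) = nat_of_cmp k by rewrite cv_digits //; case: (k).
rewrite (cv_digits (ltn_ord x)) cvE value_digits nth_trunc => H.
rewrite (minn_idPl (_ : `|d|%N <= C)); last by lia.
have {H} H : `|d|%N < C by lia.
move: (mu x) => m; have Hd : (d < 0)%R \/ (d < 0)%R = false by case: (d < 0)%R; [left|right].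
by case: k; rewrite /cmp_sem /cmpn /=; case: Hd => Hd; rewrite Hd; apply/idP/idP; lia.
Qed.

Lemma all_satc mu (g : guard 'I_nc) : const_ok C (raw_guard g) ->
  all (fun c => satc C (trunc mu) c) (raw_guard g) = sat mu g.
Proof.
elim: g => //= c g IH /andP[H1 /IH H2]; rewrite /= H2; congr (_ && _).
exact: satcE.
Qed.

Lemma invatE (l : 'I_nl) mu : invat C r l (trunc mu) = in_inv A (l, mu).
Proof.
rewrite /invat /in_inv /r /raw_of /r_inv /=.
rewrite (nth_map l) ?size_enum_ord // nth_ord_enum; apply: all_satc.
by apply: (allP inv_ok); apply/mapP; exists l; rewrite ?mem_enum.
Qed.

Lemma tickvE mu : tickv C (trunc mu) = trunc (elapse mu 1).
Proof. by rewrite /tickv /trunc -map_comp; apply: eq_map => x /=; rewrite ffunE; move: (mu x) => m; lia. Qed.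

Lemma resetvE (R : {set 'I_nc}) mu : resetv (raw_set R) (trunc mu) = trunc (reset R mu).
Proof.
rewrite /resetv size_trunc -val_enum_ord -map_comp; apply: eq_map => x /=.
by rewrite nth_raw_set nth_trunc ffunE; case: ifP => // _; rewrite min0n.
Qed.

Lemma finE (l : 'I_nl) : nth false (r_fin r) l = (l \in final_locs A).
Proof. exact: nth_raw_set. Qed.

Lemma privE (l : 'I_nl) : nth false (r_priv r) l = (l \in private_locs A).
Proof. exact: nth_raw_set. Qed.

Lemma nlE : r_nl r = nl. Proof. exact: size_nseq. Qed.

Lemma init_nodeE : init_node r = node_of (init_loc A) [ffun=> 0] (init_loc A \in private_locs A).
Proof.
rewrite /init_node nlE /r_init /= cv_digits // privE /node_of; congr (_, (_, _)).
rewrite /r_nc /= size_nseq /trunc (eq_map (g := fun=> 0)).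
  by rewrite -[in LHS](size_enum_ord nc); elim: (enum _) => //= x s ->.
by move=> x; rewrite ffunE min0n.
Qed.

Lemma startE x : x \in (start C r : seq nodeq) <->
  in_inv A (init_config A) /\ x = node_of (init_loc A) [ffun=> 0] (init_loc A \in private_locs A).
Proof.
rewrite /start init_nodeE /= invatE -/(init_config A); case: ifP => _; last by split=> // -[].
by rewrite inE; split=> [/eqP|[_ ->]].
Qed.

Lemma tickE l mu f y : y \in lstep C r None (node_of l mu f) <->
  [/\ l \notin final_locs A, in_inv A (l, elapse mu 1) & y = node_of l (elapse mu 1) f].
Proof.
rewrite /lstep /tick_succ /= finE tickvE invatE; case: ifP => [/andP[H1 H2]|H].
  by rewrite inE; split=> [/eqP ->|[_ _ ->]].
by split=> // -[H1 H2]; rewrite H1 H2 in H.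
Qed.

Lemma edge_succE l mu f y (e : edge 'I_na 'I_nl 'I_nc) : e \in edges A ->
  y \in (edge_succ C r (node_of l mu f) (raw_edge e) : seq nodeq) <->
  [/\ src e = l, l \notin final_locs A, sat mu (eguard e),
      in_inv A (tgt e, reset (resets e) mu)
    & y = node_of (tgt e) (reset (resets e) mu) (f || (tgt e \in private_locs A))].
Proof.
move=> He; rewrite /edge_succ nlE /= !cv_digits // finE resetvE privE invatE.
have Hg : const_ok C (raw_guard (eguard e)).
  by have := allP edges_ok (raw_edge e); apply; apply: map_f.
rewrite all_satc //; case: ifP => [/and4P[/eqP/val_inj H1 H2 H3 H4]|H].
  by rewrite inE; split=> [/eqP ->|[_ _ _ _ ->]].
by split=> // -[H1 H2 H3 H4]; rewrite H1 H2 H3 H4 eqxx in H.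
Qed.

Lemma edgeE oa l mu f y : y \in lstep C r (Some oa) (node_of l mu f) <->
  exists e : edge 'I_na 'I_nl 'I_nc, e \in edges A /\ omap (@nat_of_ord na) (eact e) = oa /\
  [/\ src e = l, l \notin final_locs A, sat mu (eguard e),
      in_inv A (tgt e, reset (resets e) mu)
    & y = node_of (tgt e) (reset (resets e) mu) (f || (tgt e \in private_locs A))].
Proof.
have -> : y \in lstep C r (Some oa) (node_of l mu f) <->
    exists2 e, e \in edges A & omap (@nat_of_ord na) (eact e) = oa /\
       y \in (edge_succ C r (node_of l mu f) (raw_edge e) : seq nodeq).
  rewrite /lstep; case: oa => [a|].
    split.
      case/flatten_mapP=> _ /mapP [e He ->]; rewrite [(raw_edge e).2.2.1]/=.
      case E: (eact e) => [b|] //; rewrite [omap _ _]/=; case: ifP => // /eqP Hb Hy.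
      exists e => //; rewrite E; split => //=; congr Some.
      by move: Hb; rewrite cvE value_digits; lia.
    move=> [e He [Ea Hy]]; apply/flatten_mapP; exists (raw_edge e); first exact: map_f.
    case E: (eact e) Ea => [b|] //= [Eb]; rewrite E /=.
    by rewrite Eb cv_digits // eqxx.
  split.
    case/flatten_mapP=> _ /mapP [e He ->]; rewrite [(raw_edge e).2.2.1]/=.
    by case E: (eact e) => [b|] //= Hy; exists e; rewrite // E.
  move=> [e He [Ea Hy]]; apply/flatten_mapP; exists (raw_edge e); first exact: map_f.
  by case E: (eact e) Ea => [b|] //= _; rewrite E.
split=> [[e He [Ea /(edge_succE _ _ _ _ He) Hy]]|[e [He [Ea /(edge_succE _ _ _ _ He) Hy]]]]; exists e => //.
Qed.

Lemma elapse0 (mu : valuation 'I_nc) : elapse mu 0 = mu.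
Proof. by apply/ffunP => x; rewrite ffunE addn0. Qed.

Lemma elapseD (mu : valuation 'I_nc) d d' : elapse (elapse mu d) d' = elapse mu (d + d').
Proof. by apply/ffunP => x; rewrite !ffunE addnA. Qed.

Lemma lpath_ticks d l mu f : l \notin final_locs A ->
  (forall d', d' <= d -> in_inv A (l, elapse mu d')) ->
  lpath C r (nseq d None) (node_of l mu f) (node_of l (elapse mu d) f).
Proof.
move=> Hl; elim: d mu => [|d IH] mu H /=; first by rewrite elapse0.
exists (node_of l (elapse mu 1) f); first by apply/tickE; split => //; apply: H.
have -> : elapse mu d.+1 = elapse (elapse mu 1) d by rewrite elapseD.
by apply: IH => d' Hd; rewrite elapseD; apply: H.
Qed.

Lemma adv_ticks w k d : foldl adv (w, k) (nseq d None) = (w, k + d).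
Proof. by elim: d k => [|d IH] k /=; rewrite ?addn0 // IH addSnnS. Qed.

Definition nat_delays t (w : timed_word 'I_na) : seq (nat * nat) :=
  [seq (p.1, val p.2) | p <- delays t w].

Lemma invP l (mu : valuation 'I_nc) d :
  reflect (forall d', d' <= d -> in_inv A (l, elapse mu d')) [forall d' : 'I_d.+1, in_inv A (l, elapse mu d')].
Proof.
apply: (iffP forallP) => [H d' Hd|H d']; last by apply: H; rewrite -ltnS.
by have := H (Ordinal (Hd : d' < d.+1)).
Qed.

(** [t] is the current date and [d] the time since the last letter, so [t - d] is the date from
    which [delays] measures the next letter. *)
Lemma path_of_run l mu f (s : seq (timed_step 'I_na 'I_nl 'I_nc)) :
  feasible A (l, mu) s -> last l (tail_locs s) \in final_locs A ->
  all (fun l => l \notin final_locs A) (belast l (tail_locs s)) ->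
  exists ls y, [/\ lpath C r ls (node_of l mu f) y,
     finals r (f || has (fun l => l \in private_locs A) (tail_locs s)) y
   & forall w d t, d <= t -> (foldl adv (w, d) ls).1 = w ++ nat_delays (t - d) (trace_from t s)].
Proof.
elim: s l mu f => [|[d e] s IH] l mu f /=.
  move=> _ Hl _; exists [::], (node_of l mu f); split => //.
    by rewrite /finals finE Hl orbF /= eqxx.
  by move=> w d t _; rewrite cats0.
case/andP=> /and5P[/= He /eqP Es /invP Hinv Hg Hi] Hf Hlast /andP[Hl Hb].
have [ls [y [H1 H2 H3]]] := IH _ _ (f || (tgt e \in private_locs A)) Hf Hlast Hb.
exists (nseq d None ++ Some (omap (@nat_of_ord na) (eact e)) :: ls), y; split.
- apply/lpath_cat; exists (node_of l (elapse mu d) f); first exact: lpath_ticks.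
  exists (node_of (tgt e) (reset (resets e) (elapse mu d)) (f || (tgt e \in private_locs A))) => //.
  by apply/edgeE; exists e.
- by move: H2; rewrite orbA.
- move=> w k t Hk; rewrite foldl_cat adv_ticks /=; case: (eact e) => [a|] /=.
    rewrite -(addn_subn_subn d Hk).
    by rewrite (H3 _ 0 (t + d)) // subn0 cat_rcons.
  by rewrite (H3 _ _ (t + d)) ?leq_add2r // subnDr.
Qed.

(** Time units are merged into the delay of the next edge. Such an edge exists: time passes only in
    a location that is not final, while the path ends in a final one. *)
Lemma run_of_path ls l mu f g y : in_inv A (l, mu) ->
  lpath C r ls (node_of l mu f) y -> finals r g y ->
  exists s : seq (timed_step 'I_na 'I_nl 'I_nc), [/\ feasible A (l, mu) s,
    last l (tail_locs s) \in final_locs A,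
    all (fun l => l \notin final_locs A) (belast l (tail_locs s)),
    f || has (fun l => l \in private_locs A) (tail_locs s) = g
   & forall w d t, d <= t -> (foldl adv (w, d) ls).1 = w ++ nat_delays (t - d) (trace_from t s)].
Proof.
elim: ls l mu f => [|[oa|] ls IH] l mu f Hinv.
- move=> <- /andP[]; rewrite /= finE => Hl /eqP <-; exists [::]; split => //.
    by rewrite orbF.
  by move=> w d t _; rewrite cats0.
- move=> [z /edgeE [e [He [Ea [Es Hl Hg Hi ->]]]] Hp] Hy.
  have [s [H1 H2 H3 H4 H5]] := IH _ _ _ Hi Hp Hy.
  exists ((0, e) :: s); split => //=.
  + apply/andP; split; last by rewrite /succ_config /= elapse0.
    apply/and5P; split => //; first by apply/eqP.
    * by apply/invP => -[|//] _; rewrite elapse0.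
    * by rewrite elapse0.
    * by rewrite /succ_config /= elapse0.
  + by rewrite Hl.
  + by rewrite -H4 orbA.
  + move=> w d t Hd; rewrite -Ea; case: (eact e) => [a|] /=; rewrite addn0; last exact: H5.
    by rewrite (H5 _ 0 t) // subn0 cat_rcons /nat_delays /= subKn.
- move=> [z /tickE [Hl Hi ->] Hp] Hy.
  have [s [H1 H2 H3 H4 H5]] := IH _ _ _ Hi Hp Hy.
  case: s H1 H2 H3 H4 H5 => [|[d e] s]; first by move=> _ /= H; rewrite H in Hl.
  move=> /= /andP[/and5P[/= He Es /invP Hinv' Hg Hi'] Hf] H2 H3 H4 H5.
  have Ed : elapse (elapse mu 1) d = elapse mu d.+1 by rewrite elapseD.
  exists ((d.+1, e) :: s); split => //=.
  + rewrite /succ_config /= in Hf *; rewrite -Ed Hf andbT.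
    apply/and5P; split => //=.
      apply/invP => -[|d'] Hd'; first by rewrite elapse0.
      have -> : elapse mu d'.+1 = elapse (elapse mu 1) d' by rewrite elapseD.
      exact: Hinv'.
    by rewrite -Ed.
    by move: Hi'; rewrite /succ_config /= Ed.
  + move=> w k t Hk; rewrite (H5 _ _ t.+1) //= subSS.
    by rewrite addSnnS.
Qed.

Theorem accepts_runs f M w : accepts C r f M w <->
  exists s, [/\ is_run A s, is_private A s = f & take M (nat_delays 0 (trace s)) = w].
Proof.
split.
- move=> [x [ls [y [/startE [Hi ->] Hl Hy Ht]]]].
  have [s [H1 H2 H3 H4 H5]] := run_of_path Hi Hl Hy.
  exists s; split => //; first by rewrite /is_run Hi H1 H2 H3.
  by rewrite -Ht /advs (H5 [::] 0 0).
- move=> [s [/and4P[Hi Hf Hl Hb] Hp Ht]].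
  have [ls [y [H1 H2 H3]]] := path_of_run (init_loc A \in private_locs A) Hf Hl Hb.
  exists (node_of (init_loc A) [ffun=> 0] (init_loc A \in private_locs A)), ls, y; split => //.
  + by apply/startE.
  + by move: H2; rewrite -Hp.
  + by rewrite -Ht /advs (H3 [::] 0 0).
Qed.

End Runs.

Section OpacityAcceptance.

Variables (na nl nc : nat) (A : TA 'I_na 'I_nl 'I_nc) (N C : nat).
Let r := raw_of (MkInstance A N).
Hypotheses (inv_ok : all (const_ok C) (r_inv r)) (edges_ok : all (fun e => const_ok C e.2.1) (r_edges r)).

Lemma trace_sorted t (s : seq (timed_step 'I_na 'I_nl 'I_nc)) : path leq t (map snd (trace_from t s)).
Proof.
elim: s t => //= -[d e] s IH t; case: (eact e) => [a|] /=; first by rewrite leq_addr IH.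
by have := IH (t + d); case: (trace_from _ _) => //= -[a u] v /= /andP[H ->]; rewrite (leq_trans (leq_addr d t) H).
Qed.

Lemma nat_delays_take t M (v : timed_word 'I_na) : nat_delays t (take M v) = take M (nat_delays t v).
Proof. by rewrite /nat_delays -map_take; congr map; elim: v t M => [|[a u] v IH] t [|M] //=; rewrite IH. Qed.

(** Dates are nondecreasing, so no subtraction is truncated and the delays determine the dates. This
    carries inclusions of delay words back to timed words. *)
Lemma nat_delays_inj t (v v' : timed_word 'I_na) : path leq t (map snd v) -> path leq t (map snd v') ->
  nat_delays t v = nat_delays t v' -> v = v'.
Proof.
elim: v t v' => [|[a u] v IH] t [|[a' u'] v'] //= /andP[Hu Hv] /andP[Hu' Hv'] [E1 /val_inj E2 E3].
have Eu : u = u' by lia.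
by subst u'; rewrite E2 (IH _ _ Hv Hv' E3).
Qed.

Lemma first_obs_accepts f w : first_obs N (fun v => exists s, [/\ is_run A s, is_private A s = f & v = trace s]) w ->
  accepts C r f N (nat_delays 0 w) /\ path leq 0 (map snd w).
Proof.
move=> [v [s [H1 H2 ->]] ->]; split; last by rewrite map_take; apply: take_path; apply: trace_sorted.
by apply/(accepts_runs inv_ok edges_ok); exists s; rewrite nat_delays_take.
Qed.

Lemma accepts_first_obs f w : accepts C r f N w ->
  exists2 v, w = nat_delays 0 v & first_obs N (fun v => exists s, [/\ is_run A s, is_private A s = f & v = trace s]) v.
Proof.
move/(accepts_runs inv_ok edges_ok)=> [s [H1 H2 <-]]; exists (take N (trace s)).
  by rewrite nat_delays_take.
by exists (trace s) => //; exists s.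
Qed.

Lemma first_obs_incl f g :
  (forall w, first_obs N (fun v => exists s, [/\ is_run A s, is_private A s = f & v = trace s]) w ->
             first_obs N (fun v => exists s, [/\ is_run A s, is_private A s = g & v = trace s]) w) <->
  (forall w, accepts C r f N w -> accepts C r g N w).
Proof.
split=> H w.
  by case/accepts_first_obs=> v -> /H /first_obs_accepts [].
move=> Hw; have [/H /accepts_first_obs [v E Hv] S] := first_obs_accepts Hw.
by have [_ S'] := first_obs_accepts Hv; rewrite (nat_delays_inj S S' E).
Qed.

Lemma first_obs_ext (T T' : timed_word 'I_na -> Prop) w : (forall v, T v <-> T' v) ->
  first_obs N T w <-> first_obs N T' w.
Proof. by move=> H; split=> -[v /H Hv ->]; exists v. Qed.

Lemma PrivTrE v : PrivTr A v <-> exists s, [/\ is_run A s, is_private A s = true & v = trace s].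
Proof. by split=> -[s [H1 H2 H3]]; exists s. Qed.

Lemma PubTrE v : PubTr A v <-> exists s, [/\ is_run A s, is_private A s = false & v = trace s].
Proof. by split=> -[s [H1 H2 H3]]; exists s; split => //; [apply/negbTE|rewrite H2]. Qed.

Lemma weakly_opaqueE : weakly_opaque A N <-> forall w, accepts C r true N w -> accepts C r false N w.
Proof.
rewrite -first_obs_incl; split=> H w.
  by move/(first_obs_ext w PrivTrE)/H/(first_obs_ext w PubTrE).
by move/(first_obs_ext w PrivTrE)/H/(first_obs_ext w PubTrE).
Qed.

Lemma fully_opaqueE : fully_opaque A N <->
  forall f w, accepts C r f N w -> accepts C r (~~ f) N w.
Proof.
split=> H.
  case; apply/first_obs_incl => w.
    by move/(first_obs_ext w PrivTrE)/H/(first_obs_ext w PubTrE).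
  by move/(first_obs_ext w PubTrE)/H/(first_obs_ext w PrivTrE).
move=> w; split.
  by move/(first_obs_ext w PrivTrE)/(first_obs_incl true false).2 => /(_ (H true))/(first_obs_ext w PubTrE).
by move/(first_obs_ext w PubTrE)/(first_obs_incl false true).2 => /(_ (H false))/(first_obs_ext w PrivTrE).
Qed.

End OpacityAcceptance.

Definition opaque (weak : bool) (i : instance) : Prop :=
  if weak then weakly_opaque (automaton i) (nobs i) else fully_opaque (automaton i) (nobs i).

(** Weak opacity is violated only by a private run, [f = true]; full opacity by either kind.
    Extracting the violation is classical. *)
Lemma opaqueE weak i C : all (const_ok C) (r_inv (raw_of i)) ->
  all (fun e => const_ok C e.2.1) (r_edges (raw_of i)) ->
  ~ opaque weak i <-> exists f w, [/\ ~~ weak || f, accepts C (raw_of i) f (nobs i) w &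
    ~ accepts C (raw_of i) (~~ f) (nobs i) w].
Proof.
case: i => na nl nc A N H1 H2; rewrite /opaque /=; case: weak.
  split.
    move=> H; apply: NNPP => H3; apply: H; apply/(weakly_opaqueE H1 H2) => w Hw.
    by apply: NNPP => H4; apply: H3; exists true, w.
  by move=> [f [w [/= -> H3 H4]]] /(weakly_opaqueE H1 H2) /(_ w H3).
split.
  move=> H; apply: NNPP => H3; apply: H; apply/(fully_opaqueE H1 H2) => f w Hw.
  by apply: NNPP => H4; apply: H3; exists f, w.
by move=> [f [w [_ H3 H4]]] /(fully_opaqueE H1 H2) /(_ f w H3).
Qed.

(** * Certificates of non-opacity and their size *)

Definition node_codec : codec node_encType :=
  pair_codec nat_codec (pair_codec (seq_codec nat_codec) bool_codec).
Definition cert_codec :=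
  pair_codec bool_codec (pair_codec nat_codec (pair_codec (seq_codec node_codec)
    (seq_codec (pair_codec bits_codec nat_codec)))).

(** A word that encodes no instance is in the complement, so any certificate is accepted for it.
    What follows the decoded certificate is left free: this is the padding to the prescribed
    length. *)
Definition nonopacity_check (weak : bool) (c w : seq bool) : bool :=
  if cdec rinst_codec w is Some p then
    if nilp p.2 && valid p.1 then
      if cdec cert_codec c is Some q then
        (~~ weak || q.1.1) && verify q.1.2.1 p.1 q.1.2.2.1 q.1.2.2.2 q.1.1
      else false
    else true
  else true.

Lemma FP_nonopacity_check weak : FP (fun p => nonopacity_check weak p.1 p.2).
Proof.
rewrite /nonopacity_check; have Hv := FP_valid.
repeat first [match goal with
  | |- FP (fun x => cdec ?c (@?f x)) => apply: (@FP_cdec _ _ c f)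
  | |- FP (fun x => verify (@?c x) (@?r x) (@?v x) (@?w x) (@?f x)) => apply: (@FP_verify _ c r w f v)
  end; cbn beta | fp1].
Qed.

Lemma size_cenc_mem (A : encType) (c : codec A) (l : seq A) m :
  size (cenc (seq_codec c) l) <= m -> all (fun x => size (cenc c x) <= m) l.
Proof.
elim: l => //= x l' IH; rewrite size_cat => H; apply/andP; split; first by lia.
by apply: IH; rewrite /=; lia.
Qed.

Lemma size_cenc_seq (A : encType) (c : codec A) (l : seq A) k :
  all (fun x => size (cenc c x) <= k) l -> size (cenc (seq_codec c) l) <= size l * k.+1 + 1.
Proof.
elim: l => //= x l IH /andP[H1 /IH]; rewrite size_cat /=; nia.
Qed.

Lemma size_cenc_seq_ge (A : encType) (c : codec A) (l : seq A) : size l <= size (cenc (seq_codec c) l).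
Proof. by elim: l => //= x l; rewrite size_cat /=; lia. Qed.

Lemma value_lt b : value b < 2 ^ size b.
Proof. by elim: b => //= x b IH; rewrite -/(value b) expnS; case: x; lia. Qed.

Lemma value_small b n : size (cenc bits_codec b) <= n -> value b < 2 ^ n.
Proof.
move=> H; apply: leq_trans (value_lt b) _; rewrite leq_exp2l //.
exact: leq_trans (size_cenc_seq_ge bool_codec b) H.
Qed.

Lemma guard_small g n : size (cenc (seq_codec rconstr_codec) g) <= n -> const_ok (2 ^ n) g.
Proof.
move/size_cenc_mem/allP=> H; apply/allP => -[x [k [s d]]] /H.
rewrite /rconstr_codec !cenc_pair !size_cat => H1; have /value_small : size (cenc bits_codec d) <= n by lia.
by move=> Hv; rewrite cvE; apply: leq_ltn_trans (geq_minl _ _) Hv.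
Qed.

Lemma raw_small (r : rinst) n : size (cenc rinst_codec r) <= n ->
  [/\ all (const_ok (2 ^ n)) (r_inv r), all (fun e => const_ok (2 ^ n) e.2.1) (r_edges r) &
      [/\ value (r_nobs r) < 2 ^ n, r_na r <= n, r_nl r <= n & r_nc r <= n]].
Proof.
case: r => na [nl [nc [i0 [pr [fi [iv [ed nb]]]]]]].
rewrite /rinst_codec !cenc_pair !size_cat => H; split.
- have /size_cenc_mem/allP H1 : size (cenc (seq_codec (seq_codec rconstr_codec)) iv) <= n by lia.
  by apply/allP => g /H1 /guard_small.
- have /size_cenc_mem/allP H1 : size (cenc (seq_codec redge_codec) ed) <= n by lia.
  apply/allP => -[x [g [a [R t]]]] /H1; rewrite /redge_codec !cenc_pair !size_cat => H2.
  have L : size (cenc (seq_codec rconstr_codec) g) <= n by lia.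
  exact: guard_small L.
- split.
  + have L : size (cenc bits_codec nb) <= n by lia.
    exact: value_small L.
  + by apply: leq_trans (size_cenc_seq_ge unit_codec na) _; lia.
  + by apply: leq_trans (size_cenc_seq_ge unit_codec nl) _; lia.
  + by apply: leq_trans (size_cenc_seq_ge unit_codec nc) _; lia.
Qed.

Fixpoint vecs (n C : nat) : seq (seq nat) :=
  if n is n'.+1 then [seq x :: v | x <- iota 0 C.+1, v <- vecs n' C] else [:: [::]].

Lemma vecsP n C v : (v \in vecs n C) = (size v == n) && all (fun x => x <= C) v.
Proof.
elim: n v => [|n IH] v; first by case: v.
apply/allpairsP/andP => [[[x u] /= [Hx Hu ->]]|[/eqP Hs Ha]].
  have {}Hx : x <= C by move: (Hx : x \in iota 0 C.+1); rewrite mem_iota.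
  by move: Hu; rewrite IH /= Hx => /andP[/eqP -> ->].
case: v Hs Ha => // x v [Hs] /= /andP[Hx Ha]; exists (x, v); split => //.
  by rewrite -[_ \in _]/(x \in iota 0 C.+1) mem_iota.
by rewrite IH Hs eqxx.
Qed.

Lemma size_vecs n C : size (vecs n C) = C.+1 ^ n.
Proof. by elim: n => // n IH; rewrite -[vecs _ _]/[seq x :: v | x <- iota 0 C.+1, v <- vecs n C] size_allpairs size_iota IH expnS. Qed.

Definition all_nodes (nl nc C : nat) : seq nodeq :=
  [seq (l, p) | l <- iota 0 nl, p <- [seq (v, f) | v <- vecs nc C, f <- [:: true; false]]].

Lemma all_nodesP nl nc C (x : nodeq) : (x \in all_nodes nl nc C) =
  [&& x.1 < nl, size x.2.1 == nc & all (fun u => u <= C) x.2.1].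
Proof.
apply/allpairsP/and3P => [[[l p] /= [Hl Hp ->]]|[Hl Hs Ha]] /=.
  have /allpairsP [[v f] [/= Hv _ ->]] : p \in [seq (v, f) | v <- vecs nc C, f <- [:: true; false]] := Hp.
  by move: Hv Hl; rewrite vecsP mem_iota => /andP[-> ->] /= ->.
case: x Hl Hs Ha => l [v f] /= Hl Hs Ha; exists (l, (v, f)); split => //; first by rewrite mem_iota.
rewrite -[_ \in _]/((v, f) \in [seq (v, f) | v <- vecs nc C, f <- [:: true; false]]).
by apply/allpairsP; exists (v, f); split => //=; [rewrite vecsP Hs|case: f].
Qed.

Lemma size_all_nodes nl nc C : size (all_nodes nl nc C) = nl * (C.+1 ^ nc * 2).
Proof. by rewrite !size_allpairs size_iota size_vecs. Qed.

Lemma lstep_shape i C lb x y : 0 < C -> y \in lstep C (raw_of i) lb x ->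
  x \in all_nodes (nloc i) (nclk i) C -> y \in all_nodes (nloc i) (nclk i) C.
Proof.
rewrite !all_nodesP => HC Hy /and3P[H1 H2 H3].
have edge_shape e : e \in r_edges (raw_of i) -> y \in (edge_succ C (raw_of i) x e : seq nodeq) ->
    [&& y.1 < nloc i, size y.2.1 == nclk i & all (fun u => u <= C) y.2.1].
  case/mapP=> {}e He ->; rewrite /edge_succ; case: ifP => // _; rewrite inE => /eqP -> /=.
  rewrite /r_nl /= size_nseq cv_digits // ltn_ord size_map size_iota H2 /=.
  apply/allP => u /mapP [k]; rewrite mem_iota => /andP[_ Hk] ->; case: ifP => // _.
  by apply: (allP H3); rewrite mem_nth.
case: lb Hy => [[a|]|] /=.
- case/flatten_mapP=> e He; case: e.2.2.1 => // b; case: ifP => // _; exact: edge_shape.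
- case/flatten_mapP=> e He; case: e.2.2.1 => // ; exact: edge_shape.
- rewrite /tick_succ; case: ifP => // _; rewrite inE => /eqP -> /=.
  rewrite H1 size_map H2 /=; apply/allP => u /mapP [k _ ->]; exact: geq_minr.
Qed.

Lemma all_nodes_closed i C : 0 < C -> closedV C (raw_of i) (all_nodes (nloc i) (nclk i) C).
Proof.
move=> HC; apply/allP => x Hx; apply/allP => y; rewrite nmemE mem_cat => /orP[Hy|/all_succE [oa Hy]].
  exact: (lstep_shape (lb := None)) Hy Hx.
exact: lstep_shape HC Hy Hx.
Qed.

Lemma init_in_all_nodes i C : init_node (raw_of i) \in all_nodes (nloc i) (nclk i) C.
Proof.
rewrite all_nodesP /= /r_nl /r_nc /r_init /= !size_nseq cv_digits // ltn_ord eqxx /=.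
by elim: (nclk i).
Qed.

Lemma enc_unary_size n : size (cenc nat_codec n) = n.+1.
Proof. by rewrite /= /enc_unary size_cat size_nseq addn1. Qed.

(** With [S <= D = 2 ^ ((n + 1) * (n + 1))], everything is at most [1024 * D * C * C], a power of
    two with exponent [(n + 1) ^ 2 + 2 * n + 10]. This is below [(n + 10) ^ 2], the exponent chosen
    for the certificate length. *)
Lemma cert_arith n C D nl nc na S a b : C = 2 ^ n -> D = 2 ^ ((n + 1) * (n + 1)) ->
  nl <= n -> nc <= n -> na <= n -> S = nl * (C.+1 ^ nc * 2) -> a <= C ->
  b <= 1 + (C + 1) + ((S * (nl + (nc * (C + 3) + 10)).+1 + 1) + (a * (2 * S + 1 + na + 10).+1 + 1)) ->
  b <= 2 ^ ((n + 10) * (n + 10)).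
Proof.
move=> EC ED Hl Hc Ha ES HaC Hb.
have Cn : n < C by rewrite EC ltn_expl.
have C0 : 0 < C by rewrite EC expn_gt0.
have C1 : C.+1 <= 2 ^ n.+1 by rewrite expnS -EC; lia.
have P : C.+1 ^ nc <= 2 ^ (n.+1 * n).
  rewrite expnM; apply: leq_trans (_ : (2 ^ n.+1) ^ nc <= _).
    by case: (nc) => // k; rewrite leq_exp2r.
  by rewrite leq_exp2l // -[1]/(2 ^ 0) ltn_exp2l.
have SD : S <= D.
  rewrite ES ED (_ : (n + 1) * (n + 1) = n.+1 * n + n + 1); last by lia.
  rewrite (expnD 2 (n.+1 * n + n) 1) (expnD 2 (n.+1 * n) n) -EC expn1; set X := C.+1 ^ nc in P *; set Y := 2 ^ _ in P *.
  have H : nl * X <= Y * C by rewrite mulnC leq_mul //; lia.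
  by rewrite mulnA leq_mul2r H orbT.
have Big : D * (C * C) * 1024 <= 2 ^ ((n + 10) * (n + 10)).
  rewrite ED EC -!expnD -[1024]/(2 ^ 10) -expnD leq_exp2l //; lia.
apply: leq_trans Big; apply: leq_trans Hb _.
have D0 : 0 < D by rewrite ED expn_gt0.
have B1 : nl + (nc * (C + 3) + 10) < 16 * (C * C) by nia.
have B2 : S * (nl + (nc * (C + 3) + 10)).+1 <= D * (16 * (C * C)) by apply: leq_mul.
have B3 : 2 * S + 1 + na + 10 < 16 * (D * C) by nia.
have B4 : a * (2 * S + 1 + na + 10).+1 <= C * (16 * (D * C)) by apply: leq_mul.
have B5 : C * (16 * (D * C)) = D * (16 * (C * C)) by lia.
have B6 : C <= D * (C * C) by nia.
rewrite B5 in B4; set X := D * (C * C) in B6 *.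
have B7 : D * (16 * (C * C)) = 16 * X by rewrite /X; lia.
have X0 : 0 < X by lia.
lia.
Qed.

Lemma node_size nl nc C (x : nodeq) : x \in all_nodes nl nc C ->
  size (cenc node_codec x) <= nl + (nc * (C + 3) + 10).
Proof.
rewrite all_nodesP => /and3P[H1 /eqP H2 H3]; case: x H1 H2 H3 => l [v f] H1 H2 H3.
rewrite /node_codec !cenc_pair size_cat enc_unary_size size_cat.
have : size (cenc (seq_codec nat_codec) v) <= size v * C.+2 + 1.
  by apply: size_cenc_seq; apply/allP => u Hu; rewrite enc_unary_size ltnS; apply: (allP H3).
rewrite /= in H1 H2 *; nia.
Qed.

Theorem nonopacity_NEXPTIME weak (P : language) :
  (forall w, P w <-> ~ problem (opaque weak) w) -> NEXPTIME P.
Proof.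
move=> HP; apply: (@FP_NEXPTIME _ (fun n => (n + 10) * (n + 10)) (nonopacity_check weak)).
- exact: FP_nonopacity_check.
- by mpb.
- by fp.
move=> w; rewrite HP; split; last first.
  move=> [c _ Hc] [i Ei Ho]; move: Hc; rewrite /nonopacity_check -Ei enc_raw.
  have := cencK rinst_codec (raw_of i) [::]; rewrite cats0 => ->.
  have -> : nilp (raw_of i, [::] : seq bool).2 && valid (raw_of i, [::] : seq bool).1 by apply/validP; exists i.
  case: (cdec cert_codec c) => [[[f [C [V wd]]] r]|] // /andP[Hf Hv].
  have [u [H1 H2 H3 H4 H5]] := verify_sound (Hv : verify C (raw_of i) V wd f).
  have EN : value (r_nobs (raw_of i)) = nobs i := value_digits _.
  apply: (proj2 (opaqueE weak H1 H2)) Ho; exists f, u.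
  by rewrite EN in H4 H5.
move=> Hn; case Ed: (cdec rinst_codec w) => [[r rest]|]; last first.
  by exists (nseq (2 ^ ((size w + 10) * (size w + 10))) false); rewrite ?size_nseq // /nonopacity_check Ed.
case Ev: (nilp rest && valid r); last first.
  by exists (nseq (2 ^ ((size w + 10) * (size w + 10))) false); rewrite ?size_nseq // /nonopacity_check Ed /= Ev.
case/andP: Ev => /nilP Er /validP [i Ei]; subst rest r.
have Ew : w = cenc rinst_codec (raw_of i) by rewrite (cdecK Ed) cats0.
have Hw : size (cenc rinst_codec (raw_of i)) <= size w by rewrite -Ew.
have [H1 H2 [H3 Hna Hnl Hnc]] := raw_small Hw.
(* Every constant, and [N], is written in binary inside [w], hence is below [2 ^ n]. *)
set n := size w in H1 H2 H3 Hna Hnl Hnc *; set C := 2 ^ n in H1 H2 H3.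
have Hno : ~ opaque weak i by move=> Ho; apply: Hn; exists i => //; rewrite enc_raw -Ew.
have [f [u [Hf Ha Hna']]] := proj1 (opaqueE weak H1 H2) Hno.
have EN : nobs i = value (r_nobs (raw_of i)) := esym (value_digits _).
rewrite EN in Ha Hna'.
have C0 : 0 < C by rewrite expn_gt0.
have Hu : size u <= value (r_nobs (raw_of i)).
  by case: Ha => x [ls [y [_ _ _ <-]]]; rewrite size_take_min geq_minl.
(* The certificate writes actions in unary, so their numbers must be bounded too. *)
have Hacts : all (fun a => a < nact i) (map snd u).
  have [s [_ _ <-]] := proj1 (accepts_runs H1 H2 f _ _) Ha.
  rewrite map_take; apply/allP => a /mem_take /mapP [p Hp ->]; move: Hp.
  by rewrite /nat_delays => /mapP [q _ ->] /=.
have [wd [W1 W2 W3]] := verify_complete H1 H2 H3 (init_in_all_nodes i C) (all_nodes_closed i C0) Hu Ha Hna'.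
set V := all_nodes _ _ _ in W2 W3.
pose ct := (f, (C, (V, wd))).
have Hsz : size (cenc cert_codec ct) <= 2 ^ ((n + 10) * (n + 10)).
  apply: (@cert_arith n C (2 ^ ((n + 1) * (n + 1))) (nloc i) (nclk i) (nact i) (size V) (size u)) => //.
  - by rewrite /r_nl /= size_nseq in Hnl.
  - by rewrite /r_nc /= size_nseq in Hnc.
  - by rewrite /r_na /= size_nseq in Hna.
  - exact: size_all_nodes.
  - by apply: leq_trans Hu (ltnW H3).
  have Lw : size wd = size u by rewrite -(size_map snd) W1 size_map.
  rewrite /ct /cert_codec !cenc_pair size_cat size_cat enc_unary_size size_cat.
  have S1 : size (cenc (seq_codec node_codec) V) <= size V * (nloc i + (nclk i * (C + 3) + 10)).+1 + 1.
    by apply: size_cenc_seq; apply/allP => x Hx; apply: node_size.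
  have S2 : size (cenc (seq_codec (pair_codec bits_codec nat_codec)) wd) <= size wd * (2 * size V + 1 + nact i + 10).+1 + 1.
    apply: size_cenc_seq; apply/allP => -[b a] Hba; rewrite cenc_pair size_cat enc_unary_size.
    have /eqP Hb := allP W2 _ Hba.
    have : a < nact i by apply: (allP Hacts); rewrite -W1; apply/mapP; exists (b, a).
    have : size (cenc bits_codec b) <= size b * 2 + 1.
      by apply: size_cenc_seq; apply/allP.
    by rewrite Hb; lia.
  rewrite Lw in S2; rewrite -[size (cenc bool_codec f)]/1 -[C.+1]addn1 -[1 + (C + 1) + _]addnA.
  by rewrite !leq_add2l; apply: leq_add S1 S2.
exists (cenc cert_codec ct ++ nseq (2 ^ ((n + 10) * (n + 10)) - size (cenc cert_codec ct)) false).
  by rewrite size_cat size_nseq subnKC.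
rewrite /nonopacity_check Ed cencK.
have -> : nilp (raw_of i, [::] : seq bool).2 && valid (raw_of i, [::] : seq bool).1 by apply/validP; exists i.
by apply/andP; split; [exact: Hf|exact: W3].
Qed.

(** * Reduction from machine acceptance *)

Section Reduction.

Variable M : NTM.

Definition tp : finType := 'I_(ntapes M).+1.
Definition msym : finType := option (bool + aux M).
Definition action : finType := (state M * {ffun tp -> msym * direction})%type.
(** The absence of an action marks the last letter, a halted accepting configuration. *)
Definition letter : finType := (state M * {ffun tp -> msym} * option action)%type.

(* [Ctl q] checks the timing and the control states, [Track i s] follows the
   content [s] of one cell of the tape [i], [Adj i s d] updates the clock which
   gives the position of the head relative to this cell after a move [d]. *)
Inductive loc :=
| L0 | LP | LF | LA | LD
| Ctl of state M
| Track of tp & msym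
| Adj of tp & msym & direction.

Definition loc_code (l : loc) : 'I_5 + (state M + (tp * msym + tp * msym * direction)) :=
  match l with
  | L0 => inl (inord 0) | LP => inl (inord 1) | LF => inl (inord 2)
  | LA => inl (inord 3) | LD => inl (inord 4)
  | Ctl q => inr (inl q)
  | Track i s => inr (inr (inl (i, s)))
  | Adj i s d => inr (inr (inr (i, s, d)))
  end.

Definition loc_decode (x : 'I_5 + (state M + (tp * msym + tp * msym * direction))) : loc :=
  match x with
  | inl i => match val i with 0 => L0 | 1 => LP | 2 => LF | 3 => LA | _ => LD end
  | inr (inl q) => Ctl q
  | inr (inr (inl (i, s))) => Track i s
  | inr (inr (inr (i, s, d))) => Adj i s d
  end.

Lemma loc_codeK : cancel loc_code loc_decode.
Proof. by case=> //=; rewrite inordK. Qed.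

HB.instance Definition _ := Finite.copy loc (can_type loc_codeK).

Definition cy : 'I_2 := ord0.
Definition cz : 'I_2 := ord_max.

(* The constant [(b, k)] stands for [2 ^ (m + b) + k]. *)
Definition tconstr : Type := ('I_2 * cmp * (bool * nat))%type.
Definition template : Type := (loc * seq tconstr * option letter * {set 'I_2} * loc)%type.

Definition mk (l : loc) (g : seq tconstr) (a : option letter) (R : {set 'I_2}) (l' : loc) : template :=
  (l, g, a, R, l').

Definition cP : bool * nat := (true, 1).
Definition cH : bool * nat := (false, 1).
(** This is [period - dirz d]. A clock showing [mark - k] at a letter and reset at that value shows
    [mark - (k - dirz d)] one period after the letter, and [k - dirz d] is the position of the cell
    after the move. *)
Definition cPd (d : direction) : bool * nat :=
  (true, match d with ToLeft => 2 | Stay => 1 | ToRight => 0 end).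

Definition ok (a : letter) : bool :=
  match a.2 with
  | Some qa => @delta M a.1.1 a.1.2 qa
  | None => (a.1.1 \in accept M) && [forall qa : action, ~~ @delta M a.1.1 a.1.2 qa]
  end.

Definition ctl_edges (qa : state M * letter) : seq template :=
  let: (q, a) := qa in
  [:: mk (Ctl q) [:: (cz, CmpLt, cP)] (Some a) set0 LA; mk (Ctl q) [:: (cz, CmpGt, cP)] (Some a) set0 LA;
      if ok a && (a.1.1 == q) then
        mk (Ctl q) [::] (Some a) [set cz] (if a.2 is Some qa then Ctl qa.1 else LD)
      else mk (Ctl q) [::] (Some a) set0 LA].

Definition track_edges (x : tp * msym * letter) : seq template :=
  let: (i, s, a) := x in
  if a.1.2 i != s then [:: mk (Track i s) [:: (cy, CmpEq, cH)] (Some a) set0 LA] else [::].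

Definition move_edges (x : tp * msym * letter) : seq template :=
  let: (i, s, a) := x in
  if a.2 is Some qa then
    [:: mk (Track i s) [:: (cy, CmpLt, cH)] (Some a) set0 (Adj i s (qa.2 i).2);
        mk (Track i s) [:: (cy, CmpGt, cH)] (Some a) set0 (Adj i s (qa.2 i).2)] ++
    (if a.1.2 i == s then
       [:: mk (Track i s) [:: (cy, CmpEq, cH)] (Some a) set0 (Adj i (qa.2 i).1 (qa.2 i).2)] else [::])
  else [::].

(** [LP] is private and reads every word. [LA] is entered once an error has been found and also
    reads everything. [LD] follows a last letter, after which any letter is an error. Stopping in
    [Ctl q] is itself an error, a computation left incomplete. *)
Definition static_edges : seq template :=
  [:: mk L0 [::] None set0 LP; mk LP [::] None set0 LF; mk L0 [::] None set0 (Ctl (Defs.start M));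
      mk LA [::] None set0 LF; mk L0 [:: (cy, CmpLt, (false, 0))] None [set cy] (Track ord0 None)] ++
  flatten [seq [:: mk LP [::] (Some a) set0 LP; mk LA [::] (Some a) set0 LA; mk LD [::] (Some a) set0 LA]
     | a <- enum letter] ++
  [seq mk (Ctl q) [::] None set0 LF | q <- enum (state M)] ++
  flatten [seq ctl_edges x | x <- enum {: state M * letter}] ++
  flatten [seq track_edges x ++ move_edges x | x <- enum {: tp * msym * letter}] ++
  [seq mk L0 [::] None [set cy] (Track i None) | i <- enum tp & i != ord0] ++
  [seq mk (Adj x.1.1 x.1.2 x.2) [:: (cy, CmpEq, cPd x.2)] None [set cy] (Track x.1.1 x.1.2)
     | x <- enum {: tp * msym * direction}].

Variables (w : seq bool) (m : nat).

(** Input cell [x] starts [x] places to the right of the head. A reset at date [2 ^ m + x] makes the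
    clock show [mark - x] at the first letter, due at date [period]. Dates below [2 ^ m] select the
    blank cells on the left of the input. *)
Definition input_edge (x : nat) (b : bool) : template :=
  mk L0 [:: (cy, CmpEq, (false, x))] None [set cy] (Track ord0 (Some (inl b))).

Definition beyond_edge (n : nat) : template :=
  mk L0 [:: (cy, CmpGe, (false, n))] None [set cy] (Track ord0 None).

Definition input_edges : seq template :=
  [seq input_edge x (nth false w x) | x <- iota 0 (size w)] ++ [:: beyond_edge (size w)].

Definition templates : seq template := static_edges ++ input_edges.

Definition const (c : bool * nat) : nat := 2 ^ (m + c.1) + c.2.

Definition period : nat := const cP.
Definition mark : nat := const cH.

Definition tsat (Y Z : nat) (g : seq tconstr) : bool :=
  all (fun c : tconstr => cmp_sem c.1.2 (Posz (if c.1.1 == cy then Y else Z)) (Posz (const c.2))) g.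

Definition word : Type := seq (letter * nat).

(* [acc l Y Z now v]: a run from [l] at time [now], with clock values [Y] and
   [Z], reads [v] and reaches [LF] without entering [LP]. *)
Inductive acc : loc -> nat -> nat -> nat -> word -> Prop :=
| acc_final Y Z now : acc LF Y Z now [::]
| acc_eps l g R l' Y Z now v d : mk l g None R l' \in templates -> l != LF -> l' != LP ->
    tsat (Y + d) (Z + d) g ->
    acc l' (if cy \in R then 0 else Y + d) (if cz \in R then 0 else Z + d) (now + d) v ->
    acc l Y Z now v
| acc_obs l g a R l' Y Z now v d : mk l g (Some a) R l' \in templates -> l != LF -> l' != LP ->
    tsat (Y + d) (Z + d) g ->
    acc l' (if cy \in R then 0 else Y + d) (if cz \in R then 0 else Z + d) (now + d) v ->
    acc l Y Z now ((a, now + d) :: v).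

Definition heads (c : tm_config M) : {ffun tp -> msym} := [ffun i => Defs.thead (c.2 i)].

Definition nextc (c : tm_config M) (qa : action) : tm_config M :=
  (qa.1, [ffun i => tape_act (c.2 i) (qa.2 i)]).

(* [v] describes an accepting computation from [c], one letter every [period] time
   units. *)
Fixpoint accepting_word (c : tm_config M) (t : nat) (v : word) : Prop :=
  if v is (a, u) :: v' then
    [/\ u = t + period, ok a, a.1.1 = c.1, a.1.2 = heads c &
        if a.2 is Some qa then accepting_word (nextc c qa) u v' else v' = [::]]
  else False.

Lemma accepting_word_of_run n c c' t : tm_reach n c c' -> tm_halted c' -> c'.1 \in accept M ->
  exists2 v, accepting_word c t v & size v = n.+1.
Proof.
elim: n c t => [|n IH] c t /=.
  move=> -> Hh Ha; exists [:: ((c'.1, heads c', None), t + period)] => //=; split => //.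
  rewrite /ok /= Ha /=; apply/forallP => qa; apply/negP => Hd.
  by apply: (Hh (nextc c' qa)); exists qa.
case=> c1 [qa Hd ->] Hr Hh Ha; have [v Hv Hs] := IH _ (t + period) Hr Hh Ha.
by exists (((c.1, heads c, Some qa), t + period) :: v); rewrite /= ?Hs.
Qed.

Lemma run_of_accepting_word c t v : accepting_word c t v ->
  exists n c', [/\ tm_reach n c c', tm_halted c' & c'.1 \in accept M].
Proof.
elim: v c t => //= -[[[q s] [qa|]] u] v IH c t /= [_ Hok /= Hq Hs]; rewrite /ok /= Hq Hs in Hok.
  case/IH=> n [c' [H1 H2 H3]]; exists n.+1, c'; split => //.
  by exists (nextc c qa) => //; exists qa.
move=> _; exists 0, c; case/andP: Hok => Ha /forallP Hd; split => // c' [qa Hqa _].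
by have := Hd qa; rewrite Hqa.
Qed.

Definition getz (T : tape (aux M)) (k : int) : msym :=
  match k with
  | Posz 0 => Defs.thead T
  | Posz n.+1 => nth None (tright T) n
  | Negz n => nth None (tleft T) n
  end.

Definition dirz (d : direction) : int := match d with ToLeft => -1 | Stay => 0 | ToRight => 1 end.

Lemma getz_act T (sd : msym * direction) k :
  getz (tape_act T sd) (k - dirz sd.2)%R = if k == 0 then sd.1 else getz T k.
Proof.
case: T sd => l h r [s d]; case: d => /=.
- rewrite opprK; case: k => [[|n]|[|n]].
  + by [].
  + by rewrite (_ : (_ + 1)%R = Posz n.+2) //=; lia.
  + by rewrite (_ : (_ + 1)%R = Posz 0) /=; [case: l|lia].
  + by rewrite (_ : (_ + 1)%R = Negz n) /=; [case: l => //; rewrite nth_nil|lia].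
- by rewrite subr0; case: k => [[|n]|n].
- case: k => [[|[|n]]|n].
  + by [].
  + by rewrite (_ : (_ - 1)%R = Posz 0) /=; [case: r|lia].
  + by rewrite (_ : (_ - 1)%R = Posz n.+1) /=; [case: r => //; rewrite nth_nil|lia].
  + by rewrite (_ : (_ - 1)%R = Negz n.+1) //; lia.
Qed.

Lemma getz_init i k : getz ((tm_init M w).2 i) k =
  if i == ord0 then (if k is Posz n then (if n < size w then Some (inl (nth false w n)) else None) else None)
  else None.
Proof.
rewrite /= ffunE /tape_of; case: eqP => _; last by case: k => [[|n]|n] //=; rewrite nth_nil.
case: k => [[|n]|n] /=; last by rewrite nth_nil.
  by case: (w).
case: (w) => [|b u] /=; first by rewrite nth_nil.
rewrite ltnS; case: ltnP => Hn; first by rewrite (nth_map false).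
by rewrite nth_default // size_map.
Qed.

(** An inductive view of [templates], which replaces the inspection of nested concatenations by one
    case analysis. *)
Inductive shape : loc -> seq tconstr -> option letter -> {set 'I_2} -> loc -> Prop :=
| ShPriv : shape L0 [::] None set0 LP
| ShPrivEnd : shape LP [::] None set0 LF
| ShStart : shape L0 [::] None set0 (Ctl (Defs.start M))
| ShErrEnd : shape LA [::] None set0 LF
| ShNeg : shape L0 [:: (cy, CmpLt, (false, 0))] None [set cy] (Track ord0 None)
| ShPrivLoop (a : letter) : shape LP [::] (Some a) set0 LP
| ShErrLoop (a : letter) : shape LA [::] (Some a) set0 LA
| ShDone (a : letter) : shape LD [::] (Some a) set0 LA
| ShCtlEnd q : shape (Ctl q) [::] None set0 LF
| ShCtlLt q (a : letter) : shape (Ctl q) [:: (cz, CmpLt, cP)] (Some a) set0 LA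
| ShCtlGt q (a : letter) : shape (Ctl q) [:: (cz, CmpGt, cP)] (Some a) set0 LA
| ShCtlOk (a : letter) : ok a -> shape (Ctl a.1.1) [::] (Some a) [set cz] (if a.2 is Some qa then Ctl qa.1 else LD)
| ShCtlErr q (a : letter) : ~~ (ok a && (a.1.1 == q)) -> shape (Ctl q) [::] (Some a) set0 LA
| ShRead i s (a : letter) : a.1.2 i != s -> shape (Track i s) [:: (cy, CmpEq, cH)] (Some a) set0 LA
| ShMoveLt i s (a : letter) (qa : action) : a.2 = Some qa ->
    shape (Track i s) [:: (cy, CmpLt, cH)] (Some a) set0 (Adj i s (qa.2 i).2)
| ShMoveGt i s (a : letter) (qa : action) : a.2 = Some qa ->
    shape (Track i s) [:: (cy, CmpGt, cH)] (Some a) set0 (Adj i s (qa.2 i).2)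
| ShMoveEq i (a : letter) (qa : action) : a.2 = Some qa ->
    shape (Track i (a.1.2 i)) [:: (cy, CmpEq, cH)] (Some a) set0 (Adj i (qa.2 i).1 (qa.2 i).2)
| ShTape i : i != ord0 -> shape L0 [::] None [set cy] (Track i None)
| ShAdj i s d : shape (Adj i s d) [:: (cy, CmpEq, cPd d)] None [set cy] (Track i s)
| ShInput x : x < size w -> shape L0 [:: (cy, CmpEq, (false, x))] None [set cy] (Track ord0 (Some (inl (nth false w x))))
| ShBeyond : shape L0 [:: (cy, CmpGe, (false, size w))] None [set cy] (Track ord0 None).

Lemma shapeP l g a R l' : mk l g a R l' \in templates <-> shape l g a R l'.
Proof.
rewrite /templates /static_edges; split.
  rewrite !mem_cat => /orP[/or4P[||| /or4P[]]|/orP[]].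
  - rewrite !inE => /orP[/eqP[-> -> -> -> ->]|/orP[/eqP[-> -> -> -> ->]|/orP[/eqP[-> -> -> -> ->]|/orP[/eqP[-> -> -> -> ->]|/eqP[-> -> -> -> ->]]]]];
      by constructor.
  - case/flatten_mapP=> b _; rewrite !inE => /or3P[] /eqP[-> -> -> -> ->]; by constructor.
  - by case/mapP=> q _ [-> -> -> -> ->]; constructor.
  - case/flatten_mapP=> -[q b] _; rewrite !inE => /or3P[/eqP[-> -> -> -> ->]|/eqP[-> -> -> -> ->]|]; try by constructor.
    by case: ifP => [/andP[Hb /eqP <-]|/negbT Hb] /eqP[-> -> -> -> ->]; constructor.
  - case/flatten_mapP=> -[[i s] b] _; rewrite mem_cat => /orP[].
      by rewrite /track_edges; case: ifP => // Hb; rewrite inE => /eqP[-> -> -> -> ->]; constructor.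
    rewrite /move_edges; case Eb: b.2 => [qa|//]; rewrite mem_cat !inE => /orP[/orP[]|].
    + by move/eqP=> [-> -> -> -> ->]; constructor.
    + by move/eqP=> [-> -> -> -> ->]; constructor.
    + by case: ifP => // /eqP <-; rewrite inE => /eqP[-> -> -> -> ->]; constructor.
  - by case/mapP=> i; rewrite mem_filter => /andP[Hi _] [-> -> -> -> ->]; constructor.
  - by case/mapP=> -[[i s] d] _ [-> -> -> -> ->]; constructor.
  - by case/mapP=> x; rewrite mem_iota => /andP[_ Hx] [-> -> -> -> ->]; constructor.
  - by rewrite inE => /eqP[-> -> -> -> ->]; constructor.
have in0 t s1 s2 : t \in s1 -> t \in (s1 ++ s2 : seq template) by rewrite mem_cat => ->.
have inS t s1 s2 : t \in s2 -> t \in (s1 ++ s2 : seq template) by rewrite mem_cat orbC => ->.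
case=> {l g a R l'}.
- by rewrite !inE eqxx.
- by rewrite !inE eqxx ?orbT.
- by rewrite !inE eqxx ?orbT.
- by rewrite !inE eqxx ?orbT.
- by rewrite !inE eqxx ?orbT.
- move=> a; apply/in0/inS/in0/flatten_mapP; exists a; rewrite ?mem_enum // !inE eqxx //.
- move=> a; apply/in0/inS/in0/flatten_mapP; exists a; rewrite ?mem_enum // !inE eqxx ?orbT //.
- move=> a; apply/in0/inS/in0/flatten_mapP; exists a; rewrite ?mem_enum // !inE eqxx ?orbT //.
- by move=> q; apply/in0/inS/inS/in0/mapP; exists q; rewrite ?mem_enum.
- by move=> q a; apply/in0/inS/inS/inS/in0/flatten_mapP; exists (q, a); rewrite ?mem_enum // !inE eqxx.
- by move=> q a; apply/in0/inS/inS/inS/in0/flatten_mapP; exists (q, a); rewrite ?mem_enum // !inE eqxx ?orbT.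
- move=> a Ha; apply/in0/inS/inS/inS/in0/flatten_mapP; exists (a.1.1, a); rewrite ?mem_enum //.
  by rewrite /ctl_edges Ha eqxx !inE eqxx ?orbT.
- move=> q a /negbTE Ha; apply/in0/inS/inS/inS/in0/flatten_mapP; exists (q, a); rewrite ?mem_enum //.
  by rewrite /ctl_edges Ha !inE eqxx ?orbT.
- move=> i s a Ha; apply/in0/inS/inS/inS/inS/in0/flatten_mapP; exists (i, s, a); rewrite ?mem_enum //.
  by apply: in0; rewrite /track_edges Ha inE.
- move=> i s a qa Ha; apply/in0/inS/inS/inS/inS/in0/flatten_mapP; exists (i, s, a); rewrite ?mem_enum //.
  by apply: inS; rewrite /move_edges Ha !inE eqxx.
- move=> i s a qa Ha; apply/in0/inS/inS/inS/inS/in0/flatten_mapP; exists (i, s, a); rewrite ?mem_enum //.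
  by apply: inS; rewrite /move_edges Ha !inE eqxx ?orbT.
- move=> i a qa Ha; apply/in0/inS/inS/inS/inS/in0/flatten_mapP; exists (i, a.1.2 i, a); rewrite ?mem_enum //.
  by apply: inS; rewrite /move_edges Ha eqxx !inE eqxx ?orbT.
- move=> i Hi; apply/in0/inS/inS/inS/inS/inS/in0/mapP; exists i => //.
  by rewrite mem_filter Hi mem_enum.
- by move=> i s d; apply/in0/inS/inS/inS/inS/inS/inS/mapP; exists (i, s, d); rewrite ?mem_enum.
- by move=> x Hx; apply/inS/in0/mapP; exists x; rewrite ?mem_iota.
- by apply/inS/inS; rewrite inE.
Qed.

(* [Track]: at the next letter, [y = mark] iff the head is on the tracked cell. *)
Definition invariant (l : loc) (Y Z now : nat) (v : word) : Prop :=
  match l with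
  | L0 => [/\ now = 0, Y = 0, Z = 0 & accepting_word (tm_init M w) 0 v]
  | LP | LA => False
  | LF => v <> [::]
  | LD => v = [::]
  | Ctl q => exists c t, [/\ accepting_word c t v, c.1 = q & Z + t = now]
  | Track i s => exists c t (k : int), [/\ accepting_word c t v, getz (c.2 i) k = s
      & (Posz Y + Posz t + Posz period - Posz now = Posz mark - k)%R]
  | Adj i s d => exists c t (k : int), [/\ accepting_word c t v, getz (c.2 i) k = s
      & (Posz Y = Posz mark - (k + dirz d) + Posz now - Posz t)%R]
  end.

Lemma period_E : period = 2 ^ m.+1 + 1. Proof. by rewrite -[m.+1]addn1. Qed.
Lemma mark_E : mark = 2 ^ m + 1. Proof. by rewrite -[in RHS](addn0 m). Qed.
Lemma Pd_E d : Posz (const (cPd d)) = (Posz period - dirz d)%R.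
Proof. by rewrite period_E /const -[m.+1]addn1; case: d => /=; lia. Qed.

Lemma const0 x : const (false, x) = 2 ^ m + x.
Proof. by rewrite /const -[in RHS](addn0 m). Qed.

Lemma period_mark_E : period = mark + 2 ^ m. Proof. by rewrite period_E mark_E expnS; lia. Qed.

Lemma invariant_start i s (k : int) (now : nat) v : accepting_word (tm_init M w) 0 v ->
  getz ((tm_init M w).2 i) k = s -> Posz now = (Posz (2 ^ m) + k)%R -> invariant (Track i s) 0 0 now v.
Proof.
move=> Hg Hs Hn; exists (tm_init M w), 0, k; split => //.
by rewrite Hn period_mark_E; lia.
Qed.

(** The core of soundness: while an accepting word is read, timing, control and the followed cell
    stay exact, so every edge to [LA] contradicts its guard or its side condition. [LF] can be
    entered only with letters left to read, whereas [acc] ends there on the empty word. *)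
Lemma invariant_step l g a R l' Y Z now v d : shape l g a R l' -> l' != LP ->
  tsat (Y + d) (Z + d) g ->
  invariant l Y Z now (if a is Some b then (b, now + d) :: v else v) ->
  invariant l' (if cy \in R then 0 else Y + d) (if cz \in R then 0 else Z + d) (now + d) v.
Proof.
have HPE := period_mark_E.
case=> {l g a R l'}; rewrite /tsat ?[all _ _]/= ?inE ?andbT ?eqxx //=.
- by move=> _ _ [-> _ -> Hg]; exists (tm_init M w), 0; split => //; lia.
- move=> _; rewrite const0 => Hd [Hn HY _ Hg].
  apply: (@invariant_start _ _ (Negz (2 ^ m - d).-1)) => //; first by rewrite getz_init eqxx.
  by rewrite NegzE; lia.
- by move=> q _ _ [c [t [Hg _ _]]] E; rewrite E in Hg.
- by move=> q a _ Hd [c [t [/= [Hu _ _ _ _] _ HZ]]]; move: Hd; rewrite -/period; lia.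
- by move=> q a _ Hd [c [t [/= [Hu _ _ _ _] _ HZ]]]; move: Hd; rewrite -/period; lia.
- move=> a _ Hl _ [c [t [/= [Hu _ Hq _ Hg] _ HZ]]]; case Ea: a.2 Hg Hl => [qa|] //= Hg Hl.
  by exists (nextc c qa), (now + d); split.
- move=> q a Ha _ _ [c [t [/= [_ Hok Hq _ _] Eq _]]].
  by rewrite Hok Hq Eq eqxx in Ha.
- move=> i s a Hs _ /eqP Hd [c [t [k [/= [Hu _ _ Hr _] Hk HY]]]].
  have E : k = 0 by rewrite -/mark in Hd; lia.
  by move: Hs; rewrite Hr ffunE -Hk E eqxx.
- move=> i s a qa Ea _ Hd [c [t [k [/= [Hu _ _ Hr Hg] Hk HY]]]]; rewrite Ea in Hg.
  exists (nextc c qa), (now + d), (k - dirz (qa.2 i).2)%R; split => //; last by lia.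
  rewrite /= ffunE getz_act; case: eqP => // E; rewrite -/mark in Hd; lia.
- move=> i s a qa Ea _ Hd [c [t [k [/= [Hu _ _ Hr Hg] Hk HY]]]]; rewrite Ea in Hg.
  exists (nextc c qa), (now + d), (k - dirz (qa.2 i).2)%R; split => //; last by lia.
  rewrite /= ffunE getz_act; case: eqP => // E; rewrite -/mark in Hd; lia.
- move=> i a qa Ea _ /eqP Hd [c [t [k [/= [Hu _ _ Hr Hg] Hk HY]]]]; rewrite Ea in Hg.
  exists (nextc c qa), (now + d), (k - dirz (qa.2 i).2)%R; split => //; last by lia.
  rewrite /= ffunE getz_act; case: eqP => // E; rewrite -/mark in Hd; lia.
- move=> i Hi _ _ [Hn HY _ Hg].
  apply: (@invariant_start _ _ (Posz d - Posz (2 ^ m))%R) => //; last by lia.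
  by rewrite getz_init (negbTE Hi).
- move=> i s dr _ /eqP; rewrite Pd_E => Hd [c [t [k [Hg Hk HY]]]].
  by exists c, t, k; split => //; lia.
- move=> x Hx _ /eqP; rewrite const0 => Hd [Hn HY _ Hg].
  apply: (@invariant_start _ _ (Posz x)) => //; last by lia.
  by rewrite getz_init eqxx Hx.
- move=> _; rewrite const0 => Hd [Hn HY _ Hg].
  apply: (@invariant_start _ _ (Posz (d - 2 ^ m))) => //; last by lia.
  by rewrite getz_init eqxx ltnNge; case: leqP => //; lia.
Qed.

Lemma acc_invariant l Y Z now v : acc l Y Z now v -> ~ invariant l Y Z now v.
Proof.
elim=> {l Y Z now v} [Y Z now|l g R l' Y Z now v d /shapeP Hs _ Hl' Hg _ IH Hi|l g a R l' Y Z now v d /shapeP Hs _ Hl' Hg _ IH Hi]; first by [].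
  exact: IH (invariant_step Hs Hl' Hg Hi).
exact: IH (invariant_step Hs Hl' Hg Hi).
Qed.

Lemma acc_not_accepting v : acc L0 0 0 0 v -> ~ accepting_word (tm_init M w) 0 v.
Proof. by move=> /acc_invariant Ha Hg; apply: Ha. Qed.

Lemma acc_eps' l g R l' Y Z now v d : shape l g None R l' -> l <> LF -> l' <> LP ->
    tsat (Y + d) (Z + d) g ->
    acc l' (if cy \in R then 0 else Y + d) (if cz \in R then 0 else Z + d) (now + d) v ->
    acc l Y Z now v.
Proof. by move=> /shapeP H1 /eqP H2 /eqP H3 H4; apply: acc_eps H1 H2 H3 H4. Qed.

Lemma acc_obs' l g a R l' Y Z now v u : now <= u -> shape l g (Some a) R l' -> l <> LF -> l' <> LP ->
    tsat (Y + (u - now)) (Z + (u - now)) g ->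
    acc l' (if cy \in R then 0 else Y + (u - now)) (if cz \in R then 0 else Z + (u - now)) u v ->
    acc l Y Z now ((a, u) :: v).
Proof.
move=> Hu /shapeP H1 /eqP H2 /eqP H3 H4 H5; rewrite -[in (a, u)](subnKC Hu).
by apply: acc_obs H1 H2 H3 H4 _; rewrite subnKC.
Qed.

Definition sorted_from (t : nat) (v : word) : bool := path leq t (map snd v).

Lemma sorted_from_cons t a u v : sorted_from t ((a, u) :: v) = (t <= u) && sorted_from u v.
Proof. by []. Qed.

Arguments sorted_from : simpl never.

Lemma acc_LA Y Z now v : sorted_from now v -> acc LA Y Z now v.
Proof.
elim: v Y Z now => [|[a u] v IH] Y Z now /=.
  move=> _; apply: (@acc_eps' _ _ _ _ _ _ _ _ 0 ShErrEnd) => //.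
  exact: acc_final.
rewrite sorted_from_cons => /andP[Hu Hv].
apply: (@acc_obs' _ _ _ _ _ _ _ _ _ _ Hu (ShErrLoop a)) => //.
exact: IH.
Qed.

(** [accepting_word] with the tapes forgotten. It splits the errors into those of timing and
    control, found by [Ctl], and the misread symbols, found by [Track]. *)
Fixpoint ctl_ok (q : state M) (t : nat) (v : word) : Prop :=
  if v is (a, u) :: v' then
    [/\ u = t + period, ok a, a.1.1 = q & if a.2 is Some qa then ctl_ok qa.1 u v' else v' = [::]]
  else False.

Lemma acc_ctl q t v Y Z now : sorted_from now v -> Z + t = now -> ~ ctl_ok q t v -> acc (Ctl q) Y Z now v.
Proof.
elim: v q t Y Z now => [|[a u] v IH] q t Y Z now /=.
  move=> _ _ _; apply: (@acc_eps' _ _ _ _ _ _ _ _ 0 (ShCtlEnd q)) => //.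
  exact: acc_final.
rewrite sorted_from_cons => /andP[Hu Hv] HZ Hn.
have [HuP|HuP|HuP] := ltngtP u (t + period).
- apply: (@acc_obs' _ _ _ _ _ _ _ _ _ _ Hu (ShCtlLt q a)) => //; last exact: acc_LA.
  by rewrite /tsat /= -/period; lia.
- apply: (@acc_obs' _ _ _ _ _ _ _ _ _ _ Hu (ShCtlGt q a)) => //; last exact: acc_LA.
  by rewrite /tsat /= -/period; lia.
case Eok: (ok a && (a.1.1 == q)); last first.
  apply: (@acc_obs' _ _ _ _ _ _ _ _ _ _ Hu (ShCtlErr (negbT Eok))) => //; exact: acc_LA.
case/andP: Eok => Hok /eqP Eq; rewrite -Eq in Hn *.
apply: (@acc_obs' _ _ _ _ _ _ _ _ _ _ Hu (ShCtlOk Hok)) => //; first by case: (a.2).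
rewrite !inE /=; case Ea: a.2 Hn => [qa|] Hn.
  by apply: IH Hv _ _ => // Hc; apply: Hn.
case: v Hv Hn {IH} => [|[b u'] v] Hv Hn; first by case: Hn.
move: Hv; rewrite sorted_from_cons => /andP[Hu' Hv].
by apply: (@acc_obs' _ _ _ _ _ _ _ _ _ _ Hu' (ShDone b)) => //; apply: acc_LA.
Qed.

(** Some letter misreads a tape [i]. The misread cell is under the head there, at position 0, and
    its earlier positions are obtained by undoing the moves, each a shift by at most one. The
    letters before the error are genuine machine steps, so the time bound [b] limits the distance
    and keeps all waiting times nonnegative. *)
Lemma acc_track b c t v : b < 2 ^ m -> (forall n c', tm_reach n c c' -> n <= b) ->
  sorted_from t v -> ctl_ok c.1 t v -> ~ accepting_word c t v ->
  exists i (k : int), (`|k| <= b)%N /\ forall Y Z now, t <= now <= t + period ->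
    (Posz Y + Posz t + Posz period - Posz now = Posz mark - k)%R -> acc (Track i (getz (c.2 i) k)) Y Z now v.
Proof.
have HPE := period_mark_E; have HHE := mark_E.
elim: v b c t => [|[a u] v IH] b c t //= Hb Hreach.
rewrite sorted_from_cons => /andP[Hu Hv] [Eu Hok Hq Hc] Hng.
case: (pickP (fun i => a.1.2 i != heads c i)) => [i Hi|Heq].
  exists i, 0%R; split => // Y Z now /andP[Hnow Hnow'] HY.
  have Hs : a.1.2 i != getz (c.2 i) 0 by move: Hi; rewrite /heads ffunE.
  have Hnu : now <= u by rewrite Eu.
  apply: (@acc_obs' _ _ _ _ _ _ _ _ _ _ Hnu (ShRead Hs)) => //; last exact: acc_LA.
  by rewrite /tsat /= -/mark; lia.
have Eh : a.1.2 = heads c by apply/ffunP => i; apply/eqP; have := Heq i; case: eqP.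
case Ea: a.2 Hc Hng => [qa|] Hc Hng; last by case: Hng.
have Hstep : tm_step c (nextc c qa).
  by exists qa => //; move: Hok; rewrite /ok Ea Hq Eh.
have b0 : 0 < b by apply: (Hreach 1 (nextc c qa)); exists (nextc c qa).
have [|||||i [k [Hk Hacc]]] := IH b.-1 (nextc c qa) u; first by lia.
- by move=> n c' Hr; have := Hreach n.+1 c' (ex_intro2 _ _ _ Hstep Hr); lia.
- exact: Hv.
- exact: Hc.
- by move=> Hg; apply: Hng.
pose d := (qa.2 i).2; exists i, (k + dirz d)%R; split.
  by rewrite /d; case: (qa.2 i).2 => /=; lia.
move=> Y Z now /andP[Hnow Hnow'] HY.
have Hnu : now <= u by rewrite Eu.
have Hd : (`|dirz d| <= 1)%N by case: (d).
have Hadj Z' : acc (Adj i (getz ((nextc c qa).2 i) k) d) (Y + (u - now)) Z' u v.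
  (* The wait after the letter: from [mark - (k + dirz d)] the clock needs [2 ^ m + k] units to
     reach [period - dirz d]. *)
  pose e := (Posz (2 ^ m) + k)%R.
  have He : (0 <= e)%R by rewrite /e; lia.
  apply: (@acc_eps' _ _ _ _ _ _ _ _ `|e|%N (ShAdj i (getz ((nextc c qa).2 i) k) d)) => //.
    by rewrite /tsat /= Pd_E /e in He *; lia.
  rewrite !inE /=; apply: Hacc; rewrite /e in He *; lia.
have Eg := getz_act (c.2 i) (qa.2 i) (k + dirz d)%R.
rewrite -/d addrK in Eg.
have En : getz ((nextc c qa).2 i) k = if (k + dirz d)%R == 0 then (qa.2 i).1 else getz (c.2 i) (k + dirz d)%R.
  by rewrite /= ffunE.
move: Hadj; rewrite En; case: eqP => Ek Hadj.
  have Es : getz (c.2 i) (k + dirz d)%R = a.1.2 i by rewrite Ek Eh ffunE.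
  rewrite Es; apply: (@acc_obs' _ _ _ _ _ _ _ _ _ _ Hnu (ShMoveEq i Ea)) => //.
    by rewrite /tsat /= -/mark; lia.
  by rewrite !inE.
have [Hlt|Hgt] : (Y + (u - now) < mark)%N \/ (mark < Y + (u - now))%N by lia.
  apply: (@acc_obs' _ _ _ _ _ _ _ _ _ _ Hnu (ShMoveLt i _ Ea)) => //; last by rewrite !inE.
  by rewrite /tsat /= -/mark; lia.
apply: (@acc_obs' _ _ _ _ _ _ _ _ _ _ Hnu (ShMoveGt i _ Ea)) => //; last by rewrite !inE.
by rewrite /tsat /= -/mark; lia.
Qed.

(** The initial wait [2 ^ m + k] selects the cell at position [k]; the tape, the sign of [k] and its
    comparison with [size w] decide which edge guesses its initial content. *)
Lemma acc_of_not_accepting b v : b < 2 ^ m ->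
  (forall n c', tm_reach n (tm_init M w) c' -> n <= b) ->
  sorted_from 0 v -> ~ accepting_word (tm_init M w) 0 v -> acc L0 0 0 0 v.
Proof.
move=> Hb Hreach Hv Hng; have HPE := period_mark_E; have HHE := mark_E.
case: (classic (ctl_ok (Defs.start M) 0 v)) => Hc; last first.
  apply: (@acc_eps' _ _ _ _ _ _ _ _ 0 ShStart) => //.
  by rewrite !inE !addn0; apply: acc_ctl Hv _ Hc.
have [i [k [Hk Hacc]]] := acc_track Hb Hreach Hv Hc Hng.
pose e := (Posz (2 ^ m) + k)%R; have He : (0 <= e)%R by rewrite /e; lia.
have {}Hacc : acc (Track i (getz ((tm_init M w).2 i) k)) 0 `|e|%N `|e|%N v.
  by apply: Hacc; rewrite /e in He *; lia.
move: Hacc; rewrite getz_init; case: eqP => [->|/eqP Hi] Hacc; last first.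
  by apply: (@acc_eps' _ _ _ _ _ _ _ _ `|e|%N (ShTape Hi)) => //; rewrite !inE.
case: k Hk @e He Hacc => [x|x] Hk e He Hacc.
  case: ltnP Hacc => Hx Hacc.
    apply: (@acc_eps' _ _ _ _ _ _ _ _ `|e|%N (ShInput Hx)) => //; last by rewrite !inE.
    by rewrite /tsat /= const0 /e; lia.
  apply: (@acc_eps' _ _ _ _ _ _ _ _ `|e|%N ShBeyond) => //; last by rewrite !inE.
  by rewrite /tsat /= const0 /e; lia.
apply: (@acc_eps' _ _ _ _ _ _ _ _ `|e|%N ShNeg) => //; last by rewrite !inE.
by rewrite /tsat /= const0 /e; lia.
Qed.

End Reduction.

(** * The instance of the reduction and its opacity *)

Section ReductionTA.

Variables (M : NTM) (w : seq bool) (m : nat).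

Definition rk (T : finType) (x : T) : 'I_#|T| := enum_rank x.

Definition inst_guard (g : seq tconstr) : guard 'I_2 := [seq (c.1, Posz (const m c.2)) | c <- g].

Definition inst (t : template M) : edge 'I_#|letter M| 'I_#|{: loc M}| 'I_2 :=
  let: (l, g, a, R, l') := t in
  Edge (rk l) (inst_guard g) (omap (@rk (letter M)) a) R (rk l').

Definition reductTA : TA 'I_#|letter M| 'I_#|{: loc M}| 'I_2 :=
  MkTA (rk (@L0 M)) [set rk (@LP M)] [set rk (@LF M)] [ffun=> [::]] (map inst (templates M w)).

Lemma in_invT c : in_inv reductTA c.
Proof. by rewrite /in_inv /= ffunE. Qed.

Lemma rk_inj (T : finType) : injective (@rk T). Proof. exact: enum_rank_inj. Qed.

Lemma rkK (T : finType) : cancel (@rk T) enum_val. Proof. exact: enum_rankK. Qed.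

Lemma enum_val_rkK (T : finType) : cancel enum_val (@rk T). Proof. exact: enum_valK. Qed.

Lemma rk_neq (l l' : loc M) : l <> l' -> rk l != rk l'.
Proof. by move=> Hl; apply/eqP => /rk_inj. Qed.

Lemma sat_inst (mu : valuation 'I_2) g : sat mu (inst_guard g) = tsat m (mu cy) (mu cz) g.
Proof.
rewrite /sat /tsat /inst_guard all_map; apply: eq_all => -[[x c] k] /=.
by congr (cmp_sem _ (Posz _) _); case: (unliftP ord0 x) => [j ->|-> //]; rewrite (ord1 j); congr (mu _); apply: val_inj.
Qed.

Lemma enabledE l (mu : valuation 'I_2) d e : enabled reductTA (rk l, mu) (d, e) <->
  exists g a R l', [/\ mk l g a R l' \in templates M w, e = inst (mk l g a R l') &
    tsat m (mu cy + d) (mu cz + d) g].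
Proof.
have Es g : sat (elapse mu d) (inst_guard g) = tsat m (mu cy + d) (mu cz + d) g.
  by rewrite sat_inst !ffunE.
split.
  case/and5P=> /mapP [[[[[l0 g] a] R] l'] Ht /= ->] /eqP /= /rk_inj El _ Hs _.
  by exists g, a, R, l'; rewrite -El -Es; split.
move=> [g [a [R [l' [Ht -> Hs]]]]]; apply/and5P; split => //=; try exact: in_invT.
- exact: (map_f inst Ht).
- by apply/forallP => d'; apply: in_invT.
- by rewrite Es.
Qed.

Definition encw (v : word M) : timed_word 'I_#|letter M| := [seq (rk p.1, p.2) | p <- v].
Definition decw (v : timed_word 'I_#|letter M|) : word M := [seq (enum_val p.1, p.2) | p <- v].

Lemma encwK : cancel encw decw.
Proof. by move=> v; rewrite /decw /encw -map_comp map_id_in // => -[a u] _ /=; rewrite rkK. Qed.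

Lemma decwK : cancel decw encw.
Proof. by move=> v; rewrite /decw /encw -map_comp map_id_in // => -[a u] _ /=; rewrite enum_val_rkK. Qed.

Definition public_from (l : loc M) (mu : valuation 'I_2) (now : nat) (v : word M) : Prop :=
  exists s, [/\ feasible reductTA (rk l, mu) s, last (rk l) (tail_locs s) = rk (@LF M),
    all (fun x => x != rk (@LF M)) (belast (rk l) (tail_locs s)),
    all (fun x => x != rk (@LP M)) (tail_locs s) & trace_from now s = encw v].

Lemma public_of_acc l Y Z now v : acc w m l Y Z now v ->
  forall mu : valuation 'I_2, mu cy = Y -> mu cz = Z -> public_from l mu now v.
Proof.
elim=> {l Y Z now v} [Y Z now|l g R l' Y Z now v d Ht Hl Hl' Hg _ IH|l g a R l' Y Z now v d Ht Hl Hl' Hg _ IH] mu HY HZ.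
- by exists [::].
- have [||s [H1 H2 H3 H4 H5]] := IH (reset R (elapse mu d)); try by rewrite !ffunE ?HY ?HZ.
  exists ((d, inst (mk l g None R l')) :: s); split => //=.
  + apply/andP; split; last by [].
    by apply/enabledE; exists g, None, R, l'; split; rewrite ?HY ?HZ.
  + by rewrite H3 andbT (inj_eq (@rk_inj _)).
  + by rewrite H4 andbT (inj_eq (@rk_inj _)).
- have [||s [H1 H2 H3 H4 H5]] := IH (reset R (elapse mu d)); try by rewrite !ffunE ?HY ?HZ.
  exists ((d, inst (mk l g (Some a) R l')) :: s); split => //=.
  + apply/andP; split; last by [].
    by apply/enabledE; exists g, (Some a), R, l'; split; rewrite ?HY ?HZ.
  + by rewrite H3 andbT (inj_eq (@rk_inj _)).
  + by rewrite H4 andbT (inj_eq (@rk_inj _)).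
  + by rewrite H5.
Qed.

Lemma acc_of_public l mu now v : public_from l mu now v -> acc w m l (mu cy) (mu cz) now v.
Proof.
move=> [s [H1 H2 H3 H4 H5]]; elim: s l mu now v H1 H2 H3 H4 H5 => [|[d e] s IH] l mu now v /=.
  move=> _ /rk_inj -> _ _; case: v => // _; exact: acc_final.
case/andP=> /enabledE [g [a [R [l' [Ht -> Hg]]]]] Hf H2 /andP[Hl H3] /andP[Hl' H4] H5.
rewrite (inj_eq (@rk_inj _)) in Hl; rewrite (inj_eq (@rk_inj _)) in Hl'.
have IH' u : trace_from (now + d) s = encw u ->
    acc w m l' (if cy \in R then 0 else mu cy + d) (if cz \in R then 0 else mu cz + d) (now + d) u.
  by move=> E; have := IH l' _ (now + d) u Hf H2 H3 H4 E; rewrite !ffunE.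
case: a Ht H5 {Hf H2 H3 H4} IH' => [a|] Ht /= H5 IH'; last first.
  by apply: (acc_eps Ht Hl Hl' Hg); apply: IH'.
case: v H5 => [//|[b u] v] /= [/rk_inj Ea Eu E]; rewrite -Ea -Eu.
exact: (acc_obs Ht Hl Hl' Hg (IH' _ E)).
Qed.

Lemma PubTr_acc v : PubTr reductTA v <-> acc w m (@L0 M) 0 0 0 (decw v).
Proof.
have L0P : rk (@L0 M) != rk (@LP M) by apply: rk_neq.
split.
  move=> [s [/and4P[_ H1 H2 H3] H4 H5]].
  have := @acc_of_public (@L0 M) [ffun=> 0] 0 (decw v); rewrite !ffunE; apply.
  exists s; split => //.
  - by move: H2; rewrite inE => /eqP.
  - by apply: sub_all H3 => x; rewrite inE.
  - move: H4; rewrite /is_private -all_predC => /= /andP[_]; apply: sub_all => x /=.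
    by rewrite inE.
  - by rewrite decwK H5.
move=> H; have [||s [H1 H2 H3 H4 H5]] := public_of_acc H (mu := [ffun=> 0]); rewrite ?ffunE //.
exists s; split; last by rewrite /trace H5 decwK.
  rewrite /is_run in_invT H1 /= H2 inE eqxx /=; apply: sub_all H3 => x; by rewrite inE.
rewrite /is_private /= inE (negbTE L0P) /= -all_predC; apply: sub_all H4 => x /=.
by rewrite inE.
Qed.

Lemma priv_loop now (v : timed_word 'I_#|letter M|) c : c.1 = rk (@LP M) -> path leq now (map snd v) ->
  exists s, [/\ feasible reductTA c s, last (rk (@LP M)) (tail_locs s) = rk (@LF M),
    all (fun x => x != rk (@LF M)) (belast (rk (@LP M)) (tail_locs s)) & trace_from now s = v].
Proof.
have PF : rk (@LP M) != rk (@LF M) by apply: rk_neq.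
elim: v now c => [|[a u] v IH] now [l mu] /= ->.
  move=> _; exists [:: (0, inst (mk (@LP M) [::] None set0 (@LF M)))]; split => //=; last by rewrite PF.
  rewrite andbT; apply/enabledE; exists [::], None, set0, (@LF M); split => //.
  by apply/shapeP; constructor.
case/andP=> Hu Hv; pose e := inst (mk (@LP M) [::] (Some (enum_val a)) set0 (@LP M)).
have [s [H1 H2 H3 H4]] := IH u (succ_config (rk (@LP M), mu) (u - now, e)) (erefl _) Hv.
exists ((u - now, e) :: s); split => //=.
- rewrite H1 andbT; apply/enabledE; exists [::], (Some (enum_val a)), set0, (@LP M); split => //.
  by apply/shapeP; constructor.
- by rewrite PF H3.
- by rewrite subnKC // H4 enum_val_rkK.
Qed.

Lemma PrivTr_all v : path leq 0 (map snd v) -> PrivTr reductTA v.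
Proof.
pose e := inst (mk (@L0 M) [::] None set0 (@LP M)).
move=> /(priv_loop (erefl : (succ_config (init_config reductTA) (0, e)).1 = _)) [s [H1 H2 H3 H4]].
have L0F : rk (@L0 M) != rk (@LF M) by apply: rk_neq.
have He : enabled reductTA (init_config reductTA) (0, e).
  by apply/enabledE; exists [::], None, set0, (@LP M); split => //; apply/shapeP; constructor.
exists ((0, e) :: s); split.
- rewrite /is_run in_invT [feasible _ _ _]/= He H1 /= !inE H2 eqxx L0F /=.
  by apply: sub_all H3 => x; rewrite inE.
- by rewrite /is_private /= !inE eqxx orbT.
- by rewrite /trace /= addn0 H4.
Qed.

Lemma accepting_word_sorted (c : tm_config M) t v : accepting_word m c t v -> sorted_from t v.
Proof.
elim: v c t => //= -[a u] v IH c t [Eu _ _ _ Hv]; rewrite sorted_from_cons Eu leq_addr /= -Eu.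
by case: a.2 Hv => [qa Hv|->]; [exact: IH Hv|].
Qed.

(** An accepting word is a private trace but not a public one. If there is none, the public traces
    are all the words with nondecreasing dates, exactly the private ones, which gives full and
    therefore weak opacity. *)
Lemma opaque_reductTA weak b : b.+1 < 2 ^ m ->
  (forall n c, tm_reach n (tm_init M w) c -> n <= b) ->
  opaque weak (MkInstance reductTA (2 ^ m)) <->
  ~ exists n c, [/\ tm_reach n (tm_init M w) c, tm_halted c & c.1 \in accept M].
Proof.
move=> Hb Hreach.
have Hw : opaque weak (MkInstance reductTA (2 ^ m)) -> weakly_opaque reductTA (2 ^ m).
  by case: weak => //= H v /H.
split.
  move=> /Hw H [n [c [H1 H2 H3]]].
  have [v Hv Hs] := accepting_word_of_run m 0 H1 H2 H3.
  have Hv2 : size (encw v) < 2 ^ m by rewrite size_map Hs; have := Hreach _ _ H1; lia.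
  have [|u Hu E] := H (encw v).
    exists (encw v); last by rewrite take_oversize // ltnW.
    by apply: PrivTr_all; rewrite -map_comp; exact: accepting_word_sorted Hv.
  (* The accepting word has at most [b.+1 < 2 ^ m] letters, so a trace whose first [2 ^ m] letters
     are that word has no other letters. *)
  have Eu : u = encw v.
    have [Hsu|Hsu] := leqP (size u) (2 ^ m); first by rewrite E take_oversize.
    by move: Hv2; rewrite E size_takel ?ltnn // ltnW.
  by move/PubTr_acc: Hu; rewrite Eu encwK => /acc_not_accepting; apply.
move=> Hno.
have Ht v : PubTr reductTA v <-> path leq 0 (map snd v).
  split; first by move=> [s [_ _ ->]]; apply: trace_sorted.
  move=> Hv; apply/PubTr_acc; apply: (acc_of_not_accepting _ Hreach); first by lia.
    by rewrite /sorted_from -map_comp; exact: Hv.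
  by move=> /run_of_accepting_word; apply: Hno.
have Hf : fully_opaque reductTA (2 ^ m).
  move=> v; split=> -[u Hu ->]; exists u => //; last by apply/PrivTr_all/Ht.
  by apply/Ht; case: Hu => s [_ _ ->]; apply: trace_sorted.
by case: weak Hw => _ //= v /Hf.
Qed.

End ReductionTA.

(** * Computing the reduction in polynomial time *)

Lemma FP_horner (A : encType) (p : {poly nat}) (n : A -> nat) :
  FP n -> FP (fun a => (p.[n a])%R : nat).
Proof.
move=> Hn; elim/poly_ind: p => [|p c IH].
  by apply: (@FP_ext _ _ (fun=> 0)) (FP_const _ _) => a; rewrite horner0.
apply: (@FP_ext _ _ (fun a => (p.[n a])%R * n a + c)).
  by move=> a; rewrite hornerMXaddC.
by fp.
Qed.

Lemma enc_seqE (T : Type) (e : T -> seq bool) s :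
  enc_seq e s = flatten [seq true :: e x | x <- s] ++ [:: false].
Proof. by elim: s => //= x s ->; rewrite catA. Qed.

Lemma enc_seq_split (T : Type) (e : T -> seq bool) s1 s2 x :
  enc_seq e (s1 ++ s2 ++ [:: x]) = flatten [seq true :: e y | y <- s1] ++
    flatten [seq true :: e y | y <- s2] ++ (true :: e x) ++ [:: false].
Proof. by rewrite enc_seqE !map_cat !flatten_cat /= cats0 -!catA. Qed.

Lemma FP_enc_seq (C X : encType) (e : C -> X -> seq bool) (l : C -> seq X) :
  FP (fun p => e p.1 p.2) -> FP l -> FP (fun c => enc_seq (e c) (l c)).
Proof.
move=> He Hl; apply: (@FP_ext _ _ (fun c => flatten [seq true :: e c x | x <- l c] ++ [:: false])).
  by move=> c; rewrite enc_seqE.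
by fp.
Qed.

(** The list belongs to the fixed machine [M], not to the input: the program is assembled by
    recursion on it, and its elements are never coded. *)
Lemma FP_flatten_const (C : encType) (T : eqType) (l : seq T) (g : C -> T -> seq bool) :
  (forall x, FP (g^~ x)) -> FP (fun c => flatten [seq g c x | x <- l]).
Proof.
move=> Hg; elim: l => [|x l IH] /=; first exact: FP_const.
by apply: (FP_cat (Hg x) IH).
Qed.

(** The digits of [2 ^ n + k] for [k < 2 ^ n]: the [n] low digits come from [k] and the leading one
    is appended. The exponential number itself, unary in [FP], is never formed. *)
Definition shifted_digits (n k : nat) : seq bool := [seq odd (iter i half k) | i <- iota 0 n] ++ [:: true].

Lemma iter_half i k : iter i half k = k %/ 2 ^ i.
Proof. by elim: i => [|i IH]; rewrite ?divn1 // iterS IH -divn2 -divnMA expnSr. Qed.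

Lemma shifted_digitsE n k : k < 2 ^ n -> binary_digits (2 ^ n + k) = shifted_digits n k.
Proof.
move=> Hk; rewrite /binary_digits /shifted_digits.
rewrite (@trunc_log_eq 2 n) //; last by rewrite leq_addr /= expnS; lia.
rewrite -[in iota 0 n.+1]addn1 iotaD map_cat /= add0n divnDl // divnn expn_gt0 /= divn_small //; congr (_ ++ _).
apply/eq_in_map => i; rewrite mem_iota add0n /= => Hi; rewrite iter_half.
rewrite -[in X in 2 ^ X + k](subnK (ltnW Hi)) expnD divnMDl ?expn_gt0 // oddD oddX.
by rewrite subn_eq0 leqNgt Hi.
Qed.

Lemma FP_shifted_digits (A : encType) (n k : A -> nat) :
  FP n -> FP k -> FP (fun a => shifted_digits (n a) (k a)).
Proof.
have Hodd (B : encType) (f : B -> nat) : FP f -> FP (fun b => odd (f b)).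
  by move=> Hf; apply: (@FP_fst _ _ _ (fun b => (odd (f b), (f b)./2))); apply: FP_odd_half.
have Hhalf (B : encType) (f : B -> nat) : FP f -> FP (fun b => (f b)./2).
  by move=> Hf; apply: (@FP_snd _ _ _ (fun b => (odd (f b), (f b)./2))); apply: FP_odd_half.
move=> Hn Hk; apply: FP_cat; last exact: FP_const.
apply: (@FP_map _ _ _ (fun a i => odd (iter i half (k a)))); last by fp.
apply: Hodd; apply: (@FP_iter _ _ (fun _ => half)); [exact: Hhalf (FP_arg2 _ _)|exact: FP_arg2|exact: (FP_comp Hk (FP_arg1 _ _))|].
have [F HF B] := FP_size_bound Hk; exists F => // -[a i] j _.
have L : sz (k a) <= F (sz (a, i)).
  by apply: leq_trans (B a) _; apply: (mpb_homo HF); rewrite sz_pair; lia.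
apply: leq_trans L; rewrite iter_half !sz_nat.
have := leq_div (k a) (2 ^ j); lia.
Qed.

Section ReductionEncoding.

Variable M : NTM.

Definition enc_tconstr (m : nat) (c : tconstr) : seq bool :=
  enc_nat c.1.1 ++ enc_nat (nat_of_cmp c.1.2) ++
  false :: enc_seq enc_bool (shifted_digits (m + c.2.1) c.2.2).

Definition enc_template (m : nat) (t : template M) : seq bool :=
  let: (l, g, a, R, l') := t in
  enc_nat (rk l) ++ enc_seq (enc_tconstr m) g ++
  enc_option (fun b => enc_nat (rk b)) a ++ enc_set R ++ enc_nat (rk l').

Definition offsets_below (K : nat) (t : template M) : bool := all (fun c : tconstr => c.2.2 < K) t.1.1.1.2.

Lemma enc_templateE m t : offsets_below (2 ^ m) t -> enc_edge (inst m t) = enc_template m t.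
Proof.
case: t => -[[[l g] a] R] l' Ht; rewrite /enc_template.
have <- : enc_guard (inst_guard m g) = enc_seq (enc_tconstr m) g; last by case: a {Ht}.
rewrite /offsets_below /= in Ht.
have Hc x c b k : k < 2 ^ m ->
    enc_constraint ((x, c), Posz (const m (b, k))) = enc_tconstr m ((x, c), (b, k)) :> seq bool.
  move=> Hk; rewrite /enc_constraint /enc_tconstr /enc_int /enc_nat -shifted_digitsE //.
  by apply: leq_trans Hk _; rewrite leq_exp2l // leq_addr.
elim: g Ht => // -[[x c] [b k]] g IH /andP[/(Hc x c b) Hk /IH Hg].
exact: (congr2 (fun u v => true :: u ++ v) Hk Hg).
Qed.

(** The offsets are at most 2 or at most [size w], hence at most [m], so no carry reaches the
    leading digit. *)
Lemma offsets_templates w m t : 3 <= m -> size w <= m -> t \in templates M w -> offsets_below (2 ^ m) t.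
Proof.
move=> Hm Hw; case: t => -[[[l g] a] R] l' /shapeP Ht.
have H2 k : k <= m -> k < 2 ^ m by move=> Hk; apply: leq_ltn_trans Hk (ltn_expl _ _).
rewrite /offsets_below /=; case: Ht => //= *; rewrite ?andbT ?H2 //; try lia.
by case: (X in match X with ToLeft => _ | Stay => _ | ToRight => _ end); lia.
Qed.

Definition reduction (w : seq bool) (m : nat) : instance := MkInstance (reductTA M w m) (2 ^ m).

Definition fixed_part : seq bool :=
  enc_unary #|letter M| ++ enc_unary #|{: loc M}| ++ enc_unary 2 ++
  enc_nat (rk (@L0 M)) ++ enc_set [set rk (@LP M)] ++ enc_set [set rk (@LF M)] ++
  enc_seq (@enc_guard 2) [seq [::] | _ <- enum 'I_#|{: loc M}|].

Lemma enc_insts m (s : seq (template M)) : {in s, forall t, offsets_below (2 ^ m) t} ->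
  enc_seq (@enc_edge _ _ 2) (map (inst m) s) = enc_seq (enc_template m) s.
Proof.
elim: s => // t s IH Hs.
have {}IH := IH (fun u Hu => Hs u (mem_behead (s := t :: s) Hu)).
exact: (congr2 (fun u v => true :: u ++ v) (enc_templateE (Hs t (mem_head t s))) IH).
Qed.

Lemma enc_reduction w m : 3 <= m -> size w <= m ->
  enc_instance (reduction w m) =
  fixed_part ++ (flatten [seq true :: enc_template m t | t <- static_edges M] ++
    flatten [seq true :: enc_template m (input_edge M x (nth false w x)) | x <- iota 0 (size w)] ++
     (true :: enc_template m (beyond_edge M (size w))) ++ [:: false]) ++
  enc_seq enc_bool (shifted_digits m 0).
Proof.
move=> Hm Hw; rewrite /enc_instance /enc_TA.
have -> : [seq loc_inv (automaton (reduction w m)) l | l <- enum 'I_#|{: loc M}|] =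
    [seq [::] | _ <- enum 'I_#|{: loc M}|] by apply: eq_map => l; rewrite ffunE.
have -> : enc_seq (@enc_edge _ _ 2) (edges (automaton (reduction w m))) =
    enc_seq (enc_template m) (templates M w).
  by apply: enc_insts => t; apply: offsets_templates.
have -> : enc_nat (nobs (reduction w m)) = enc_seq enc_bool (shifted_digits m 0).
  by rewrite /enc_nat -shifted_digitsE ?expn_gt0 // addn0.
have -> : enc_seq (enc_template m) (templates M w) =
    flatten [seq true :: enc_template m t | t <- static_edges M] ++
    flatten [seq true :: enc_template m (input_edge M x (nth false w x)) | x <- iota 0 (size w)] ++
     (true :: enc_template m (beyond_edge M (size w))) ++ [:: false].
  by rewrite /templates /input_edges enc_seq_split -map_comp.
by rewrite /fixed_part -!catA.
Qed.

Lemma FP_enc_tconstr (A : encType) (m k : A -> nat) x c b : FP m -> FP k ->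
  FP (fun a => enc_tconstr (m a) ((x, c), (b, k a))).
Proof.
move=> Hm Hk; apply: (FP_cat (FP_const A (enc_nat x))).
apply: (FP_cat (FP_const A (enc_nat (nat_of_cmp c)))); apply: (FP_cons (FP_const A false)).
apply: (@FP_enc_seq _ _ (fun _ => enc_bool)); last first.
  by apply: (@FP_shifted_digits A (fun a => m a + b) k) => //; fp.
by rewrite /enc_bool; fp.
Qed.

Lemma FP_enc_template (A : encType) (m k : A -> nat) l x c b u R l' : FP m -> FP k ->
  FP (fun a => enc_template (m a) (mk l [:: ((x, c), (b, k a))] u R l')).
Proof.
move=> Hm Hk; apply: (FP_cat (FP_const A (enc_nat (rk l)))); apply: FP_cat; last exact: FP_const.
apply: (FP_cons (FP_const A true)).
by apply: FP_cat; [apply: FP_enc_tconstr|apply: FP_const].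
Qed.

Lemma FP_reduction (m : seq bool -> nat) : FP m -> (forall w, 3 <= m w) -> (forall w, size w <= m w) ->
  FP (fun w => enc_instance (reduction w (m w))).
Proof.
move=> Hm H3 Hs; pose In := prod_encType (seq_encType bool_encType) nat_encType.
pose tpl (p : In) b := true :: enc_template (m p.1) (input_edge M p.2 b).
have Ht b : FP (tpl^~ b).
  apply: FP_cons; first exact: FP_const.
  by apply: FP_enc_template; [exact: FP_comp Hm (FP_arg1 _ _)|exact: FP_arg2].
have Hst t : FP (fun w => true :: enc_template (m w) t).
  apply: FP_cons; first exact: FP_const.
  case: t => -[[[l g] a] R] l'; apply: FP_cat; first exact: FP_const.
  apply: FP_cat; last exact: FP_const.
  apply: (@FP_ext _ _ (fun w => flatten [seq true :: enc_tconstr (m w) c | c <- g] ++ [:: false])).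
    by move=> w; rewrite enc_seqE.
  apply: FP_cat; last exact: FP_const.
  apply: (@FP_flatten_const _ _ g (fun w c => true :: enc_tconstr (m w) c)) => -[[x c] [b k]].
  apply: FP_cons; first exact: FP_const.
  by apply: FP_enc_tconstr => //; apply: FP_const.
apply: FP_ext (fun w => esym (enc_reduction (H3 w) (Hs w))) _.
apply: FP_cat; first exact: FP_const.
apply: FP_cat; last first.
  apply: (@FP_enc_seq _ _ (fun _ => enc_bool)); first by rewrite /enc_bool; fp.
  by apply: FP_shifted_digits => //; apply: FP_const.
apply: FP_cat; first exact: (@FP_flatten_const _ _ _ (fun w t => true :: enc_template (m w) t)).
apply: FP_cat; last first.
  apply: FP_cat; last exact: FP_const.
  apply: FP_cons; first exact: FP_const.
  by apply: (@FP_enc_template _ m (fun w => size w)) => //; apply: FP_size; apply: FP_id.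
apply: (@FP_flatmap _ _ _ (fun w x => true :: enc_template (m w) (input_edge M x (nth false w x)))); last by fp.
(* The input bit selects the target location, whose rank is an opaque constant; testing the bit
   leaves one constant in each branch. *)
apply: (@FP_ext _ _ (fun p : In => if nth false p.1 p.2 then tpl p true else tpl p false)).
  by move=> p; rewrite /tpl; case: (nth _ _ _).
by apply: FP_if => //; fp.
Qed.

End ReductionEncoding.

(** Equal encodings give equal raw forms, and by [opaqueE] opacity depends on the raw form and
    [nobs] only. This avoids comparing dependent records. *)
Lemma problem_opaque weak i : problem (opaque weak) (enc_instance i) <-> opaque weak i.
Proof.
split; last by exists i.
move=> [j Ej Hj]; apply: NNPP => Hi.
have Er : raw_of j = raw_of i.
  have E : Some (raw_of j, [::]) = Some (raw_of i, [::]) :> option (rinst * seq bool).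
    by rewrite -!(cencK rinst_codec) !cats0 -!enc_raw Ej.
  exact: (congr1 (fun o => if o is Some p then p.1 else raw_of i) E).
have [H1 H2 _] := raw_small (leqnn (size (cenc rinst_codec (raw_of i)))).
have En : nobs j = nobs i.
  by rewrite -(value_digits (nobs j)) -(value_digits (nobs i)); apply: (congr1 (fun r => value (r_nobs r)) Er).
move: Hj; apply/(opaqueE weak (C := 2 ^ size (cenc rinst_codec (raw_of i)))); rewrite Er ?En //.
by apply/(opaqueE weak H1 H2).
Qed.

Lemma opacity_coNEXPTIME_hard weak (Q : language) :
  coNEXPTIME Q -> polytime_reducible Q (problem (opaque weak)).
Proof.
move=> [M [p [Htime Hacc]]].
(* The summand [size w] bounds the input offsets; the 3 covers the constant offsets and makes
   [2 ^ m] exceed the time bound by more than one. *)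
pose m (w : seq bool) : nat := (p.[size w])%R + size w + 3.
exists (fun w => enc_instance (reduction M w (m w))).
  apply: FP_polytime; apply: FP_reduction => [|w|w]; rewrite /m; try lia.
  have Hs := FP_size (FP_id (seq_encType bool_encType)).
  exact: FP_addn (FP_addn (FP_horner p Hs) Hs) (FP_const _ 3).
move=> w; rewrite problem_opaque.
have Hb : (2 ^ (p.[size w])%R).+1 < 2 ^ m w.
  rewrite /m -addnA expnD addnC expnD; have := expn_gt0 2 (p.[size w])%R; have := expn_gt0 2 (size w); nia.
rewrite (opaque_reductTA weak Hb (Htime w)) -Hacc.
by split; [move=> ? ?|apply: NNPP].
Qed.

Theorem theorem6p36 :
  complete_for coNEXPTIME WeakFirstObsOpacity /\
  complete_for coNEXPTIME FullFirstObsOpacity.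
Proof.
split; split.
- exact: (@nonopacity_NEXPTIME true).
- exact: (@opacity_coNEXPTIME_hard true).
- exact: (@nonopacity_NEXPTIME false).
- exact: (@opacity_coNEXPTIME_hard false).
Qed.
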